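(* Let $c_1\in[1,16/15)$, $c_2\in[1,17/16)$, $\gamma_1=1/c_1$, $\gamma_2=1/c_2$, and let $h_1\in\mathcal{R}_{c_1}$, $h_2\in\mathcal{R}_{c_2}$, $\psi$ and $B$ be as in the context. For every $\chi>0$ such that $16(1-\gamma_1)+17(1-\gamma_2)+31\chi\le1$ there exists $\chi'>0$ such that for all $a,q\in\mathbb{Z}$ with $0\le a\le q-1$ and $(a,q)=1$, all $N\in\mathbb{N}$ and all $\xi\in\mathbb{T}$, \[ \sum_{\substack{p\in \mathbb{P}_B\cap [N] \\ p\equiv a\ (\mathrm{mod}\ q)}} \psi(p)^{-1}\log(p)\, e^{2\pi i p\xi}= \sum_{\substack{p\in \mathbb{P}\cap[N] \\ p\equiv a\ (\mathrm{mod}\ q)}} \log(p)\,e^{2\pi i p\xi} +O(N^{1-\chi-\chi'}), \] where the implied constant does not depend on $\xi,N,a,q$.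
   Context: $\mathbb{P}$ is the set of primes, $[N]=\{1,\dots,N\}$, $\{x\}=x-\lfloor x\rfloor$, $\mathbb{T}=\mathbb{R}/\mathbb{Z}$. The implied constant may depend on $h_1,h_2,\psi,\chi,\chi'$. Fix $x_0\ge 1$. $\mathcal{L}$ is the set of functions $\ell\colon[x_0,\infty)\to[1,\infty)$ of the form $\ell(x)=\exp\big(\int_{x_0}^x\frac{\vartheta(t)}{t}dt\big)$ where $\vartheta\in\mathcal{C}^2([x_0,\infty))$ is real-valued with $\vartheta(x)\to0$, $x\vartheta'(x)\to0$, $x^2\vartheta''(x)\to0$ as $x\to\infty$. $\mathcal{L}_0$ is the set of functions $\ell\colon[x_0,\infty)\to[1,\infty)$ of the same form where $\vartheta\in\mathcal{C}^2([x_0,\infty))$ is positive and decreasing with $\vartheta(x)\to0$, $\frac{x\vartheta'(x)}{\vartheta(x)}\to0$, $\frac{x^2\vartheta''(x)}{\vartheta(x)}\to0$ as $x\to\infty$, and such that for every $\varepsilon>0$ there is $C_\varepsilon>0$ with $\vartheta(x)\ge C_\varepsilon x^{-\varepsilon}$, and $\lim_{x\to\infty}\ell(x)=\infty$. For $c\in(1,\infty)$, $\mathcal{R}_c$ is the set of functions $h\colon[x_0,\infty)\to[1,\infty)$ that are strictly increasing, convex and of the form $h(x)=x^c\ell(x)$ with $\ell\in\mathcal{L}$; $\mathcal{R}_1$ is defined in the same way with $c=1$ and $\ell\in\mathcal{L}_0$. Given $h_1\in\mathcal{R}_{c_1}$, $h_2\in\mathcal{R}_{c_2}$, let $\varphi_1,\varphi_2$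 be the inverse functions of $h_1,h_2$. Fix a function $\psi\colon[1,\infty)\to(0,1/2]$, $\psi\in\mathcal{C}^2([1,\infty))$, with $\psi(x)\sim\varphi_2'(x)$, $\psi'(x)\sim\varphi_2''(x)$, $\psi''(x)\sim\varphi_2'''(x)$ as $x\to\infty$ ($f\sim g$ means $f/g\to1$). Define $B=\{n\in\mathbb{N}:\{\varphi_1(n)\}<\psi(n)\}$, where only $n$ in the domain $[h_1(x_0),\infty)$ of $\varphi_1$ are considered, and $\mathbb{P}_B=\mathbb{P}\cap B$. *)

(* Defs.v *)
From Stdlib Require Import Reals ZArith Znumtheory ClassicalEpsilon.
From Coquelicot Require Import Coquelicot.
Open Scope R_scope.

(* A function on a half-line [a, oo) is represented by a function R -> R, of
   which only the values on [a, oo) are constrained. *)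
Definition ray (a x : R) : Prop := a <= x.

(* f is C^2 on D with derivatives f1, f2. These are taken within D, hence
   one-sided at the endpoint of a ray. *)
Definition C2_on (D : R -> Prop) (f f1 f2 : R -> R) : Prop :=
  forall x, D x -> D_in f f1 D x /\ D_in f1 f2 D x /\ continue_in f2 D x.

Definition asymp_equiv (f g : R -> R) : Prop :=
  is_lim (fun x => f x / g x) p_infty 1.

Definition strictly_increasing_on (D : R -> Prop) (f : R -> R) : Prop :=
  forall x y, D x -> D y -> x < y -> f x < f y.

Definition decreasing_on (D : R -> Prop) (f : R -> R) : Prop :=
  forall x y, D x -> D y -> x <= y -> f y <= f x.

Definition convex_on (D : R -> Prop) (f : R -> R) : Prop :=
  forall x y t, D x -> D y -> 0 <= t <= 1 ->
    f (t * x + (1 - t) * y) <= t * f x + (1 - t) * f y.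

Definition exp_form (x0 : R) (theta ell : R -> R) : Prop :=
  forall x, x0 <= x -> ell x = exp (RInt (fun t => theta t / t) x0 x).

Definition class_L (x0 : R) (ell : R -> R) : Prop :=
  (forall x, x0 <= x -> 1 <= ell x) /\
  exists theta theta1 theta2 : R -> R,
    C2_on (ray x0) theta theta1 theta2 /\
    exp_form x0 theta ell /\
    is_lim theta p_infty 0 /\
    is_lim (fun x => x * theta1 x) p_infty 0 /\
    is_lim (fun x => x ^ 2 * theta2 x) p_infty 0.

Definition class_L0 (x0 : R) (ell : R -> R) : Prop :=
  (forall x, x0 <= x -> 1 <= ell x) /\
  (exists theta theta1 theta2 : R -> R,
    C2_on (ray x0) theta theta1 theta2 /\
    exp_form x0 theta ell /\
    (forall x, x0 <= x -> 0 < theta x) /\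
    decreasing_on (ray x0) theta /\
    is_lim theta p_infty 0 /\
    is_lim (fun x => x * theta1 x / theta x) p_infty 0 /\
    is_lim (fun x => x ^ 2 * theta2 x / theta x) p_infty 0 /\
    (forall eps, 0 < eps -> exists C, 0 < C /\
       forall x, x0 <= x -> C * Rpower x (- eps) <= theta x)) /\
  is_lim ell p_infty p_infty.

Definition class_R (x0 c : R) (h : R -> R) : Prop :=
  (forall x, x0 <= x -> 1 <= h x) /\
  strictly_increasing_on (ray x0) h /\
  convex_on (ray x0) h /\
  exists ell : R -> R,
    (forall x, x0 <= x -> h x = Rpower x c * ell x) /\
    ((c = 1 /\ class_L0 x0 ell) \/ (1 < c /\ class_L x0 ell)).

(* phi : [h x0, oo) -> [x0, oo) is the inverse function of h. *)
Definition inverse_on_ray (x0 : R) (h phi : R -> R) : Prop :=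
  (forall x, x0 <= x -> phi (h x) = x) /\
  (forall y, h x0 <= y -> x0 <= phi y /\ h (phi y) = y).

Definition admissible_psi (phi2 psi : R -> R) : Prop :=
  (forall x, 1 <= x -> 0 < psi x <= 1 / 2) /\
  exists psi1 psi2 : R -> R,
    C2_on (ray 1) psi psi1 psi2 /\
    asymp_equiv psi (Derive_n phi2 1) /\
    asymp_equiv psi1 (Derive_n phi2 2) /\
    asymp_equiv psi2 (Derive_n phi2 3).

Definition set_B (x0 : R) (h1 phi1 psi : R -> R) (n : nat) : Prop :=
  h1 x0 <= INR n /\ frac_part (phi1 (INR n)) < psi (INR n).

Definition nat_prime (n : nat) : Prop := prime (Z.of_nat n).

(* e^(2 pi i x) *)
Definition e2pi (x : R) : C := (cos (2 * PI * x), sin (2 * PI * x)).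

(* The sum of f n over the n in {1, ..., N} satisfying P. *)
Definition sum_upto (N : nat) (P : nat -> Prop) (f : nat -> C) : C :=
  sum_n_m (fun n => if excluded_middle_informative (P n) then f n else zero) 1 N.

(* Main.v *)
(** Writing [1_B(n) = psi(n) + Phi(phi1(n) - psi(n)) - Phi(phi1(n))] with the sawtooth
    [Phi(x) = {x} - 1/2], and truncating the Fourier series of [Phi] at
    [M = N^(1 - 1/c2 + chi + small)], reduces the claim to exponential sums over primes with
    phase [n xi + m phi1(n)], [1 <= m <= M]. The factor [(e(-m psi) - 1) / psi] has size and
    total variation [O(m)] on dyadic blocks and is removed by partial summation. The truncation
    error is dominated by an average of Fejer kernels, hence by exponential sums over all
    integers. Vaughan's identity turns the prime sums into linear and bilinear sums, both
    estimated with van der Corput's second derivative test; for the bilinear ones the inner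
    variable is cut into short blocks before Cauchy-Schwarz is applied. The test only needs
    [G(y) = - y^2 phi1''(y)] to vary at a polynomial rate, which follows from the
    regular variation of [h1]. Residue classes are detected by additive characters, which
    shift [xi] by rational numbers, so uniformity in [xi] gives uniformity in [a] and [q]. *)

Require Import Defs.
From Stdlib Require Import Reals ZArith Znumtheory Lra Lia Psatz ClassicalEpsilon.
From Coquelicot Require Import Coquelicot.
From HB Require Import structures.
From mathcomp Require all_boot zify.
Open Scope R_scope.

(** Second differences annihilate the linear phase n xi, so no estimate ever sees xi. The price is
    that phi1'' must be known well from both sides. When c1 = 1, theta tends to 0, and G y / y with
    it, only slower than any power. Bounds for theta' and theta'' are therefore kept relative to c1
    - 1 + theta, which is the true order of G y / phi1 y, and G itself enters only through y^(9/10)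
    <= G y <= 2 y. After Cauchy-Schwarz the phase is F (k l') - F (k l); its second derivative in k
    is governed by G', hence by theta''. Within a block l' - l stays between 1 and J, and J trades
    the diagonal against the size of this derivative. A prime sum with multiplier m <= N^mu then has
    exponent 9/10 + mu/2 or 11/12 + mu/4. Summing over the N^mu multipliers asks for (3/2) mu + chi
    < 1/10 and (5/4) mu + chi < 1/12, with mu slightly above 1 - 1/c2 + chi; this is what 17 (1 -
    1/c2) + 31 chi <= 1 provides. *)

Module PrimeSums.
Import all_boot zify.
Delimit Scope R_scope with R.
Local Open Scope R_scope.
Arguments pow : simpl never.
Arguments Cmult : simpl never.
Arguments Cplus : simpl never.
Arguments INR : simpl never.

(** * Finite sums *)

(** These instances make the generic [bigop] lemmas, such as [exchange_big] and [big_distrr],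
    available for sums of real and complex numbers. *)
HB.instance Definition _ := Monoid.isComLaw.Build R 0 Rplus
  (fun x y z => esym (Rplus_assoc x y z)) Rplus_comm Rplus_0_l.
HB.instance Definition _ := Monoid.isMulLaw.Build R 0 Rmult Rmult_0_l Rmult_0_r.
HB.instance Definition _ := Monoid.isAddLaw.Build R Rmult Rplus
  Rmult_plus_distr_r Rmult_plus_distr_l.
HB.instance Definition _ := Monoid.isComLaw.Build C (RtoC 0) Cplus
  Cplus_assoc Cplus_comm Cplus_0_l.
HB.instance Definition _ := Monoid.isMulLaw.Build C (RtoC 0) Cmult Cmult_0_l Cmult_0_r.
HB.instance Definition _ := Monoid.isAddLaw.Build C Cmult Cplus
  Cmult_plus_distr_r Cmult_plus_distr_l.

Notation "\sum_ ( i <- r ) F" := (\big[Rplus/0]_(i <- r) F) : R_scope.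
Notation "\sum_ ( i <- r | P ) F" := (\big[Rplus/0]_(i <- r | P) F) : R_scope.
Notation "\sum_ ( m <= i < n ) F" := (\big[Rplus/0]_(m <= i < n) F) : R_scope.
Notation "\sum_ ( m <= i < n | P ) F" := (\big[Rplus/0]_(m <= i < n | P) F) : R_scope.
Notation "\sum_ ( i <- r ) F" := (\big[Cplus/(RtoC 0)]_(i <- r) F) : C_scope.
Notation "\sum_ ( i <- r | P ) F" := (\big[Cplus/(RtoC 0)]_(i <- r | P) F) : C_scope.
Notation "\sum_ ( m <= i < n ) F" := (\big[Cplus/(RtoC 0)]_(m <= i < n) F) : C_scope.
Notation "\sum_ ( m <= i < n | P ) F" := (\big[Cplus/(RtoC 0)]_(m <= i < n | P) F) : C_scope.

Lemma Rsum_ge0 (I : Type) (r : seq I) (P : pred I) (F : I -> R) :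
  (forall i, P i -> 0 <= F i) -> 0 <= \sum_(i <- r | P i) F i.
Proof. move=> H; elim/big_ind: _ => //; [lra|move=> *; lra]. Qed.

Lemma Rsum_le (I : Type) (r : seq I) (P : pred I) (F G : I -> R) :
  (forall i, P i -> F i <= G i) -> \sum_(i <- r | P i) F i <= \sum_(i <- r | P i) G i.
Proof. move=> H; elim/big_ind2: _ => //; [lra|move=> *; lra]. Qed.

Lemma Rsum_le_nat m n (F G : nat -> R) :
  (forall i, (m <= i < n)%N -> F i <= G i) ->
  \sum_(m <= i < n) F i <= \sum_(m <= i < n) G i.
Proof.
move=> H; rewrite big_nat_cond [X in _ <= X]big_nat_cond.
by apply: Rsum_le => i; rewrite andbT; apply: H.
Qed.

Lemma Rsum_const (m n : nat) c : \sum_(m <= i < n) c = INR (n - m) * c.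
Proof.
rewrite big_const_nat; elim: (n - m)%N => [|k IH]; first by rewrite /= (_ : INR 0 = 0) //; lra.
by rewrite iterS IH S_INR; lra.
Qed.

Lemma Rsum_mull (I : Type) (r : seq I) (P : pred I) c (F : I -> R) :
  c * (\sum_(i <- r | P i) F i) = \sum_(i <- r | P i) (c * F i).
Proof. by rewrite big_distrr. Qed.

Lemma Csum_mull (I : Type) (r : seq I) (P : pred I) c (F : I -> C) :
  (c * (\sum_(i <- r | P i) F i) = \sum_(i <- r | P i) (c * F i))%C.
Proof. by rewrite big_distrr. Qed.

Lemma Csum_mulr (I : Type) (r : seq I) (P : pred I) c (F : I -> C) :
  ((\sum_(i <- r | P i) F i) * c = \sum_(i <- r | P i) (F i * c))%C.
Proof. by rewrite big_distrl. Qed.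

Lemma Cmod_sum (I : Type) (r : seq I) (P : pred I) (F : I -> C) :
  Cmod (\sum_(i <- r | P i) F i)%C <= \sum_(i <- r | P i) Cmod (F i).
Proof.
elim/big_ind2: _ => [|x1 x2 y1 y2 H1 H2|i _]; [rewrite Cmod_0; lra| |lra].
by apply: Rle_trans (Cmod_triangle _ _) _; lra.
Qed.

Lemma Cmod_sum_le m n (F : nat -> C) (G : nat -> R) :
  (forall i, (m <= i < n)%N -> Cmod (F i) <= G i) ->
  Cmod (\sum_(m <= i < n) F i)%C <= \sum_(m <= i < n) G i.
Proof. by move=> H; apply: Rle_trans (Cmod_sum _ _ _ _) _; exact: Rsum_le_nat. Qed.

Lemma Csum_conj (I : Type) (r : seq I) (P : pred I) (F : I -> C) :
  Cconj (\sum_(i <- r | P i) F i)%C = (\sum_(i <- r | P i) Cconj (F i))%C.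
Proof.
apply: (big_morph Cconj Cplus_conj).
by rewrite /Cconj /= Ropp_0.
Qed.

Lemma RtoC_sum (I : Type) (r : seq I) (P : pred I) (F : I -> R) :
  RtoC (\sum_(i <- r | P i) F i) = (\sum_(i <- r | P i) RtoC (F i))%C.
Proof. by apply: (big_morph RtoC RtoC_plus). Qed.

Lemma Csum_sub (I : Type) (r : seq I) (P : pred I) (F G : I -> C) :
  ((\sum_(i <- r | P i) F i) - (\sum_(i <- r | P i) G i) =
   \sum_(i <- r | P i) (F i - G i))%C.
Proof.
have -> : (\sum_(i <- r | P i) (F i - G i) = \sum_(i <- r | P i) (F i + (- 1) * G i))%C.
  by apply: eq_bigr => i _; ring.
by rewrite big_split /= -Csum_mull; ring.
Qed.

(** The quadratic A - 2 t B + t^2 Z, being the sum of the squares (|a i| - t |z i|)^2, is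
    nonnegative for every t; evaluating it at t = B / Z gives the bound. *)
Lemma Csum_cauchy_schwarz (I : Type) (r : seq I) (a z : I -> C) :
  Cmod (\sum_(i <- r) (a i * z i))%C ^ 2 <=
  (\sum_(i <- r) Cmod (a i) ^ 2) * (\sum_(i <- r) Cmod (z i) ^ 2).
Proof.
have H : Cmod (\sum_(i <- r) (a i * z i))%C <= \sum_(i <- r) (Cmod (a i) * Cmod (z i)).
  by apply: Rle_trans (Cmod_sum _ _ _ _) _; apply: Rsum_le => i _; rewrite Cmod_mult; lra.
have H2 : (\sum_(i <- r) (Cmod (a i) * Cmod (z i))) ^ 2 <=
    (\sum_(i <- r) Cmod (a i) ^ 2) * (\sum_(i <- r) Cmod (z i) ^ 2).
  set A := \sum_(i <- r) Cmod (a i) ^ 2; set Z := \sum_(i <- r) Cmod (z i) ^ 2.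
  set B := \sum_(i <- r) (Cmod (a i) * Cmod (z i)).
  have Q t : 0 <= A - 2 * t * B + t ^ 2 * Z.
    have -> : A - 2 * t * B + t ^ 2 * Z =
        \sum_(i <- r) (Cmod (a i) - t * Cmod (z i)) ^ 2.
      transitivity (\sum_(i <- r) (Cmod (a i) ^ 2 +
        ((- 2 * t) * (Cmod (a i) * Cmod (z i)) + t ^ 2 * Cmod (z i) ^ 2))).
        by rewrite !big_split /= -!Rsum_mull /A /B /Z; lra.
      by apply: eq_bigr => i _; ring.
    by apply: Rsum_ge0 => i _; apply: pow2_ge_0.
  have A0 : 0 <= A by apply: Rsum_ge0 => i _; apply: pow2_ge_0.
  have Z0 : 0 <= Z by apply: Rsum_ge0 => i _; apply: pow2_ge_0.
  case: (Rle_lt_or_eq_dec _ _ Z0) => [Zp|Ze].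
    have := Q (B / Z); have -> : A - 2 * (B / Z) * B + (B / Z) ^ 2 * Z = A - B ^ 2 / Z.
      by field; lra.
    move=> h; have h2 : B ^ 2 / Z <= A by lra.
    have : B ^ 2 / Z * Z <= A * Z by apply: Rmult_le_compat_r; lra.
    by have -> : B ^ 2 / Z * Z = B ^ 2 by field; lra.
  rewrite -Ze in Q *.
  (* With Z = 0 the quadratic is affine in t, and t = (A + 1) / B would make it equal to - A - 2. *)
  case: (Req_dec B 0) => [->|Bn]; first by lra.
  have := Q ((A + 1) / B); have -> : A - 2 * ((A + 1) / B) * B + ((A + 1) / B) ^ 2 * 0 = - A - 2.
    by field.
  by lra.
apply: Rle_trans H2; apply: pow_incr; split=> //; apply: Cmod_ge_0.
Qed.

Lemma Cmod2_sum (I : Type) (r : seq I) (z : I -> C) :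
  RtoC (Cmod (\sum_(i <- r) z i)%C ^ 2) =
  (\sum_(i <- r) \sum_(j <- r) (z i * Cconj (z j)))%C.
Proof.
rewrite Cmod2_conj Csum_conj Csum_mulr; apply: eq_bigr => i _.
by rewrite Csum_mull.
Qed.

Lemma Csum_telescope (F : nat -> C) a b : (a <= b)%N ->
  (\sum_(a <= n < b) (F n.+1 - F n) = F b - F a)%C.
Proof.
move=> /subnKC <-; elim: (b - a)%N => [|k IH].
  by rewrite addn0 big_geq //; ring.
by rewrite addnS big_nat_recr ?leq_addr //= IH; ring.
Qed.

Lemma Rsum_telescope (F : nat -> R) a b : (a <= b)%N ->
  \sum_(a <= n < b) (F n.+1 - F n) = F b - F a.
Proof.
move=> /subnKC <-; elim: (b - a)%N => [|k IH].
  by rewrite addn0 big_geq //; ring.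
by rewrite addnS big_nat_recr ?leq_addr //= IH; ring.
Qed.

Lemma abel_summation (w z : nat -> C) a b : (a <= b)%N ->
  (\sum_(a <= n < b.+1) (w n * z n) =
   w b * (\sum_(a <= n < b.+1) z n)
   - \sum_(a <= n < b) ((w n.+1 - w n) * (\sum_(a <= k < n.+1) z k)))%C.
Proof.
move=> /subnKC <-; elim: (b - a)%N => [|k IH].
  by rewrite addn0 !big_nat1 [X in (_ - X)%C]big_geq //; ring.
rewrite addnS big_nat_recr /=; last by lia.
rewrite IH [X in (_ = _ - X)%C]big_nat_recr /=; last by lia.
rewrite [X in (_ = _ * X - _)%C]big_nat_recr /=; last by lia.
by ring.
Qed.

(** Only the last weight and the total variation enter, so a slowly varying weight can be stripped
    off any sum whose initial segments are under control. *)
Lemma abel_bound (w z : nat -> C) a b W V X : (a <= b)%N -> 0 <= X ->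
  Cmod (w b) <= W ->
  \sum_(a <= n < b) Cmod (w n.+1 - w n)%C <= V ->
  (forall c, (a <= c <= b)%N -> Cmod (\sum_(a <= n < c.+1) z n)%C <= X) ->
  Cmod (\sum_(a <= n < b.+1) (w n * z n))%C <= (W + V) * X.
Proof.
move=> ab X0 HW HV HX; rewrite abel_summation //.
apply: Rle_trans (Cmod_triangle _ _) _; rewrite Cmod_opp Cmod_mult.
have h1 : Cmod (w b) * Cmod (\sum_(a <= n < b.+1) z n)%C <= W * X.
  apply: Rmult_le_compat => //; try apply: Cmod_ge_0.
  by apply: HX; rewrite ab leqnn.
suff h2 : Cmod (\sum_(a <= n < b) ((w n.+1 - w n) * (\sum_(a <= k < n.+1) z k)))%C <= V * X by lra.
apply: (Rle_trans _ (\sum_(a <= n < b) (X * Cmod (w n.+1 - w n)%C))).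
  apply: Cmod_sum_le => i /andP[ai ib]; rewrite Cmod_mult Rmult_comm.
  apply: Rmult_le_compat_r; first exact: Cmod_ge_0.
  by apply: HX; rewrite ai ltnW.
rewrite -Rsum_mull Rmult_comm; exact: Rmult_le_compat_r.
Qed.

Lemma Cconj_R (x : R) : Cconj (RtoC x) = RtoC x.
Proof. by rewrite /Cconj /RtoC /= Ropp_0. Qed.

(** * The van der Corput second derivative test *)

Lemma e2piD x y : e2pi (x + y) = (e2pi x * e2pi y)%C.
Proof.
rewrite /e2pi /Cmult /= Rmult_plus_distr_l cos_plus sin_plus.
by congr (_, _); ring.
Qed.

Lemma Cmod_e2pi x : Cmod (e2pi x) = 1.
Proof.
rewrite /Cmod /e2pi /= -[RHS]sqrt_1; congr sqrt.
by have := sin2_cos2 (2 * PI * x); rewrite /Rsqr; lra.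
Qed.

Lemma Cconj_e2pi x : Cconj (e2pi x) = e2pi (- x).
Proof.
by rewrite /Cconj /e2pi /= (_ : 2 * PI * - x = - (2 * PI * x)) ?cos_neg ?sin_neg; last by ring.
Qed.

Lemma e2pi_Z k : e2pi (IZR k) = RtoC 1.
Proof.
have s0 : sin (PI * IZR k) = 0 by apply: sin_eq_0_1; exists k; ring.
rewrite /e2pi (_ : 2 * PI * IZR k = 2 * (PI * IZR k)); last by ring.
by rewrite cos_2a_sin sin_2a s0 /RtoC; congr (_, _); ring.
Qed.

Lemma e2pi_0 : e2pi 0 = RtoC 1.
Proof. exact: e2pi_Z 0%Z. Qed.

Lemma e2piB x y : (e2pi x * e2pi (- y) = e2pi (x - y))%C.
Proof. by rewrite -e2piD. Qed.

Lemma Rabs_sin_le x : Rabs (sin x) <= Rabs x.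
Proof.
have P y : 0 <= y -> Rabs (sin y) <= y.
  move=> y0; case: (Rle_lt_dec y 1) => y1.
    rewrite Rabs_pos_eq; last by apply: sin_ge_0; have := PI_RGT_0; have := PI2_1; lra.
    by case: (Req_dec y 0) => [->|?]; [rewrite sin_0; lra | apply/Rlt_le/sin_lt_x; lra].
  apply: (Rle_trans _ 1); last lra.
  by apply: Rabs_le; exact: SIN_bound.
case: (Rle_lt_dec 0 x) => x0; first by rewrite (Rabs_pos_eq x) //; exact: P.
rewrite (Rabs_left x) // -Rabs_Ropp -sin_neg; apply: P; lra.
Qed.

Lemma Cmod_e2piB x y : Cmod (e2pi x - e2pi y)%C = 2 * Rabs (sin (PI * (x - y))).
Proof.
rewrite -(sqrt_Rsqr_abs) -[X in X * _](sqrt_Rsqr 2); last lra.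
rewrite -sqrt_mult; try exact: Rle_0_sqr.
rewrite /Cmod; congr sqrt; rewrite /e2pi /Cminus /Cplus /Copp /=.
have := sin2_cos2 (2 * PI * x); have := sin2_cos2 (2 * PI * y); rewrite /Rsqr => h1 h2.
have h3 : cos (2 * (PI * (x - y))) = 1 - 2 * sin (PI * (x - y)) * sin (PI * (x - y)).
  exact: cos_2a_sin.
rewrite (_ : 2 * (PI * (x - y)) = 2 * PI * x - 2 * PI * y) in h3; last by ring.
rewrite cos_minus in h3; nra.
Qed.

Lemma e2pi_lip x y : Cmod (e2pi x - e2pi y)%C <= 2 * PI * Rabs (x - y).
Proof.
rewrite Cmod_e2piB.
have := Rabs_sin_le (PI * (x - y)); rewrite Rabs_mult (Rabs_pos_eq PI); first lra.
by have := PI_RGT_0; lra.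
Qed.

Lemma sin_piB s : sin (PI * (1 - s)) = sin (PI * s).
Proof. by rewrite -[RHS]sin_PI_x; congr sin; ring. Qed.

(** Symmetry about 1/2 reduces to t <= 1/2. There the Taylor polynomial of degree 7 bounds sin (pi
    t) below by pi t / 3, and pi >= 3. *)
Lemma sin_pi_lb s : 0 <= s <= 1 -> Rmin s (1 - s) <= sin (PI * s).
Proof.
have P t : 0 <= t <= 1 / 2 -> t <= sin (PI * t).
  move=> t0; set x := PI * t.
  have pi3 : 3 <= PI by have := PI2_3_2; lra.
  have pi4 : PI <= 4 by exact: PI_4.
  have x0 : 0 <= x <= 2 by rewrite /x; nra.
  have x1 : x <= PI by rewrite /x; nra.
  have [h _] := SIN x (proj1 x0) x1; apply: Rle_trans h.
  rewrite /sin_lb /sin_approx /sin_term /= /pow /=.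
  rewrite /fact /Nat.mul /Nat.add /INR.
  suff : x / 3 <= x * (1 - x ^ 2 / 6 + (x ^ 4 / 120) - (x ^ 6 / 5040)).
    by rewrite {1}/x /pow; nra.
  have y0 : 0 <= x ^ 2 <= 4 by rewrite /pow; nra.
  rewrite (_ : x ^ 4 = x ^ 2 * x ^ 2); last by ring.
  rewrite (_ : x ^ 6 = x ^ 2 * x ^ 2 * x ^ 2); last by ring.
  move: (x ^ 2) y0 => y y0.
  have : 1 / 3 <= 1 - y / 6 + y * y / 120 - y * y * y / 5040.
    have : 0 <= y * y * (4 - y) by apply: Rmult_le_pos; nra.
    nra.
  nra.
move=> s01; rewrite /Rmin; case: Rle_dec => h; first by apply: P; lra.
by rewrite -sin_piB; apply: P; lra.
Qed.

Lemma sin_pi_ge s t : 0 < t -> t <= s <= 1 - t -> t <= sin (PI * s).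
Proof.
move=> t0 h; apply: Rle_trans (sin_pi_lb s _); last lra.
by apply: Rmin_glb; lra.
Qed.

Definition cotpi s := cos (PI * s) / sin (PI * s).

Lemma cotpi_bound s t : 0 < t -> t <= s <= 1 - t -> Rabs (cotpi s) <= / t.
Proof.
move=> t0 h; have S := sin_pi_ge _ _ t0 h.
rewrite /cotpi Rabs_mult Rabs_inv (Rabs_pos_eq (sin _)); last lra.
have c1 : Rabs (cos (PI * s)) <= 1 by apply: Rabs_le; exact: COS_bound.
have : / sin (PI * s) <= / t by apply: Rinv_le_contravar.
have : 0 < / sin (PI * s) by apply: Rinv_0_lt_compat; lra.
have := Rabs_pos (cos (PI * s)); nra.
Qed.

Lemma cotpi_decr s t : 0 < s -> s <= t < 1 -> cotpi t <= cotpi s.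
Proof.
move=> s0 [st t1].
have pp := PI_RGT_0.
have ss : 0 < sin (PI * s) by apply: sin_gt_0; nra.
have tt : 0 < sin (PI * t) by apply: sin_gt_0; nra.
have d : 0 <= sin (PI * t - PI * s) by apply: sin_ge_0; nra.
rewrite sin_minus in d.
apply: (Rmult_le_reg_r (sin (PI * s) * sin (PI * t))); first nra.
rewrite /cotpi.
have -> : cos (PI * t) / sin (PI * t) * (sin (PI * s) * sin (PI * t)) = cos (PI * t) * sin (PI * s).
  by field; lra.
have -> : cos (PI * s) / sin (PI * s) * (sin (PI * s) * sin (PI * t)) = cos (PI * s) * sin (PI * t).
  by field; lra.
lra.
Qed.

(* [1 / (e(d) - 1) = - 1/2 - (i/2) cot (pi d)], whose variation in [d] telescopes. *)
Lemma e2pi_diff x d : sin (PI * d) <> 0 ->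
  (((- (1/2))%R, (- (cotpi d / 2))%R) * (e2pi (x + d) - e2pi x) = e2pi x)%C.
Proof.
move=> s0; rewrite e2piD.
have -> : e2pi d = (1 - 2 * sin (PI * d) * sin (PI * d), 2 * sin (PI * d) * cos (PI * d)).
  rewrite /e2pi (_ : 2 * PI * d = 2 * (PI * d)); last by ring.
  by rewrite cos_2a_sin sin_2a.
rewrite /cotpi; have := sin2_cos2 (PI * d); rewrite /Rsqr.
move: (sin (PI * d)) s0 (cos (PI * d)) (e2pi x) => s s0 c [u v] h.
have hc : c * c = 1 - s * s by lra.
rewrite /Cmult /Cminus /Cplus /Copp /=; congr (_, _).
  transitivity (u * (s * s + c * c)); last by rewrite hc; ring.
  by field.
transitivity (v * (s * s + c * c)); last by rewrite hc; ring.
by field.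
Qed.

Lemma Cmod_pair_le (x y : R) : Cmod (x, y) <= Rabs x + Rabs y.
Proof.
have -> : ((x, y) : C) = (RtoC x + Ci * RtoC y)%C.
  by rewrite /RtoC /Ci /Cplus /Cmult /=; congr (_, _); ring.
apply: Rle_trans (Cmod_triangle _ _) _.
by rewrite Cmod_mult Cmod_Ci !Cmod_R; lra.
Qed.

(** The Kusmin-Landau inequality. By [e2pi_diff] each term is c n times a difference of consecutive
    exponentials. Sums of these differences telescope, and so does the variation of c, because the
    cotangent decreases while the differences of f increase. *)
Lemma kusmin_landau (f : nat -> R) a b t k : 0 < t <= 1 / 2 ->
  (forall n, (a <= n < b)%N -> t <= f n.+1 - f n - IZR k <= 1 - t) ->
  (forall n, (a <= n)%N -> (n.+1 < b)%N -> f n.+1 - f n <= f n.+2 - f n.+1) ->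
  Cmod (\sum_(a <= n < b) e2pi (f n))%C <= 4 / t.
Proof.
move=> t0; wlog -> : f k / k = 0%Z.
  move=> W H1 H2.
  have -> : (\sum_(a <= n < b) e2pi (f n) = \sum_(a <= n < b) e2pi (f n - IZR k * INR n))%C.
    apply: eq_bigr => n _; rewrite e2piD INR_IZR_INZ -mult_IZR -opp_IZR e2pi_Z.
    by ring.
  apply: (W _ 0%Z) => // n h1; first by rewrite S_INR; have := H1 n h1; lra.
  by move=> h2; rewrite !S_INR; have := H2 n h1 h2; lra.
move=> H1 H2.
case: (leqP b a) => ab.
  by rewrite big_geq // Cmod_0; apply: Rdiv_le_0_compat; lra.
case: b ab H1 H2 => // b ab H1 H2.
pose c n : C := (- (1/2), - (cotpi (f n.+1 - f n) / 2)).
have sp n : (a <= n < b.+1)%N -> t <= sin (PI * (f n.+1 - f n)).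
  by move=> h; apply: sin_pi_ge; [lra | have := H1 n h; lra].
have -> : (\sum_(a <= n < b.+1) e2pi (f n) =
           \sum_(a <= n < b.+1) (c n * (e2pi (f n.+1) - e2pi (f n))))%C.
  apply: eq_big_nat => n h; rewrite -[LHS](e2pi_diff _ (f n.+1 - f n)); last by have := sp n h; lra.
  by rewrite /c; congr (_ * (e2pi _ - _))%C; ring.
(* The data for [abel_bound]: |c b| <= 1/2 + 1/(2 t) <= 1/t, total variation at most 1/t, partial
   sums at most 2. *)
have -> : 4 / t = (/ t + / t) * 2 by rewrite /Rdiv; ring.
have tinv : 2 <= / t by rewrite -[2]Rinv_inv; apply: Rinv_le_contravar; lra.
have cb n : (a <= n < b.+1)%N -> Rabs (cotpi (f n.+1 - f n)) <= / t.
  by move=> h; apply: cotpi_bound; [lra | have := H1 n h; lra].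
apply: abel_bound => //; first lra.
- apply: Rle_trans (Cmod_pair_le _ _) _.
  rewrite !Rabs_Ropp (Rabs_pos_eq (1 / 2)) ?[Rabs (_ / 2)]Rabs_mult; last lra.
  by have := cb b ltac:(lia); rewrite (Rabs_pos_eq (/ 2)); lra.
- apply: (Rle_trans _ (\sum_(a <= n < b)
    (- cotpi (f n.+2 - f n.+1) / 2 - - cotpi (f n.+1 - f n) / 2))).
    apply: Rsum_le_nat => n /andP[an nb].
    have -> : (c n.+1 - c n)%C = (0, - (cotpi (f n.+2 - f n.+1) - cotpi (f n.+1 - f n)) / 2).
      by rewrite /c /Cminus /Cplus /Copp /=; congr (_, _); field.
    apply: Rle_trans (Cmod_pair_le _ _) _; rewrite Rabs_R0 Rabs_pos_eq; first lra.
    suff : cotpi (f n.+2 - f n.+1) <= cotpi (f n.+1 - f n) by lra.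
    have h2 : f n.+1 - f n <= f n.+2 - f n.+1 by apply: H2; lia.
    have h3 := H1 n ltac:(lia); have h4 := H1 n.+1 ltac:(lia).
    by apply: cotpi_decr; lra.
  rewrite (Rsum_telescope (fun n => - cotpi (f n.+1 - f n) / 2)) //.
  have h1 := cb b; have h2 := cb a.
  have {}h1 := h1 ltac:(lia); have {}h2 := h2 ltac:(lia).
  move/Rabs_le_between: h1; move/Rabs_le_between: h2; lra.
move=> d /andP[ad db]; rewrite (Csum_telescope (fun n => e2pi (f n))); last by lia.
apply: Rle_trans (Cmod_triangle _ _) _; rewrite Cmod_opp !Cmod_e2pi; lra.
Qed.

Lemma monotone_split (d : nat -> R) a b s : (a <= b)%N ->
  (forall n, (a <= n)%N -> (n.+1 < b)%N -> d n <= d n.+1) ->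
  exists c, [/\ (a <= c <= b)%N, forall n, (a <= n < c)%N -> d n < s &
             forall n, (c <= n < b)%N -> s <= d n].
Proof.
move=> /subnKC <-; elim: (b - a)%N => [|k IH] H.
  by exists a; split; try lia; move=> n; lia.
case: IH => [n h1 h2|c [c1 c2 c3]]; first by apply: H; lia.
case: (ltnP c (a + k)) => ck.
  exists c; split=> //; first by lia.
  move=> n h; case: (ltnP n (a + k)) => h2; first by apply: c3; lia.
  have -> : n = (a + k).-1.+1 by lia.
  apply: Rle_trans (c3 (a + k).-1 _) _; first by lia.
  by apply: H; lia.
have {}ck : c = (a + k)%N by lia.
case: (Rlt_le_dec (d (a + k)%N) s) => hd.
  exists (a + k.+1)%N; split; [by lia| |by move=> n; lia].
  move=> n h; case: (ltnP n c) => h2; first by apply: c2; lia.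
  by have -> : n = (a + k)%N by lia.
exists (a + k)%N; split; [by lia|by rewrite -ck|].
by move=> n h; have -> : n = (a + k)%N by lia.
Qed.

Lemma sum_e2pi_trivial (f : nat -> R) a b :
  Cmod (\sum_(a <= n < b) e2pi (f n))%C <= INR (b - a).
Proof.
apply: Rle_trans (Cmod_sum _ _ _ _) _.
rewrite (eq_bigr (fun=> 1)); last by move=> *; exact: Cmod_e2pi.
by rewrite Rsum_const; lra.
Qed.

Lemma separated_count (d : nat -> R) a b l w s : 0 < l -> 0 <= w ->
  (forall n, (a <= n)%N -> (n.+1 < b)%N -> l <= d n.+1 - d n) ->
  (forall n, (a <= n < b)%N -> s <= d n <= s + w) ->
  INR (b - a) <= w / l + 1.
Proof.
move=> l0 w0 H1 H2; have wl : 0 <= w / l by apply: Rdiv_le_0_compat.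
case: (leqP b a) => ab; first by rewrite (eqP (_ : b - a == 0)%N) //=; [rewrite (_ : INR 0 = 0) //; lra].
have G k : (a + k < b)%N -> INR k * l <= d (a + k)%N - d a.
  elim: k => [|k IH] h; first by rewrite addn0 (_ : INR 0 = 0) //; lra.
  have := IH ltac:(lia); have := H1 (a + k)%N ltac:(lia) ltac:(lia).
  rewrite addnS S_INR; lra.
have := G (b - a).-1 ltac:(lia).
have h3 := H2 (a + (b - a).-1)%N ltac:(lia); have h4 := H2 a ltac:(lia).
have -> : INR (b - a) = INR (b - a).-1 + 1 by rewrite -S_INR; congr INR; lia.
move=> h; suff : INR (b - a).-1 <= w / l by lra.
apply: (Rmult_le_reg_r l) => //; have -> : w / l * l = w by field; lra.
lra.
Qed.

(** The differences of f grow by at least l at each step, so at most t / l + 1 of them lie within t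
    of either end of the unit interval. Those terms are bounded trivially, the middle ones by
    [kusmin_landau]. *)
Lemma vdc_unit_block (f : nat -> R) a b l t k : (a <= b)%N -> 0 < l -> 0 < t <= 1 / 2 ->
  (forall n, (a <= n)%N -> (n.+1 < b)%N -> l <= (f n.+2 - f n.+1) - (f n.+1 - f n)) ->
  (forall n, (a <= n < b)%N -> IZR k <= f n.+1 - f n < IZR k + 1) ->
  Cmod (\sum_(a <= n < b) e2pi (f n))%C <= 4 / t + 2 * (t / l + 1).
Proof.
move=> ab l0 t0 H1 H2.
pose d n := f n.+1 - f n.
have mono n : (a <= n)%N -> (n.+1 < b)%N -> d n <= d n.+1.
  by move=> h1 h2; have := H1 n h1 h2; rewrite /d; lra.
have [c1 [/andP[ac1 c1b] L1 G1]] := monotone_split d a b (IZR k + t) ab mono.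
have mono' n : (c1 <= n)%N -> (n.+1 < b)%N -> d n <= d n.+1 by move=> *; apply: mono; lia.
have [c2 [/andP[c12 c2b] L2 G2]] := monotone_split d c1 b (IZR k + 1 - t) c1b mono'.
rewrite (@big_cat_nat _ _ _ c1) //= (@big_cat_nat _ _ _ c2 c1 b) //=.
have A1 : Cmod (\sum_(a <= n < c1) e2pi (f n))%C <= t / l + 1.
  apply: Rle_trans (sum_e2pi_trivial _ _ _) _.
  apply: (separated_count d _ _ _ _ (IZR k)) => //; [lra| |].
    by move=> n h1 h2; apply: H1; lia.
  by move=> n h; have := L1 n h; have := H2 n ltac:(lia); rewrite /d; lra.
have A3 : Cmod (\sum_(c2 <= n < b) e2pi (f n))%C <= t / l + 1.
  apply: Rle_trans (sum_e2pi_trivial _ _ _) _.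
  apply: (separated_count d _ _ _ _ (IZR k + 1 - t)) => //; [lra| |].
    by move=> n h1 h2; apply: H1; lia.
  by move=> n h; have := G2 n h; have := H2 n ltac:(lia); rewrite /d; lra.
have A2 : Cmod (\sum_(c1 <= n < c2) e2pi (f n))%C <= 4 / t.
  apply: (kusmin_landau _ _ _ _ k) => // n.
    by move=> h; have := L2 n h; have := G1 n ltac:(lia); rewrite /d; lra.
  by move=> h1 h2; have := mono n ltac:(lia) ltac:(lia).
have T1 := Cmod_triangle (\sum_(a <= n < c1) e2pi (f n))%C
  ((\sum_(c1 <= n < c2) e2pi (f n)) + (\sum_(c2 <= n < b) e2pi (f n)))%C.
have T2 := Cmod_triangle (\sum_(c1 <= n < c2) e2pi (f n))%C (\sum_(c2 <= n < b) e2pi (f n))%C.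
lra.
Qed.

Lemma vdc_blocks (f : nat -> R) b l t K a k : (a <= b)%N -> 0 < l -> 0 < t <= 1 / 2 ->
  (forall n, (a <= n)%N -> (n.+1 < b)%N -> l <= (f n.+2 - f n.+1) - (f n.+1 - f n)) ->
  (forall n, (a <= n < b)%N -> IZR k <= f n.+1 - f n < IZR k + INR K) ->
  Cmod (\sum_(a <= n < b) e2pi (f n))%C <= INR K * (4 / t + 2 * (t / l + 1)).
Proof.
move=> ab l0 t0; elim: K a k ab => [|K IH] a k ab H1 H2.
  have -> : a = b.
    case: (ltnP a b) => h; last lia.
    by have := H2 a ltac:(lia); rewrite (_ : INR 0 = 0) //; lra.
  by rewrite big_geq // Cmod_0 (_ : INR 0 = 0) //; lra.
have mono n : (a <= n)%N -> (n.+1 < b)%N -> f n.+1 - f n <= f n.+2 - f n.+1.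
  by move=> h1 h2; have := H1 n h1 h2; lra.
have [c [/andP[ac cb] L G]] := monotone_split (fun n => f n.+1 - f n) a b (IZR k + 1) ab mono.
rewrite (@big_cat_nat _ _ _ c) //= S_INR.
apply: Rle_trans (Cmod_triangle _ _) _.
have B1 : Cmod (\sum_(a <= n < c) e2pi (f n))%C <= 4 / t + 2 * (t / l + 1).
  apply: (vdc_unit_block _ _ _ _ _ k) => //.
    by move=> n h1 h2; apply: H1; lia.
  by move=> n h; have := L n h; have := H2 n ltac:(lia); lra.
have : Cmod (\sum_(c <= n < b) e2pi (f n))%C <= INR K * (4 / t + 2 * (t / l + 1)).
  apply: (IH c (k + 1)%Z) => //.
    by move=> n h1 h2; apply: H1; lia.
  by move=> n h; have := G n h; have := H2 n ltac:(lia); rewrite S_INR plus_IZR; lra.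
lra.
Qed.

Lemma floor_exists x : exists k : Z, IZR k <= x < IZR k + 1.
Proof. by exists (Int_part x); have := base_Int_part x; lra. Qed.

Lemma ceil_nat_exists x : 0 <= x -> exists K : nat, x <= INR K < x + 1.
Proof.
move=> x0; have [k hk] := floor_exists (- x).
have k0 : (k <= 0)%Z by apply: le_IZR; lra.
exists (Z.to_nat (- k)); rewrite INR_IZR_INZ Z2Nat.id ?opp_IZR; [lra|lia].
Qed.

(** The differences of f meet at most A l (b - a) + 2 unit intervals. On each of them t = sqrt l
    balances the contributions 4 / t and 2 t / l of [vdc_unit_block]. *)
Lemma van_der_corput (f : nat -> R) a b l A : (a <= b)%N -> 0 < l -> 1 <= A ->
  (forall n, (a <= n)%N -> (n.+2 < b)%N -> l <= (f n.+2 - f n.+1) - (f n.+1 - f n) <= A * l) ->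
  Cmod (\sum_(a <= n < b) e2pi (f n))%C <= 20 * (A * sqrt l * INR (b - a) + / sqrt l).
Proof.
move=> ab l0 A1 H.
have s0 : 0 < sqrt l by exact: sqrt_lt_R0.
have is0 : 0 < / sqrt l by exact: Rinv_0_lt_compat.
have ssl : sqrt l * sqrt l = l by apply: sqrt_sqrt; lra.
have L0 : 0 <= INR (b - a) by exact: pos_INR.
(* The choice t = sqrt l requires sqrt l <= 1/2; otherwise the trivial bound is good enough. *)
case: (Rlt_le_dec (1 / 2) (sqrt l)) => hs.
  apply: Rle_trans (sum_e2pi_trivial _ _ _) _.
  have : 1 / 2 * INR (b - a) <= A * sqrt l * INR (b - a).
    by apply: Rmult_le_compat_r => //; nra.
  lra.
have is2 : 2 <= / sqrt l by rewrite -[2]Rinv_inv; apply: Rinv_le_contravar; lra.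
have pos : 0 <= A * sqrt l * INR (b - a) by apply: Rmult_le_pos => //; nra.
case: (leqP b a) => ba; first by rewrite big_geq // Cmod_0; lra.
case: b ab H L0 ba pos => // b _ H L0 ab pos.
(* The hypothesis involves f only inside the range of summation, while [vdc_blocks] also uses the
   value just after its range; hence the last term is split off. *)
rewrite big_nat_recr //=; apply: Rle_trans (Cmod_triangle _ _) _; rewrite Cmod_e2pi.
case: (ltnP a b) => ab'; last first.
  by rewrite big_geq // Cmod_0; lra.
have [k hk] := floor_exists (f a.+1 - f a).
have AlL : 0 <= A * l * INR (b.+1 - a) by apply: Rmult_le_pos => //; nra.
have AlL1 : 0 <= A * l * INR (b.+1 - a) + 1 by lra.
have [K hK] := ceil_nat_exists _ AlL1.
have spread j : (a + j < b)%N ->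
    f a.+1 - f a <= f (a + j).+1 - f (a + j)%N <= f a.+1 - f a + A * l * INR j.
  elim: j => [|j IH] h; first by rewrite addn0 (_ : INR 0 = 0) //; lra.
  have := IH ltac:(lia); have := H (a + j)%N ltac:(lia) ltac:(lia).
  rewrite addnS S_INR; lra.
have B : Cmod (\sum_(a <= n < b) e2pi (f n))%C <=
    INR K * (4 / sqrt l + 2 * (sqrt l / l + 1)).
  apply: (vdc_blocks _ _ _ _ _ _ k); [lia | by [] | lra | |].
    by move=> n h1 h2; have := H n ltac:(lia) ltac:(lia); lra.
  move=> n h; have := spread (n - a)%N ltac:(lia).
  have -> : (a + (n - a))%N = n by lia.
  have : INR (n - a) <= INR (b.+1 - a) by apply: le_INR; lia.
  have : 0 < A * l by nra.
  move=> h1 h2 h3; have : A * l * INR (n - a) <= A * l * INR (b.+1 - a).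
    by apply: Rmult_le_compat_l; lra.
  lra.
have e1 : sqrt l / l = / sqrt l by rewrite -{2}ssl; field; lra.
rewrite e1 in B.
have B2 : INR K * (4 / sqrt l + 2 * (/ sqrt l + 1)) <=
    (A * l * INR (b.+1 - a) + 2) * (7 * / sqrt l).
  apply: Rmult_le_compat; [exact: pos_INR| | |]; rewrite /Rdiv; lra.
have e2 : (A * l * INR (b.+1 - a) + 2) * (7 * / sqrt l) =
    7 * (A * sqrt l * INR (b.+1 - a)) + 14 * / sqrt l.
  by rewrite -{1}ssl; field; lra.
lra.
Qed.

(** * Arithmetic functions and Vaughan's identity *)

Lemma INR_muln m n : INR (m * n)%N = INR m * INR n.
Proof. by rewrite -multE mult_INR. Qed.

Lemma INR_addn m n : INR (m + n)%N = INR m + INR n.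
Proof. by rewrite -plusE plus_INR. Qed.

Lemma INR_leq m n : (m <= n)%N -> INR m <= INR n.
Proof. by move=> h; apply: le_INR; lia. Qed.

Lemma INR_ltn m n : (m < n)%N -> INR m < INR n.
Proof. by move=> h; apply: lt_INR; lia. Qed.

Lemma INR_gt0 n : (0 < n)%N -> 0 < INR n.
Proof. by move=> /INR_ltn. Qed.

Lemma INR_ge1 n : (0 < n)%N -> 1 <= INR n.
Proof. by move=> /INR_leq. Qed.

Lemma ln_ge0 x : 1 <= x -> 0 <= ln x.
Proof. by move=> h; rewrite -ln_1; apply: ln_le; lra. Qed.

Lemma big_divisors (T : Type) (idx : T) (op : Monoid.com_law idx) (X n : nat) (f : nat -> T) :
  (0 < n <= X)%N ->
  \big[op/idx]_(1 <= d < X.+1 | d %| n) f d = \big[op/idx]_(d <- divisors n) f d.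
Proof.
move=> /andP[n0 nX]; rewrite -big_filter; apply: perm_big; apply: uniq_perm.
- by rewrite filter_uniq // iota_uniq.
- exact: divisors_uniq.
move=> d; rewrite mem_filter mem_index_iota -dvdn_divisors //.
case: (boolP (d %| n)) => //= dn.
by have := dvdn_leq n0 dn; have := dvdn_gt0 n0 dn; lia.
Qed.

Lemma sum_multiples (X a : nat) (H : nat -> C) : (0 < a)%N ->
  (forall n, (X < n)%N -> H n = RtoC 0) ->
  (\sum_(1 <= c < X.+1) H (a * c)%N = \sum_(1 <= n < X.+1 | a %| n) H n)%C.
Proof.
move=> a0 HX.
have E c : (0 < c)%N -> H (a * c)%N = (\sum_(1 <= n < X.+1 | n == (a * c)%N) H n)%C.
  move=> c0; case: (leqP (a * c) X) => h; last first.
    rewrite HX // big_nat_cond big_pred0 // => n.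
    by apply/negbTE/negP; lia.
  rewrite -big_filter (@perm_big _ _ _ _ _ [:: (a * c)%N]) ?big_seq1 //.
  apply: uniq_perm => //; first by rewrite filter_uniq // iota_uniq.
  move=> n; rewrite mem_filter mem_index_iota inE.
  case: eqP => //= ->; have : (0 < a * c)%N by rewrite muln_gt0 a0.
  by lia.
transitivity (\sum_(1 <= c < X.+1) \sum_(1 <= n < X.+1 | n == (a * c)%N) H n)%C.
  by apply: eq_big_nat => c /andP[c0 _]; exact: E.
under eq_bigr => c _ do rewrite big_mkcond.
rewrite exchange_big /= [RHS]big_mkcond; apply: eq_big_nat => n /andP[n0 nX].
rewrite -big_mkcond; case: (boolP (a %| n)) => an; last first.
  rewrite big_pred0 // => c; apply/negbTE/negP => /eqP e.
  by move/negP: an; apply; rewrite e dvdn_mulr.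
rewrite -big_filter (@perm_big _ _ _ _ _ [:: (n %/ a)%N]) ?big_seq1 //.
apply: uniq_perm => //; first by rewrite filter_uniq // iota_uniq.
move=> c; rewrite mem_filter mem_index_iota inE.
rewrite -{1}(divnK an) mulnC eqn_mul2l -leqn0 leqNgt a0 /= eq_sym.
case: eqP => //= ->; have := leq_div n a; have : (0 < n %/ a)%N by rewrite divn_gt0 // dvdn_leq.
by lia.
Qed.

(** Terms are grouped by n = a c. Since H vanishes beyond X, both variables may run independently up
    to X and no hyperbola condition has to be carried along. *)
Lemma sum_dirichlet (X : nat) (f H : nat -> C) :
  (forall n, (X < n)%N -> H n = RtoC 0) ->
  (\sum_(1 <= a < X.+1) \sum_(1 <= c < X.+1) (f a * H (a * c)%N) =
   \sum_(1 <= n < X.+1) ((\sum_(a <- divisors n) f a) * H n))%C.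
Proof.
move=> HX.
transitivity (\sum_(1 <= a < X.+1) \sum_(1 <= n < X.+1) (if a %| n then f a * H n else RtoC 0))%C.
  apply: eq_big_nat => a /andP[a0 _]; rewrite -Csum_mull sum_multiples // Csum_mull.
  by rewrite big_mkcond.
rewrite exchange_big; apply: eq_big_nat => n /andP[n0 nX].
by rewrite -big_mkcond -Csum_mulr big_divisors //; lia.
Qed.

Definition mobius (n : nat) : R :=
  if all (fun p => logn p n == 1)%N (primes n) then (- 1) ^ (size (primes n)) else 0.

Lemma Rabs_mobius n : Rabs (mobius n) <= 1.
Proof. by rewrite /mobius; case: ifP => _; rewrite ?pow_1_abs ?Rabs_R0; lra. Qed.

Lemma mobius_prime_mul p d : prime p -> (0 < d)%N ->
  mobius (p * d) = if p %| d then 0 else - mobius d.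
Proof.
move=> pp d0; have p0 := prime_gt0 pp.
have lp : logn p p = 1%N by rewrite logn_prime // eqxx.
case: ifP => [pd|/negbT pd]; rewrite /mobius.
  rewrite ifF //; apply/negbTE/allPn; exists p; first by rewrite mem_primes pp muln_gt0 p0 d0 dvdn_mulr.
  have h : (0 < logn p d)%N by rewrite logn_gt0 mem_primes pp d0.
  by rewrite /= lognM // lp; lia.
have mem q : (q \in primes (p * d)) = (q \in p :: primes d).
  by rewrite primesM // inE primes_prime // inE.
have perm : perm_eq (primes (p * d)) (p :: primes d).
  apply: uniq_perm => //; first exact: primes_uniq.
  by rewrite /= primes_uniq andbT mem_primes (negbTE pd) !andbF.
rewrite (perm_all _ perm) (perm_size perm) /= lognM // lp.
rewrite (_ : logn p d = 0%N) /=; last by apply/eqP; rewrite lognE (negbTE pd) !andbF.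
have -> : all (fun q => logn q (p * d) == 1)%N (primes d) = all (fun q => logn q d == 1)%N (primes d).
  apply: eq_in_all => q; rewrite mem_primes => /andP[qp /andP[_ qd]].
  rewrite lognM // logn_prime //; case: (eqVneq q p) => // e.
  by move: pd; rewrite -e qd.
by case: ifP => _; rewrite -?tech_pow_Rmult; ring.
Qed.

(** Let p be the least prime factor of n = p m. The divisors that p divides are the p e with e
    dividing m; they contribute 0 if p divides e and - mu e otherwise, which cancels the divisors of
    n prime to p. *)
Lemma sum_mobius n : (0 < n)%N ->
  \sum_(d <- divisors n) mobius d = if n == 1%N then 1 else 0.
Proof.
move=> n0; case: eqP => [->|n1]; first by rewrite (_ : divisors 1 = [:: 1%N]) ?big_seq1.
have n2 : (1 < n)%N by lia.
set p := pdiv n; have pp : prime p by exact: pdiv_prime.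
have p0 := prime_gt0 pp; have pn : p %| n by exact: pdiv_dvd.
set m := (n %/ p)%N; have nE : n = (p * m)%N by rewrite mulnC divnK.
have m0 : (0 < m)%N by rewrite divn_gt0 // dvdn_leq.
rewrite (bigID (fun d => p %| d)%N) /=.
suff -> : \sum_(d <- divisors n | p %| d) mobius d = - \sum_(d <- divisors n | ~~ (p %| d)) mobius d.
  by lra.
rewrite -big_filter (@perm_big _ _ _ _ _ [seq (p * e)%N | e <- divisors m]); last first.
  apply: uniq_perm; first by rewrite filter_uniq // divisors_uniq.
    rewrite map_inj_uniq ?divisors_uniq // => x y /eqP; rewrite eqn_pmul2l // => /eqP //.
  move=> d; rewrite mem_filter -dvdn_divisors //; apply/andP/mapP => [[pd dn]|[e em ->]].
    exists (d %/ p)%N; last by rewrite mulnC divnK.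
    by rewrite -dvdn_divisors // -(@dvdn_pmul2l p) // -nE mulnC divnK.
  by rewrite dvdn_mulr // nE dvdn_pmul2l //; rewrite dvdn_divisors.
rewrite big_map /= -[RHS]Rmult_1_l -Ropp_mult_distr_r Ropp_mult_distr_l Rsum_mull.
rewrite -[RHS]big_filter (@perm_big _ _ _ _ [seq d <- divisors n | ~~ (p %| d)] [seq e <- divisors m | ~~ (p %| e)]).
  rewrite big_filter [RHS]big_mkcond /= big_seq [RHS]big_seq; apply: eq_bigr => e.
  rewrite -dvdn_divisors // => em; rewrite mobius_prime_mul //; last by exact: dvdn_gt0 em.
  by case: ifP => _ /=; lra.
apply: uniq_perm; rewrite ?filter_uniq ?divisors_uniq // => d.
rewrite !mem_filter -!dvdn_divisors //; case: (boolP (p %| d)) => //= pd.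
by rewrite nE Gauss_dvdr // coprime_sym prime_coprime.
Qed.

Definition von_mangoldt (n : nat) : R := if primes n is [:: p] then ln (INR p) else 0.

Lemma von_mangoldt_bound n : (0 < n)%N -> 0 <= von_mangoldt n <= ln (INR n).
Proof.
move=> n0; rewrite /von_mangoldt; have n1 := INR_ge1 _ n0.
case E : (primes n) => [|p [|q s]]; try by have := ln_ge0 _ n1; lra.
have : p \in primes n by rewrite E inE.
rewrite mem_primes => /andP[pp /andP[_ pn]]; have p1 := INR_ge1 _ (prime_gt0 pp).
split; first exact: ln_ge0.
by apply: ln_le; [lra | apply/INR_leq/dvdn_leq].
Qed.

Lemma von_mangoldt_prime p : prime p -> von_mangoldt p = ln (INR p).
Proof. by move=> pp; rewrite /von_mangoldt primes_prime. Qed.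

(** Induction through n = p m. The divisors of n that do not divide m all contain p to the exact
    power v + 1, where p^v is the power of p in m; among them only p^(v+1) is a prime power, and it
    accounts for ln p. *)
Lemma sum_von_mangoldt n : (0 < n)%N ->
  \sum_(d <- divisors n) von_mangoldt d = ln (INR n).
Proof.
have [k] := ubnP n; elim: k n => // k IH n nk n0.
case: (eqVneq n 1%N) => [->|n1].
  by rewrite (_ : divisors 1 = [:: 1%N]) ?big_seq1 // ln_1.
have n2 : (1 < n)%N by lia.
set p := pdiv n; have pp : prime p by exact: pdiv_prime.
have p0 := prime_gt0 pp; have pn : p %| n by exact: pdiv_dvd.
set m := (n %/ p)%N; have nE : n = (p * m)%N by rewrite mulnC divnK.
have m0 : (0 < m)%N by rewrite divn_gt0 // dvdn_leq.
have mn : m %| n by rewrite nE dvdn_mull.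
have p1 := prime_gt1 pp.
have IHm : \sum_(d <- divisors m) von_mangoldt d = ln (INR m) by apply: IH => //; nia.
rewrite {2}nE INR_muln ln_mult; try exact: INR_gt0.
rewrite -IHm (bigID (fun d => d %| m)%N) /= Rplus_comm; congr Rplus; last first.
  rewrite -big_filter; apply: perm_big; apply: uniq_perm; rewrite ?filter_uniq ?divisors_uniq // => d.
  rewrite mem_filter -!dvdn_divisors //; case: (boolP (d %| m)) => //= dm.
  by rewrite (dvdn_trans dm).
set v := logn p m.
have pv : ((p ^ v.+1)%N \in [seq d <- divisors n | ~~ (d %| m)]).
  rewrite mem_filter -dvdn_divisors // !pfactor_dvdn // ltnn /= nE lognM // (logn_prime p pp) eqxx.
  by rewrite add1n leqnn.
rewrite -big_filter (bigD1_seq _ pv) ?filter_uniq ?divisors_uniq //=.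
have -> : von_mangoldt (p ^ v.+1)%N = ln (INR p).
  by rewrite /von_mangoldt primesX // primes_prime.
rewrite big_seq_cond big1 ?Rplus_0_r // => d /andP[].
rewrite mem_filter -dvdn_divisors // => /andP[dm dn] dv.
have d0 := dvdn_gt0 n0 dn.
have hv : logn p d = v.+1.
  apply/eqP; rewrite eqn_leq; apply/andP; split.
    have := dvdn_leq_log p n0 dn; rewrite nE lognM // (logn_prime p pp) eqxx add1n //.
  rewrite ltnNge; apply/negP => h; move/negP: dm; apply.
  apply/dvdn_partP => // q; rewrite mem_primes => /andP[qp /andP[_ qd]].
  rewrite p_part pfactor_dvdn //; case: (eqVneq q p) => [->//|qp'].
  have := dvdn_leq_log q n0 dn; rewrite nE lognM // (logn_prime q pp).
  by rewrite (negbTE qp').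
have pd : p \in primes d by rewrite -logn_gt0 hv.
rewrite /von_mangoldt; case E : (primes d) => [|q [|r s]] //.
move: pd; rewrite E inE => /eqP pq; subst q.
move/eqP: dv; case; rewrite -hv [LHS]prod_prime_decomp // prime_decompE E /= big_seq1 //.
Qed.

(** Every divisor d of m n is the product of gcd (d, m), which divides m, and d / gcd (d, m), which
    divides n. *)
Lemma size_divisors_mul m n : (0 < m)%N -> (0 < n)%N ->
  (size (divisors (m * n)) <= size (divisors m) * size (divisors n))%N.
Proof.
move=> m0 n0; have mn0 : (0 < m * n)%N by rewrite muln_gt0 m0.
rewrite -(size_allpairs muln (divisors m) (divisors n)).
apply: uniq_leq_size; first exact: divisors_uniq.
move=> d; rewrite -dvdn_divisors // => dmn; apply/allpairsP.
have d0 := dvdn_gt0 mn0 dmn.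
have g0 : (0 < gcdn d m)%N by rewrite gcdn_gt0 d0.
exists (gcdn d m, d %/ gcdn d m)%N; rewrite /= -!dvdn_divisors // dvdn_gcdr; split=> //; last first.
  by rewrite mulnC divnK // dvdn_gcdl.
have cop : coprime (d %/ gcdn d m) (m %/ gcdn d m).
  by rewrite /coprime -(@eqn_pmul2l (gcdn d m)) // muln1 muln_gcdr ![(gcdn d m * _)%N]mulnC
    !divnK ?dvdn_gcdl ?dvdn_gcdr.
rewrite -(Gauss_dvdr _ cop) -(@dvdn_pmul2l (gcdn d m)) // mulnA.
by rewrite ![(gcdn d m * _)%N]mulnC !divnK ?dvdn_gcdl ?dvdn_gcdr.
Qed.

Lemma size_divisors_pfactor p a : prime p -> (size (divisors (p ^ a)) <= a.+1)%N.
Proof.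
move=> pp; rewrite -(size_iota 0 a.+1) -(size_map (fun i => (p ^ i)%N) (iota 0 a.+1)).
apply: uniq_leq_size; first exact: divisors_uniq.
move=> d; rewrite -dvdn_divisors ?expn_gt0 ?prime_gt0 // => /(dvdn_pfactor _ _ pp) [i ia ->].
by apply/mapP; exists i; rewrite // mem_iota.
Qed.

Lemma INR_expn p a : INR (p ^ a)%N = INR p ^ a.
Proof. by elim: a => [|a IH] //; rewrite expnS INR_muln IH. Qed.

Lemma Rpower_gt0 x y : 0 < Rpower x y.
Proof. exact: exp_pos. Qed.

Lemma Rpower_INR_mul m n e : (0 < m)%N -> (0 < n)%N ->
  Rpower (INR (m * n)%N) e = Rpower (INR m) e * Rpower (INR n) e.
Proof. by move=> m0 n0; rewrite INR_muln Rpower_mult_distr //; apply: INR_gt0. Qed.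

Lemma Rpower_1l e : Rpower 1 e = 1.
Proof. by rewrite /Rpower ln_1 Rmult_0_r exp_0. Qed.

Lemma Rpower_ge1 x e : 1 <= x -> 0 <= e -> 1 <= Rpower x e.
Proof.
move=> x1 e0; rewrite -(Rpower_O x); last lra.
by apply: Rle_Rpower.
Qed.

(** A prime p >= 2^(1/e) has p^e >= 2, so removing one factor p at most doubles the divisor count
    and costs no constant. Each of the finitely many smaller primes costs one factor D. *)
Lemma divisor_bound e : 0 < e ->
  exists A, 1 <= A /\ forall n, (0 < n)%N -> INR (size (divisors n)) <= A * Rpower (INR n) e.
Proof.
move=> e0.
have [Y hY] : exists Y : nat, 2 <= Rpower (INR Y) e /\ (0 < Y)%N.
  have [Y [h1 h2]] := ceil_nat_exists (Rpower 2 (/ e)) (Rlt_le _ _ (Rpower_gt0 _ _)).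
  have p0 := Rpower_gt0 2 (/ e).
  exists Y; split; last by case: Y h1 {h2} => //; rewrite (_ : INR 0 = 0) //; lra.
  have -> : 2 = Rpower (Rpower 2 (/ e)) e by rewrite Rpower_mult Rinv_l ?Rpower_1; lra.
  by apply: Rle_Rpower_l; lra.
have l2 : 0 < ln 2 by rewrite -ln_1; apply: ln_increasing; lra.
(* Chosen so that a + 1 <= D (1 + a e ln 2) <= D 2^(a e), which handles a full power p^a of any
   prime. *)
pose D := / (e * ln 2) + 1.
have el : 0 < / (e * ln 2) by apply: Rinv_0_lt_compat; nra.
have D1 : 1 <= D by rewrite /D; lra.
have pfac p a : prime p -> INR a.+1 <= D * Rpower (INR (p ^ a)%N) e.
  move=> pp; have p2 : 2 <= INR p by apply: (INR_leq 2); exact: prime_gt1.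
  have p0 : 0 < INR p by lra.
  apply: (Rle_trans _ (D * Rpower (2 ^ a) e)); last first.
    apply: Rmult_le_compat_l; first by rewrite /D; lra.
    apply: Rle_Rpower_l; first lra; split; first by apply: pow_lt; lra.
    by rewrite INR_expn; apply: pow_incr; lra.
  have -> : Rpower (2 ^ a) e = exp (INR a * (e * ln 2)).
    by rewrite /Rpower ln_pow; [congr exp; ring | lra].
  have := exp_ineq1_le (INR a * (e * ln 2)); have a0 := pos_INR a; rewrite S_INR.
  move=> h; apply: (Rle_trans _ (D * (1 + INR a * (e * ln 2)))).
    have -> : D * (1 + INR a * (e * ln 2)) = D + INR a + INR a * (e * ln 2).
      by rewrite /D; field; nra.
    have : 0 <= INR a * (e * ln 2) by apply: Rmult_le_pos; nra.
    by lra.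
  by apply: Rmult_le_compat_l => //; rewrite /D; lra.
(* All prime factors of n are at least Y - k. The induction on k admits one more small prime at a
   time, until k = Y imposes no condition. *)
suff H k : exists A, 1 <= A /\ forall n, (0 < n)%N ->
    (forall p, prime p -> p %| n -> (Y <= p + k)%N) ->
    INR (size (divisors n)) <= A * Rpower (INR n) e.
  have [A [A1 HA]] := H Y; exists A; split=> // n n0; apply: HA => // p _ _; lia.
elim: k => [|k [A [A1 IH]]].
  exists 1; split; first lra.
  move=> n; have [m] := ubnP n; elim: m n => // m IH n nm n0 np.
  case: (eqVneq n 1%N) => [->|n1].
    by rewrite (_ : INR 1 = 1) // Rpower_1l Rmult_1_l; exact: Rle_refl.
  have n2 : (1 < n)%N by lia.
  set p := pdiv n; have pp : prime p by exact: pdiv_prime.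
  have pn : p %| n by exact: pdiv_dvd.
  have p0 := prime_gt0 pp; have p1 := prime_gt1 pp.
  have nE : n = (p * (n %/ p))%N by rewrite mulnC divnK.
  have m0 : (0 < n %/ p)%N by rewrite divn_gt0 // dvdn_leq.
  have IHm : INR (size (divisors (n %/ p))) <= 1 * Rpower (INR (n %/ p)) e.
    apply: IH => //; first by nia.
    by move=> q qp qn; apply: np => //; rewrite nE dvdn_mull.
  rewrite nE Rpower_INR_mul // Rmult_1_l.
  apply: (Rle_trans _ (INR (size (divisors p) * size (divisors (n %/ p)))%N)).
    by apply: INR_leq; exact: size_divisors_mul.
  rewrite INR_muln; apply: Rmult_le_compat; try exact: pos_INR; last lra.
  apply: (Rle_trans _ 2).
    by apply: (INR_leq _ 2); have := size_divisors_pfactor p 1 pp; rewrite expn1.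
  apply: Rle_trans (proj1 hY) _; apply: Rle_Rpower_l; first lra.
  split; first by apply: INR_gt0; case: hY.
  by apply: INR_leq; have := np p pp pn; rewrite addn0.
exists (D * A); split; first by rewrite /D; nra.
move=> n n0 np.
(* The only prime that may be new is Y - k.+1; its full power in n is split off. *)
case: (boolP (prime (Y - k.+1))) => pp; last first.
  apply: (Rle_trans _ (A * Rpower (INR n) e)).
    apply: IH => // p pr pn; have := np p pr pn; case: (eqVneq p (Y - k.+1)%N) => h; last lia.
    by rewrite -h pr in pp.
  apply: Rmult_le_compat_r; first exact/Rlt_le/Rpower_gt0.
  by rewrite /D; nra.
set p := (Y - k.+1)%N in pp *.
set a := logn p n; have pan : p ^ a %| n by rewrite pfactor_dvdn.
have nE : n = (p ^ a * (n %/ p ^ a))%N by rewrite mulnC divnK.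
have pa0 : (0 < p ^ a)%N by rewrite expn_gt0 prime_gt0.
have m0 : (0 < n %/ p ^ a)%N by rewrite divn_gt0 // dvdn_leq.
have IHm : INR (size (divisors (n %/ p ^ a))) <= A * Rpower (INR (n %/ p ^ a)) e.
  apply: IH => // q qp qn.
  have := np q qp; rewrite nE dvdn_mull // => /(_ erefl).
  case: (eqVneq q p) => h; last by rewrite /p in h; lia.
  have : (p ^ a.+1 %| n)%N by rewrite nE expnSr; apply: dvdn_mul => //; move: qn; rewrite h.
  by rewrite pfactor_dvdn // ltnn.
rewrite nE Rpower_INR_mul //.
apply: (Rle_trans _ (INR (size (divisors (p ^ a)) * size (divisors (n %/ p ^ a)))%N)).
  by apply: INR_leq; exact: size_divisors_mul.
rewrite INR_muln.
have -> : D * A * (Rpower (INR (p ^ a)%N) e * Rpower (INR (n %/ p ^ a)) e) =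
  (D * Rpower (INR (p ^ a)%N) e) * (A * Rpower (INR (n %/ p ^ a)) e) by ring.
apply: Rmult_le_compat; try exact: pos_INR; last by [].
by apply: Rle_trans (pfac p a pp); apply/INR_leq/size_divisors_pfactor.
Qed.

Definition upto (U : nat) (f : nat -> R) n := if (n <= U)%N then f n else 0.
Definition beyond (U : nat) (f : nat -> R) n := if (n <= U)%N then 0 else f n.

Definition mobius_tail V k : R := \sum_(d <- divisors k) beyond V mobius d.

Lemma mobius_tail_bound V k : Rabs (mobius_tail V k) <= INR (size (divisors k)).
Proof.
rewrite /mobius_tail; elim: (divisors k) => [|d s IH].
  by rewrite big_nil Rabs_R0 (_ : INR 0 = 0) //; lra.
rewrite big_cons /= S_INR; apply: Rle_trans (Rabs_triang _ _) _.
have : Rabs (beyond V mobius d) <= 1.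
  by rewrite /beyond; case: ifP => _; [rewrite Rabs_R0; lra | exact: Rabs_mobius].
lra.
Qed.

Lemma mobius_tail_small V k : (0 < k <= V)%N -> mobius_tail V k = 0.
Proof.
move=> /andP[k0 kV]; rewrite /mobius_tail big_seq big1 // => d; rewrite -dvdn_divisors // => dk.
by rewrite /beyond (leq_trans (dvdn_leq k0 dk)).
Qed.

Lemma upto_beyond U f n : beyond U f n = f n - upto U f n.
Proof. by rewrite /upto /beyond; case: ifP => _; ring. Qed.

(** The divisor sum of mu picks out 1, so F n is the double sum of mu b F (n b c). The part of mu
    beyond V gives the bilinear sum. In the part up to V, Lambda beyond U is Lambda minus its part
    up to U: the former, convolved with 1, becomes the logarithm, and the latter gives the triple
    sum. *)
Lemma vaughan_identity (X U V : nat) (F : nat -> C) :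
  (forall n, (X < n)%N -> F n = RtoC 0) ->
  (\sum_(1 <= n < X.+1) (RtoC (beyond U von_mangoldt n) * F n) =
   (\sum_(1 <= b < X.+1) (RtoC (upto V mobius b) *
      \sum_(1 <= k < X.+1) (RtoC (ln (INR k)) * F (b * k)%N)))
   - (\sum_(1 <= b < X.+1) \sum_(1 <= c < X.+1)
      (RtoC (upto V mobius b) * RtoC (upto U von_mangoldt c) *
        \sum_(1 <= l < X.+1) F (b * c * l)%N))
   + \sum_(1 <= n < X.+1) \sum_(1 <= k < X.+1)
      (RtoC (beyond U von_mangoldt n) * RtoC (mobius_tail V k) * F (n * k)%N))%C.
Proof.
move=> FX.
have HX a : (0 < a)%N -> forall n, (X < n)%N -> F (a * n)%N = RtoC 0.
  by move=> a0 n nX; apply: FX; nia.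
have inv n : (0 < n)%N -> F n =
    (\sum_(1 <= b < X.+1) \sum_(1 <= c < X.+1) (RtoC (mobius b) * F (n * (b * c))%N))%C.
  move=> n0; rewrite (sum_dirichlet X _ (fun k => F (n * k)%N)); last exact: HX.
  transitivity (\sum_(1 <= k < X.+1) (if k == 1%N then F n else RtoC 0))%C; last first.
    apply: eq_big_nat => k /andP[k0 _]; rewrite -RtoC_sum sum_mobius //.
    by case: eqP => [->|_]; rewrite ?muln1; ring.
  case: X FX {HX} => [|X] FX; first by rewrite big_geq // FX.
  rewrite big_ltn // eqxx big_nat big1 ?Cplus_0_r // => k /andP[k1 _].
  by rewrite ifN //; lia.
transitivity (\sum_(1 <= n < X.+1) \sum_(1 <= b < X.+1) \sum_(1 <= c < X.+1)
   (RtoC (beyond U von_mangoldt n) * RtoC (mobius b) * F (n * (b * c))%N))%C.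
  apply: eq_big_nat => n /andP[n0 _]; rewrite {1}(inv n n0) Csum_mull.
  apply: eq_bigr => b _; rewrite Csum_mull; apply: eq_bigr => c _; ring.
transitivity ((\sum_(1 <= n < X.+1) \sum_(1 <= b < X.+1) \sum_(1 <= c < X.+1)
   (RtoC (beyond U von_mangoldt n) * RtoC (upto V mobius b) * F (n * (b * c))%N))
   + \sum_(1 <= n < X.+1) \sum_(1 <= b < X.+1) \sum_(1 <= c < X.+1)
   (RtoC (beyond U von_mangoldt n) * RtoC (beyond V mobius b) * F (n * (b * c))%N))%C.
  rewrite -big_split; apply: eq_bigr => n _; rewrite -big_split; apply: eq_bigr => b _.
  rewrite -big_split; apply: eq_bigr => c _; rewrite (upto_beyond V) RtoC_minus /=; ring.
congr Cplus; last first.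
  apply: eq_big_nat => n /andP[n0 _].
  under eq_bigr => b _ do under eq_bigr => c _ do rewrite -Cmult_assoc.
  under eq_bigr => b _ do rewrite -Csum_mull.
  rewrite -Csum_mull (sum_dirichlet X (fun b => RtoC (beyond V mobius b)) (fun k => F (n * k)%N)); last exact: HX.
  by rewrite Csum_mull; apply: eq_bigr => k _; rewrite -RtoC_sum -/(mobius_tail V k); ring.
rewrite exchange_big Csum_sub; apply: eq_big_nat => b /andP[b0 _].
transitivity ((\sum_(1 <= n < X.+1) \sum_(1 <= c < X.+1)
   (RtoC (upto V mobius b) * (RtoC (von_mangoldt n) * F (b * (n * c))%N)))
   - \sum_(1 <= n < X.+1) \sum_(1 <= c < X.+1)
   (RtoC (upto V mobius b) * RtoC (upto U von_mangoldt n) * F (b * n * c)%N))%C.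
  rewrite Csum_sub; apply: eq_bigr => n _; rewrite Csum_sub; apply: eq_bigr => c _.
  rewrite upto_beyond RtoC_minus (_ : (n * (b * c) = b * (n * c))%N); last by rewrite mulnCA.
  by rewrite -mulnA; ring.
congr Cminus; last by apply: eq_bigr => c _; rewrite Csum_mull.
under eq_bigr => n _ do rewrite -Csum_mull.
rewrite -Csum_mull (sum_dirichlet X (fun n => RtoC (von_mangoldt n)) (fun k => F (b * k)%N)); last exact: HX.
congr Cmult; apply: eq_big_nat => k /andP[k0 _].
by rewrite -RtoC_sum sum_von_mangoldt.
Qed.

(* [m] is the power of the same prime whose exponent is halved. *)
Lemma proper_prime_power n : (0 < n)%N -> ~~ prime n -> von_mangoldt n <> 0 ->
  exists2 m, (0 < m)%N & n = (m ^ 2)%N \/ n = (m ^ 2 * pdiv m)%N.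
Proof.
move=> n0 np; rewrite /von_mangoldt; case E : (primes n) => [|p [|q s]] // _.
have pp : prime p by have : p \in primes n by [rewrite E inE]; rewrite mem_primes => /andP[].
have nE : n = (p ^ logn p n)%N.
  by rewrite {1}[n]prod_prime_decomp // prime_decompE E /= big_seq1.
have k2 : (1 < logn p n)%N.
  rewrite ltnNge; apply/negP => h; move/negP: np; apply.
  have : (0 < logn p n)%N by rewrite logn_gt0 E inE.
  by move=> h2; rewrite nE (_ : logn p n = 1%N) ?expn1 //; lia.
move: (logn p n) nE k2 => k nE k2.
exists (p ^ (k./2))%N; first by rewrite expn_gt0 prime_gt0.
rewrite -expnM muln2; have := odd_double_half k; case: (odd k) => /= kE.
  right; rewrite (_ : pdiv (p ^ k./2) = p) ?nE -?expnSr; last first.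
    by rewrite (_ : k./2 = (k./2).-1.+1) ?pdiv_pfactor //; lia.
  by rewrite -{1}kE add1n.
by left; rewrite nE -{1}kE add0n.
Qed.

(** By [proper_prime_power] every n that contributes is m^2 or m^2 times the least prime factor of
    m, for some m < M. Hence there are at most two of them for each m, each of weight at most ln
    X. *)
Lemma sum_proper_prime_powers (X M : nat) : (0 < X < M ^ 2)%N ->
  \sum_(1 <= n < X.+1 | ~~ prime n) von_mangoldt n <= 2 * ln (INR X) * INR M.
Proof.
move=> /andP[X0 XM].
have l0 := ln_ge0 _ (INR_ge1 _ X0).
pose ind (b : bool) : R := if b then 1 else 0.
have ind0 b : 0 <= ind b by case: b => /=; lra.
apply: (Rle_trans _ (\sum_(1 <= n < X.+1) (ln (INR X) *
    \sum_(1 <= m < M) (ind (n == m ^ 2)%N + ind (n == m ^ 2 * pdiv m)%N)))).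
  rewrite big_mkcond; apply: Rsum_le_nat => n /andP[n0 nX].
  have S0 : 0 <= \sum_(1 <= m < M) (ind (n == m ^ 2)%N + ind (n == m ^ 2 * pdiv m)%N).
    by apply: Rsum_ge0 => m _; have := ind0 (n == m ^ 2)%N; have := ind0 (n == m ^ 2 * pdiv m)%N; lra.
  case: ifP => [np|_]; last by apply: Rmult_le_pos.
  case: (Req_dec (von_mangoldt n) 0) => [->|L0]; first by apply: Rmult_le_pos.
  have [m m0 mE] := proper_prime_power n n0 np L0.
  have mM : (m < M)%N.
    rewrite ltnNge; apply/negP => Mm.
    have : (M ^ 2 <= m ^ 2)%N by rewrite leq_exp2r.
    have p1 := pdiv_gt0 m; case: mE => mE; first lia.
    have : (m ^ 2 <= m ^ 2 * pdiv m)%N by rewrite leq_pmulr.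
    lia.
  have mi : m \in index_iota 1 M by rewrite mem_index_iota m0.
  rewrite (bigD1_seq _ mi) ?iota_uniq //=.
  have L1 : von_mangoldt n <= ln (INR X).
    apply: Rle_trans (proj2 (von_mangoldt_bound n n0)) _; apply: ln_le; first exact: INR_gt0.
    exact: INR_leq.
  have T0 : 0 <= \sum_(1 <= i < M | i != m) (ind (n == i ^ 2)%N + ind (n == i ^ 2 * pdiv i)%N).
    by apply: Rsum_ge0 => i _; have := ind0 (n == i ^ 2)%N; have := ind0 (n == i ^ 2 * pdiv i)%N; lra.
  have : 1 <= ind (n == m ^ 2)%N + ind (n == m ^ 2 * pdiv m)%N.
    have h1 := ind0 (n == m ^ 2)%N; have h2 := ind0 (n == m ^ 2 * pdiv m)%N.
    by case: mE => /eqP mE; rewrite mE [ind true]/=; lra.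
  nra.
rewrite -Rsum_mull exchange_big /=.
have E a : \sum_(1 <= n < X.+1) ind (n == a)%N <= 1.
  case: (boolP (a \in index_iota 1 X.+1)) => ha.
    rewrite (bigD1_seq _ ha) ?iota_uniq //= eqxx big1 => [|n /negbTE -> //] /=; lra.
  rewrite big_seq big1 => [|n hn]; first lra.
  by case: eqP => // e; rewrite -e hn in ha.
apply: (Rle_trans _ (ln (INR X) * \sum_(1 <= m < M) 2)).
  apply: Rmult_le_compat_l => //; apply: Rsum_le_nat => m _.
  by rewrite big_split /=; have := E (m ^ 2)%N; have := E (m ^ 2 * pdiv m)%N; lra.
rewrite Rsum_const; have : INR (M - 1) <= INR M by apply: INR_leq; lia.
nra.
Qed.

(** * Type I and type II sums *)

Lemma mvt (f df : R -> R) a b : a <= b ->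
  (forall x, a <= x <= b -> is_derive f x (df x)) ->
  exists2 c, a <= c <= b & f b - f a = df c * (b - a).
Proof.
move=> ab H.
have [||c [h1 h2]] := MVT_gen f a b df.
- by move=> x; rewrite Rmin_left // Rmax_right // => h; apply: H; lra.
- move=> x; rewrite Rmin_left // Rmax_right // => h.
  by apply/continuity_pt_filterlim/ex_derive_continuous; exists (df x); apply: H.
by exists c => //; move: h1; rewrite Rmin_left // Rmax_right.
Qed.

Lemma second_difference (u u1 u2 : R -> R) x :
  (forall s, x <= s <= x + 2 -> is_derive u s (u1 s)) ->
  (forall s, x <= s <= x + 2 -> is_derive u1 s (u2 s)) ->
  exists2 z, x <= z <= x + 2 & (u (x + 2) - u (x + 1)) - (u (x + 1) - u x) = u2 z.
Proof.
move=> H1 H2.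
have [||c hc E] := mvt (fun s => u (s + 1) - u s) (fun s => u1 (s + 1) - u1 s) x (x + 1).
- lra.
- move=> s hs; apply: is_derive_minus; last by apply: H1; lra.
  rewrite -[u1 (s + 1)]Rmult_1_l; apply: (is_derive_comp u (fun s => s + 1)).
    by apply: H1; lra.
  by auto_derive => //; ring.
have [||z hz E2] := mvt u1 u2 c (c + 1); [lra|by move=> s hs; apply: H2; lra|].
exists z; first lra.
have -> : x + 2 = x + 1 + 1 by ring.
by rewrite E E2; ring.
Qed.

(* [G y = - y ^ 2 F'' y]; the bounds on [y G'] say that [G] varies at a polynomial rate. *)
Definition phase (Y : R) (F F1 G G1 : R -> R) : Prop :=
  1 <= Y /\ forall y, Y <= y ->
    is_derive F y (F1 y) /\ is_derive F1 y (- G y / y ^ 2) /\ is_derive G y (G1 y) /\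
    0 < G y /\ G y / 2 <= y * G1 y <= 2 * G y.

Lemma phase_gt0 Y F F1 G G1 y : phase Y F F1 G G1 -> Y <= y -> 0 < G y.
Proof. by move=> [_ H] /H [_ [_ [_ []]]]. Qed.

(** The lower bound on y G' makes G increasing, and y G' <= 2 G makes G / y^2 nonincreasing. *)
Lemma phase_doubling Y F F1 G G1 P y : phase Y F F1 G G1 -> Y <= P -> P <= y <= 2 * P ->
  G P <= G y <= 4 * G P.
Proof.
move=> [Y1 H] YP hy.
have H' s : P <= s -> is_derive G s (G1 s) /\ 0 < G s /\ G s / 2 <= s * G1 s <= 2 * G s.
  by move=> hs; have [|_ [_ [h3 [h4 h5]]]] := H s; [lra|].
have g0 := proj1 (proj2 (H' P ltac:(lra))).
split.
  have [||c hc E] := mvt G G1 P y; [lra|by move=> x hx; have [] := H' x ltac:(lra)|].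
  have [_ [p1 p2]] := H' c ltac:(lra).
  have : 0 < G1 c by apply: (Rmult_lt_reg_l c); lra.
  nra.
have [||c hc E] := mvt (fun s => G s / s ^ 2) (fun s => (G1 s * s - 2 * G s) / s ^ 3) P y; first lra.
  move=> x hx; have [d _] := H' x ltac:(lra).
  auto_derive; first by split; [exists (G1 x) | split => //; apply: Rgt_not_eq; rewrite /pow; nra].
  rewrite (is_derive_unique _ _ _ d) (_ : INR 2 = 2) //; field; lra.
have [_ [p1 p2]] := H' c ltac:(lra).
have h : (G1 c * c - 2 * G c) / c ^ 3 * (y - P) <= 0.
  have c3 : 0 < c ^ 3 by apply: pow_lt; lra.
  have : 0 <= (2 * G c - G1 c * c) / c ^ 3 by apply: Rdiv_le_0_compat; lra.
  have -> : (G1 c * c - 2 * G c) / c ^ 3 = - ((2 * G c - G1 c * c) / c ^ 3) by field; lra.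
  nra.
have h2 : G y / y ^ 2 <= G P / P ^ 2 by lra.
have y2 : 0 < y ^ 2 by apply: pow_lt; lra.
have P2 : 0 < P ^ 2 by apply: pow_lt; lra.
have -> : G y = G y / y ^ 2 * y ^ 2 by field; lra.
apply: (Rle_trans _ (G P / P ^ 2 * y ^ 2)); first by apply: Rmult_le_compat_r; lra.
apply: (Rle_trans _ (G P / P ^ 2 * (4 * P ^ 2))).
  apply: Rmult_le_compat_l; first by apply: Rdiv_le_0_compat; lra.
  by rewrite /pow; nra.
by right; field; lra.
Qed.

(** Conjugation reverses the sign of the phase. This is the form needed for a [phase], which is
    concave. *)
Lemma van_der_corput_neg (f : nat -> R) a b l A : (a <= b)%N -> 0 < l -> 1 <= A ->
  (forall n, (a <= n)%N -> (n.+2 < b)%N ->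
     l <= - ((f n.+2 - f n.+1) - (f n.+1 - f n)) <= A * l) ->
  Cmod (\sum_(a <= n < b) e2pi (f n))%C <= 20 * (A * sqrt l * INR (b - a) + / sqrt l).
Proof.
move=> ab l0 A1 H; rewrite -Cmod_conj Csum_conj.
under eq_bigr => n _ do rewrite Cconj_e2pi.
apply: (van_der_corput (fun n => - f n)) => // n h1 h2.
by have := H n h1 h2; lra.
Qed.

(** There are at most P / l + 1 such k, and l <= P absorbs the 1. *)
Lemma interval_count (P l a b : nat) : (0 < l)%N -> (l <= P)%N ->
  (forall k, (a <= k < b)%N -> (P <= k * l <= 2 * P)%N) ->
  INR (b - a) <= 2 * INR P / INR l.
Proof.
move=> l0 lP H.
have l1 := INR_gt0 _ l0.
apply: (Rmult_le_reg_r (INR l)) => //.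
have -> : 2 * INR P / INR l * INR l = INR (2 * P)%N by rewrite INR_muln (_ : INR 2 = 2) //; field; lra.
rewrite -INR_muln; apply: INR_leq.
case: (leqP b a) => ab; first by rewrite (eqP (_ : b - a == 0)%N).
have := H a ltac:(lia); have := H b.-1 ltac:(lia); nia.
Qed.

(** In k, the second derivative of t F (k l) is - t l^2 G y / y^2 at y = k l in [P, 2 P]. There G
    and y^2 each vary by a factor of at most 4, whence the ratio 16 and 320 = 20 * 16. *)
Lemma phase_sum Y F F1 G G1 (P l a b : nat) t xi : phase Y F F1 G G1 -> Y <= INR P -> 0 < t ->
  (0 < l <= P)%N -> (a <= b)%N -> (forall k, (a <= k < b)%N -> (P <= k * l <= 2 * P)%N) ->
  Cmod (\sum_(a <= k < b) e2pi (xi * INR k + t * F (INR (k * l)%N)))%C <=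
  320 * (sqrt (t * G (INR P)) + INR P / (INR l * sqrt (t * G (INR P)))).
Proof.
move=> ph YP t0 /andP[l0 lP] ab H.
have l1 := INR_gt0 _ l0; have [Y1 ph2] := ph; have P0 : 0 < INR P by lra.
have g0 := phase_gt0 _ _ _ _ _ _ ph YP.
set p := INR P in YP P0 g0 *; set g := G p in g0 *.
have tg : 0 < t * g by exact: Rmult_lt_0_compat.
pose lam := t * g * (INR l / (2 * p)) ^ 2.
have q0 : 0 < INR l / (2 * p) by apply: Rdiv_lt_0_compat; lra.
have lam0 : 0 < lam by apply: Rmult_lt_0_compat => //; apply: pow_lt.
have slam : sqrt lam = sqrt (t * g) * (INR l / (2 * p)).
  by rewrite /lam sqrt_mult ?sqrt_pow2; try lra; apply: pow2_ge_0.
have s0 : 0 < sqrt (t * g) by exact: sqrt_lt_R0.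
have cnt := interval_count P l a b l0 lP H.
apply: (Rle_trans _ (20 * (16 * sqrt lam * INR (b - a) + / sqrt lam))); last first.
  have -> : / sqrt lam = 2 * (p / (INR l * sqrt (t * g))) by rewrite slam; field; lra.
  have : sqrt lam * INR (b - a) <= sqrt (t * g).
    rewrite slam; apply: (Rle_trans _ (sqrt (t * g) * (INR l / (2 * p)) * (2 * p / INR l))).
      by apply: Rmult_le_compat_l => //; apply/Rlt_le/Rmult_lt_0_compat.
    by right; field; lra.
  have : 0 < p / (INR l * sqrt (t * g)) by apply: Rdiv_lt_0_compat => //; nra.
  lra.
apply: van_der_corput_neg => //; first lra.
move=> n an nb.
pose u2 x := t * (INR l * INR l) * (- G (x * INR l) / (x * INR l) ^ 2).
have rng s : INR n <= s <= INR n + 2 -> p <= s * INR l <= 2 * p.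
  move=> hs.
  have := H n ltac:(lia); have := H n.+2 ltac:(lia).
  move=> /andP[_ /INR_leq h1] /andP[/INR_leq h2 _].
  move: h1 h2; rewrite !INR_muln !S_INR (_ : INR 0 = 0) //.
  rewrite -/p => h1 h2; have e1 : INR n * INR l <= s * INR l by apply: Rmult_le_compat_r; lra.
  have : s * INR l <= (INR n + 1 + 1) * INR l by apply: Rmult_le_compat_r; lra.
  lra.
have [||z hz E] := second_difference (fun s => xi * s + t * F (s * INR l))
  (fun s => xi + t * INR l * F1 (s * INR l)) u2 (INR n).
- move=> s /rng hs; have [|d1 _] := ph2 (s * INR l); first lra.
  auto_derive; first by exists (F1 (s * INR l)).
  by rewrite (is_derive_unique _ _ _ d1); ring.
- move=> s /rng hs; have [|_ [d2 _]] := ph2 (s * INR l); first lra.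
  auto_derive; first exact: (ex_intro _ _ d2).
  by rewrite (is_derive_unique _ _ _ d2) /u2; ring.
rewrite !INR_muln !S_INR (_ : INR n + 1 + 1 = INR n + 2); last by ring.
rewrite E.
have r := rng z hz.
have gd := phase_doubling _ _ _ _ _ p (z * INR l) ph YP r.
have -> : - u2 z = t * (INR l * INR l) * (G (z * INR l) * / (z * INR l) ^ 2).
  by rewrite /u2; field; split; [lra | nra].
rewrite -/g in gd; move: (z * INR l) r gd => y r gd.
have y2 : 0 < y ^ 2 by apply: pow_lt; lra.
have lb : / (2 * p) ^ 2 <= / y ^ 2 by apply: Rinv_le_contravar => //; apply: pow_incr; lra.
have ub : / y ^ 2 <= / p ^ 2 by apply: Rinv_le_contravar; [apply: pow_lt; lra | apply: pow_incr; lra].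
have ipos : 0 < / (2 * p) ^ 2 by apply: Rinv_0_lt_compat; apply: pow_lt; lra.
have tl : 0 < t * (INR l * INR l) by apply: Rmult_lt_0_compat; nra.
have -> : lam = t * (INR l * INR l) * (g * / (2 * p) ^ 2) by rewrite /lam; field; lra.
have -> : 16 * (t * (INR l * INR l) * (g * / (2 * p) ^ 2)) = t * (INR l * INR l) * (4 * g * / p ^ 2).
  by field; lra.
split; apply: Rmult_le_compat_l; try lra; apply: Rmult_le_compat; lra.
Qed.

(** In k, the second derivative of F (k l') - F (k l) is - (G (k l') - G (k l)) / k^2, which the
    mean value theorem turns into - (l' - l) G' / k. The lower bound on y G' keeps it away from 0,
    at the order (l' - l) l G (P) / P^2. *)
Lemma phase_diff_sum Y F F1 G G1 (P l l' a b : nat) t xi : phase Y F F1 G G1 -> Y <= INR P -> 0 < t ->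
  (0 < l < l')%N -> (l <= P)%N -> (a <= b)%N ->
  (forall k, (a <= k < b)%N -> (P <= k * l)%N /\ (k * l' <= 2 * P)%N) ->
  let T := t * INR (l' - l) * INR l * G (INR P) in
  Cmod (\sum_(a <= k < b) e2pi (xi * INR k + t * (F (INR (k * l')%N) - F (INR (k * l)%N))))%C <=
  2560 * (sqrt T / INR l + INR P / sqrt T).
Proof.
move=> ph YP t0 /andP[l0 ll'] lP ab H T.
have l1 := INR_gt0 _ l0; have [Y1 ph2] := ph; have P0 : 0 < INR P by lra.
have g0 := phase_gt0 _ _ _ _ _ _ ph YP.
have jE : INR (l' - l) = INR l' - INR l.
  have e : INR l' = INR (l' - l) + INR l by rewrite -INR_addn subnK // ltnW.
  lra.
have j0 : 0 < INR (l' - l) by apply: INR_gt0; lia.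
have T0 : 0 < T by rewrite /T; apply: Rmult_lt_0_compat => //; apply: Rmult_lt_0_compat => //; nra.
set p := INR P in YP P0 g0 T T0 *.
(* The estimates below give T / (8 p^2) as a lower bound; 9 in place of 8 keeps the square root
   rational. The upper bound 8 T / p^2 is then 72 lam. *)
pose lam := T * (/ (3 * p)) ^ 2.
have q0 : 0 < / (3 * p) by apply: Rinv_0_lt_compat; lra.
have lam0 : 0 < lam by apply: Rmult_lt_0_compat => //; apply: pow_lt.
have slam : sqrt lam = sqrt T * / (3 * p).
  by rewrite /lam sqrt_mult ?sqrt_pow2; try lra; apply: pow2_ge_0.
have s0 : 0 < sqrt T by exact: sqrt_lt_R0.
have cnt : INR (b - a) <= 2 * p / INR l.
  apply: (interval_count P l) => // k /H [h1 h2]; apply/andP; split=> //.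
  by apply: leq_trans h2; rewrite leq_mul2l (ltnW ll') orbT.
apply: (Rle_trans _ (20 * (72 * sqrt lam * INR (b - a) + / sqrt lam))); last first.
  have -> : / sqrt lam = 3 * (p / sqrt T) by rewrite slam; field; lra.
  have : sqrt lam * INR (b - a) <= sqrt T / INR l * (2 / 3).
    rewrite slam; apply: (Rle_trans _ (sqrt T * / (3 * p) * (2 * p / INR l))).
      by apply: Rmult_le_compat_l => //; apply/Rlt_le/Rmult_lt_0_compat.
    by right; field; lra.
  have : 0 < sqrt T / INR l by apply: Rdiv_lt_0_compat.
  have : 0 < p / sqrt T by apply: Rdiv_lt_0_compat => //; nra.
  lra.
apply: van_der_corput_neg => //; first lra.
move=> n an nb.
pose u2 x := - (t * ((G (x * INR l') - G (x * INR l)) / x ^ 2)).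
have rng s : INR n <= s <= INR n + 2 -> 0 < s /\ p <= s * INR l /\ s * INR l' <= 2 * p.
  move=> hs.
  have := H n ltac:(lia); have := H n.+2 ltac:(lia).
  move=> [_ /INR_leq h1] [/INR_leq h2 _].
  move: h1 h2; rewrite !INR_muln !S_INR (_ : INR 0 = 0) //.
  rewrite -/p => h1 h2; have e1 : INR n * INR l <= s * INR l by apply: Rmult_le_compat_r; lra.
  have : s * INR l' <= (INR n + 1 + 1) * INR l' by apply: Rmult_le_compat_r; lra.
  split; last lra.
  by apply: (Rmult_lt_reg_r (INR l)); lra.
have rng' s : INR n <= s <= INR n + 2 -> p <= s * INR l <= 2 * p /\ p <= s * INR l' <= 2 * p.
  move=> /rng [s1 [h1 h2]]; have : s * INR l <= s * INR l' by apply: Rmult_le_compat_l; lra.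
  lra.
have [||z hz E] := second_difference (fun s => xi * s + t * (F (s * INR l') - F (s * INR l)))
  (fun s => xi + t * (INR l' * F1 (s * INR l') - INR l * F1 (s * INR l))) u2 (INR n).
- move=> s /rng' [hs hs']; have [|d1 _] := ph2 (s * INR l); first lra.
  have [|d1' _] := ph2 (s * INR l'); first lra.
  auto_derive; first by split; [exact: (ex_intro _ _ d1') | split; [exact: (ex_intro _ _ d1)|]].
  by rewrite (is_derive_unique _ _ _ d1) (is_derive_unique _ _ _ d1'); ring.
- move=> s hs0; have [hs hs'] := rng' s hs0; have [s1 _] := rng s hs0.
  have [|_ [d2 _]] := ph2 (s * INR l); first lra.
  have [|_ [d2' _]] := ph2 (s * INR l'); first lra.
  auto_derive; first by split; [exact: (ex_intro _ _ d2') | split; [exact: (ex_intro _ _ d2)|]].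
  rewrite (is_derive_unique _ _ _ d2) (is_derive_unique _ _ _ d2') /u2; field; nra.
rewrite !INR_muln !S_INR (_ : INR n + 1 + 1 = INR n + 2); last by ring.
rewrite E.
have [r r'] := rng' z hz; have [z0 _] := rng z hz.
have [||c hc EG] := mvt G G1 (z * INR l) (z * INR l').
- by apply: Rmult_le_compat_l; lra.
- by move=> x hx; have [|_ [_ [d _]]] := ph2 x; [lra|].
have gd := phase_doubling _ _ _ _ _ p c ph YP ltac:(lra).
have [_ [_ [_ [gc0 gc]]]] := ph2 c ltac:(lra).
have -> : - u2 z = t * INR (l' - l) * (G1 c * / z).
  by rewrite /u2 EG jE; field; lra.
have tj : 0 < t * INR (l' - l) by apply: Rmult_lt_0_compat.
have -> : lam = t * INR (l' - l) * (INR l * G p / (3 * p) ^ 2).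
  by rewrite /lam /T; field; lra.
have -> : 72 * (t * INR (l' - l) * (INR l * G p / (3 * p) ^ 2)) = t * INR (l' - l) * ((8 * G p / p) * (INR l / p)).
  by field; lra.
have g1l : G p / (4 * p) <= G1 c.
  apply: (Rmult_le_reg_l c); first lra.
  apply: (Rle_trans _ (G c / 2)); last lra.
  have -> : c * (G p / (4 * p)) = G p / 2 * (c / (2 * p)) by field; lra.
  have : c / (2 * p) <= 1 by apply: (Rmult_le_reg_r (2 * p)); [lra|]; rewrite /Rdiv Rmult_assoc Rinv_l; lra.
  have : 0 < c / (2 * p) by apply: Rdiv_lt_0_compat; lra.
  nra.
have g1u : G1 c <= 8 * G p / p.
  apply: (Rmult_le_reg_l c); first lra.
  apply: (Rle_trans _ (8 * G p)); first lra.
  have -> : c * (8 * G p / p) = 8 * G p * (c / p) by field; lra.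
  have : 1 <= c / p by apply: (Rmult_le_reg_r p); [lra|]; rewrite /Rdiv Rmult_assoc Rinv_l; lra.
  nra.
have zl : INR l / (2 * p) <= / z.
  apply: (Rmult_le_reg_r (2 * p * z)); first nra.
  have -> : INR l / (2 * p) * (2 * p * z) = z * INR l by field; lra.
  by rewrite (_ : / z * (2 * p * z) = 2 * p); [lra | field; lra].
have zu : / z <= INR l / p.
  apply: (Rmult_le_reg_r (p * z)); first nra.
  have -> : INR l / p * (p * z) = z * INR l by field; lra.
  by rewrite (_ : / z * (p * z) = p); [lra | field; lra].
have q1 : 0 < G p / (4 * p) by apply: Rdiv_lt_0_compat; lra.
have q2 : 0 < INR l / (2 * p) by apply: Rdiv_lt_0_compat; lra.
split; apply: Rmult_le_compat_l; try lra; last by apply: Rmult_le_compat; lra.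
apply: (Rle_trans _ (G p / (4 * p) * (INR l / (2 * p)))); last by apply: Rmult_le_compat; lra.
have -> : G p / (4 * p) * (INR l / (2 * p)) = INR l * G p / (3 * p) ^ 2 * (9 / 8) by field; lra.
have : 0 < INR l * G p / (3 * p) ^ 2 by apply: Rdiv_lt_0_compat; [nra | apply: pow_lt; lra].
lra.
Qed.

Lemma ln_le_sub1 y : 0 < y -> ln y <= y - 1.
Proof.
move=> y0; have := exp_ineq1_le (ln y); rewrite exp_ln //; lra.
Qed.

Lemma harmonic_bound n : (0 < n)%N -> \sum_(1 <= i < n.+1) / INR i <= 1 + ln (INR n).
Proof.
elim: n => // n IH _; case: (posnP n) => [->|n0].
  by rewrite big_nat1 (_ : INR 1 = 1) // ln_1; lra.
rewrite big_nat_recr //=; have := IH n0; have i0 := INR_gt0 _ n0; rewrite S_INR.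
have : ln (INR n / (INR n + 1)) <= - / (INR n + 1).
  apply: Rle_trans (ln_le_sub1 _ _) _; first by apply: Rdiv_lt_0_compat; lra.
  by right; field; lra.
rewrite ln_div; lra.
Qed.

Lemma sum_window (m n a b : nat) (g h : nat -> C) : (m <= a)%N -> (b <= n)%N ->
  (forall k, (m <= k < n)%N -> g k = if (a <= k < b)%N then h k else RtoC 0) ->
  (\sum_(m <= k < n) g k = \sum_(a <= k < b) h k)%C.
Proof.
move=> ma bn H; have Z c d : (m <= c)%N -> (d <= n)%N ->
    (forall k, (c <= k < d)%N -> ~~ (a <= k < b)%N) -> (\sum_(c <= k < d) g k = RtoC 0)%C.
  move=> mc dn hk; rewrite big_nat big1 // => k hk2.
  by rewrite H; [rewrite (negbTE (hk k hk2)) | lia].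
case: (leqP a b) => ab; last first.
  by rewrite [RHS]big_geq ?(ltnW ab) // Z // => k _; lia.
case: (leqP m n) => mn; last by rewrite !big_geq //; lia.
rewrite (@big_cat_nat _ _ _ a) //=; last by lia.
rewrite (@big_cat_nat _ _ _ b a n) //= (Z m a) //; [|lia|by move=> k; lia].
rewrite (Z b n) //; [|lia|by move=> k; lia].
rewrite Cplus_0_l Cplus_0_r; apply: eq_big_nat => k hk.
by rewrite H ?hk //; lia.
Qed.

(** Extended by 0 outside the window, so that it can serve as the function F of [vaughan_identity]
    and all sums can run over fixed ranges. *)
Definition wave (P P' : nat) (F : R -> R) (t xi : R) (n : nat) : C :=
  if (P < n <= P')%N then e2pi (xi * INR n + t * F (INR n)) else RtoC 0.

Lemma Cmod_wave P P' F t xi n : Cmod (wave P P' F t xi n) <= 1.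
Proof. by rewrite /wave; case: ifP => _; rewrite ?Cmod_e2pi ?Cmod_0; lra. Qed.

Lemma wave_gt P P' F t xi n : (P' < n)%N -> wave P P' F t xi n = RtoC 0.
Proof. by move=> h; rewrite /wave ifF //; lia. Qed.

Lemma type1_inner Y F F1 G G1 (P P' l c : nat) t xi : phase Y F F1 G G1 -> Y <= INR P ->
  0 < t -> (P' <= 2 * P)%N -> (0 < l <= P)%N ->
  Cmod (\sum_(1 <= k < c.+1) wave P P' F t xi (l * k)%N)%C <=
  320 * (sqrt (t * G (INR P)) + INR P / (INR l * sqrt (t * G (INR P)))).
Proof.
move=> ph YP t0 P2 lP; have /andP[l0 _] := lP.
rewrite (sum_window _ _ (P %/ l).+1 (minn c (P' %/ l)).+1 _
  (fun k => e2pi (xi * INR l * INR k + t * F (INR (k * l)%N)))) //; first last.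
- move=> k /andP[k0 kc]; rewrite /wave mulnC.
  have -> : (P < k * l <= P')%N = ((P %/ l).+1 <= k < (minn c (P' %/ l)).+1)%N.
    by rewrite ltn_divLR // ltnS leq_min (_ : (k <= c)%N) ?leq_divRL //; lia.
  by case: ifP => // _; rewrite INR_muln; congr e2pi; ring.
- by rewrite ltnS geq_minl.
have [ab|ab] := leqP (P %/ l).+1 (minn c (P' %/ l)).+1.
  apply: phase_sum ph YP t0 lP ab _ => k /andP[h1 h2].
  rewrite ltn_divLR // in h1; rewrite ltnS leq_min leq_divRL // in h2; lia.
rewrite big_geq ?(ltnW ab) // Cmod_0.
have l1 := INR_gt0 _ l0; have P0 : 0 < INR P by apply: INR_gt0; lia.
have g0 := phase_gt0 _ _ _ _ _ _ ph YP.
have s0 : 0 < sqrt (t * G (INR P)) by apply: sqrt_lt_R0; nra.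
have : 0 < INR P / (INR l * sqrt (t * G (INR P))) by apply: Rdiv_lt_0_compat; nra.
lra.
Qed.

(** An application of [phase_diff_sum] with l >= l0: the first term uses l' - l <= J and the second
    l' - l >= 1. *)
Lemma wave_correlation Y F F1 G G1 (P P' J K l0 l l' : nat) t xi : phase Y F F1 G G1 ->
  Y <= INR P -> 0 < t -> (P' <= 2 * P)%N -> (0 < l0)%N -> (2 * P %/ l0 <= K)%N ->
  (l0 <= l < l')%N -> (l' < l0 + J)%N -> (l0 + J <= P)%N ->
  Cmod (\sum_(1 <= k < K.+1)
    (wave P P' F t xi (k * l')%N * Cconj (wave P P' F t xi (k * l)%N)))%C <=
  2560 * (sqrt (t * INR J * G (INR P)) / sqrt (INR l0)
          + INR P / (sqrt (t * G (INR P)) * sqrt (INR l0))).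
Proof.
move=> ph YP t0 P2 l00 hK /andP[l0l ll'] l'J JP.
have l0p : (0 < l)%N by lia.
have l0p' : (0 < l')%N by lia.
have i0 := INR_gt0 _ l00; have il := INR_gt0 _ l0p; have P0 : 0 < INR P by apply: INR_gt0; lia.
have J0 : 0 < INR J by apply: INR_gt0; lia.
have g0 := phase_gt0 _ _ _ _ _ _ ph YP.
have tg : 0 < t * G (INR P) by apply: Rmult_lt_0_compat.
have s0 : 0 < sqrt (t * G (INR P)) by apply: sqrt_lt_R0.
have q0 : 0 < sqrt (INR l0) by apply: sqrt_lt_R0.
have tJ : 0 < t * INR J * G (INR P) by apply: Rmult_lt_0_compat => //; nra.
have sJ : 0 < sqrt (t * INR J * G (INR P)) by exact: sqrt_lt_R0.
rewrite (sum_window _ _ (P %/ l).+1 (P' %/ l').+1 _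
  (fun k => e2pi (xi * INR (l' - l) * INR k + t * (F (INR (k * l')%N) - F (INR (k * l)%N))))) //; first last.
- move=> k /andP[k0 kK]; rewrite /wave.
  have ab1 : (P < k * l)%N = ((P %/ l).+1 <= k)%N by rewrite ltn_divLR.
  have ab2 : (k * l' <= P')%N = (k < (P' %/ l').+1)%N by rewrite ltnS leq_divRL.
  rewrite -ab1 -ab2.
  have mono : (k * l <= k * l')%N by rewrite leq_mul2l (ltnW ll') orbT.
  case: (ltnP P (k * l)) => h1; last by rewrite /= Cconj_R Cmult_0_r.
  case: (leqP (k * l') P') => h2; last by rewrite andbF Cmult_0_l.
  rewrite (leq_trans h1 mono) (leq_trans mono h2) /= Cconj_e2pi -e2piD; congr e2pi.
  have -> : INR (l' - l) = INR l' - INR l by have : INR l' = INR (l' - l) + INR l; [rewrite -INR_addn subnK // ltnW | lra].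
  by rewrite !INR_muln; ring.
- rewrite ltnS; apply: leq_trans hK; apply: leq_trans (leq_div2r _ P2) _.
  by apply: leq_div2l => //; lia.
have [ab|ab] := leqP (P %/ l).+1 (P' %/ l').+1; last first.
  rewrite big_geq ?(ltnW ab) // Cmod_0.
  have : 0 < sqrt (t * INR J * G (INR P)) / sqrt (INR l0) by apply: Rdiv_lt_0_compat.
  have : 0 < INR P / (sqrt (t * G (INR P)) * sqrt (INR l0)) by apply: Rdiv_lt_0_compat; nra.
  lra.
apply: (Rle_trans _ _ _ (phase_diff_sum _ _ _ _ _ P l l' _ _ t _ ph YP t0 _ _ ab _)).
- by rewrite l0p ll'.
- by lia.
- move=> k /andP[h1 h2]; rewrite ltn_divLR // in h1; rewrite ltnS leq_divRL // in h2; lia.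
have j1 : 1 <= INR (l' - l) by apply: INR_ge1; lia.
have jJ : INR (l' - l) <= INR J by apply: INR_leq; lia.
have ll0 : INR l0 <= INR l by exact: INR_leq.
have sl : 0 < sqrt (INR l) by exact: sqrt_lt_R0.
have sll : sqrt (INR l0) <= sqrt (INR l) by apply: sqrt_le_1; lra.
have ssl : sqrt (INR l) * sqrt (INR l) = INR l by apply: sqrt_sqrt; lra.
have E : sqrt (t * INR (l' - l) * INR l * G (INR P)) = sqrt (t * INR (l' - l) * G (INR P)) * sqrt (INR l).
  rewrite -sqrt_mult; [congr sqrt; ring| |lra].
  by apply: Rmult_le_pos; nra.
apply: Rmult_le_compat_l; first lra; apply: Rplus_le_compat.
  rewrite E -{2}ssl (_ : _ / _ = sqrt (t * INR (l' - l) * G (INR P)) / sqrt (INR l)); last by field; lra.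
  apply: Rmult_le_compat; try exact: sqrt_pos; [by apply/Rlt_le/Rinv_0_lt_compat| |exact: Rinv_le_contravar].
  apply: sqrt_le_1; [apply: Rmult_le_pos; nra|lra|].
  by apply: Rmult_le_compat_r; [lra | apply: Rmult_le_compat_l; lra].
apply: Rmult_le_compat_l; first lra; apply: Rinv_le_contravar; first nra.
rewrite E; apply: Rmult_le_compat => //; try exact: sqrt_pos.
by apply: sqrt_le_1; [lra | apply: Rmult_le_pos; nra | nra].
Qed.

(* The square of the saving factor: the terms come from the diagonal and from the two terms of
   van der Corput's bound, the block [i J <= l < (i + 1) J] being weighted by [1 / i]. *)
Definition type2_gain (g : R) (P J : nat) (t q : R) : R :=
  / INR J + sqrt (t * INR J * g) * sqrt q / INR P + sqrt q / sqrt (t * g).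

(** Cauchy-Schwarz in k, with l in [i J, i J + J) inside. Expanding the square gives J diagonal
    correlations of size at most K and at most J^2 others, bounded by [wave_correlation]. As k runs
    up to 2 P / (i J) only, the block carries the factor J / (i J) = 1 / i. *)
Lemma type2_block Y F F1 G G1 (P P' J i : nat) (a b : nat -> R) A B t xi :
  phase Y F F1 G G1 -> Y <= INR P -> 0 < t -> (P' <= 2 * P)%N -> (0 < J)%N -> (0 < i)%N ->
  (2 * (i * J) <= P)%N -> 0 <= A -> 0 <= B ->
  (forall k, (0 < k <= 2 * P)%N -> Rabs (a k) <= A) -> (forall l, Rabs (b l) <= B) ->
  Cmod (\sum_(i * J <= l < i * J + J) \sum_(1 <= k < (2 * P).+1)
     (RtoC (a k) * RtoC (b l) * wave P P' F t xi (k * l)%N))%C <=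
  A * B * INR P * (72 * sqrt (type2_gain (G (INR P)) P J t (INR (i * J)%N))) * / INR i.
Proof.
move=> ph YP t0 P2 J0 i0 lP A0 B0 Ha Hb.
set l0 := (i * J)%N in lP *.
have l00 : (0 < l0)%N by rewrite muln_gt0 i0.
have Jl0 : (J <= l0)%N by rewrite /l0 leq_pmull.
set K := (2 * P %/ l0)%N; have KP : (K <= 2 * P)%N by exact: leq_div.
have rl0 := INR_gt0 _ l00; have rJ := INR_gt0 _ J0; have ri := INR_gt0 _ i0.
have P0 : 0 < INR P by apply: INR_gt0; lia.
have g0 := phase_gt0 _ _ _ _ _ _ ph YP.
set g := G (INR P) in g0 *.
have tg : 0 < t * g by apply: Rmult_lt_0_compat.
have s0 : 0 < sqrt (t * g) by apply: sqrt_lt_R0.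
have q0 : 0 < sqrt (INR l0) by apply: sqrt_lt_R0.
have qq : sqrt (INR l0) * sqrt (INR l0) = INR l0 by apply: sqrt_sqrt; lra.
have sJ : 0 <= sqrt (t * INR J * g) by exact: sqrt_pos.
set w := wave P P' F t xi.
rewrite exchange_big /=.
set S := (X in Cmod X).
(* For k > K already k l0 exceeds 2 P, and the wave vanishes on the whole block. *)
have SE : S = (\sum_(1 <= k < K.+1) (RtoC (a k) * \sum_(l0 <= l < l0 + J) (RtoC (b l) * w (k * l)%N)))%C.
  rewrite /S; apply: sum_window => // k hk.
  rewrite Csum_mull; case: ifP => hk2; first by apply: eq_bigr => l _; ring.
  rewrite big_nat big1 // => l hl; rewrite /w wave_gt ?Cmult_0_r //.
  apply: (leq_ltn_trans P2); apply: (@leq_trans (k * l0)); last by apply: leq_mul => //; case/andP: hl.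
  by rewrite -ltn_divLR // -/K; lia.
have Ka : \sum_(k <- index_iota 1 K.+1) Cmod (RtoC (a k)) ^ 2 <= INR K * A ^ 2.
  apply: (Rle_trans _ (\sum_(1 <= k < K.+1) A ^ 2)); last by rewrite Rsum_const subn1 /=; lra.
  apply: Rsum_le_nat => k hk; apply: pow_incr; split; first exact: Cmod_ge_0.
  by rewrite Cmod_R; apply: Ha; lia.
pose Off := 2560 * (sqrt (t * INR J * g) / sqrt (INR l0) + INR P / (sqrt (t * g) * sqrt (INR l0))).
have Off0 : 0 <= Off.
  have : 0 <= sqrt (t * INR J * g) / sqrt (INR l0) by apply: Rdiv_le_0_compat.
  have : 0 < INR P / (sqrt (t * g) * sqrt (INR l0)) by apply: Rdiv_lt_0_compat; nra.
  rewrite /Off; lra.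
have corr l l' : (l0 <= l < l0 + J)%N -> (l0 <= l' < l0 + J)%N -> l' != l ->
    Cmod (\sum_(1 <= k < K.+1) (w (k * l)%N * Cconj (w (k * l')%N)))%C <= Off.
  move=> hl hl' ne; case: (ltnP l' l) => ll.
    by apply: (wave_correlation _ _ _ _ _ _ _ _ _ _ _ _ _ _ ph YP t0 P2 l00 (leqnn _)); lia.
  rewrite -Cmod_conj Csum_conj.
  under eq_bigr => k _ do rewrite Cmult_conj Cconj_conj Cmult_comm.
  by apply: (wave_correlation _ _ _ _ _ _ _ _ _ _ _ _ _ _ ph YP t0 P2 l00 (leqnn _)); lia.
have KZ : \sum_(k <- index_iota 1 K.+1) Cmod (\sum_(l0 <= l < l0 + J) (RtoC (b l) * w (k * l)%N))%C ^ 2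
    <= B ^ 2 * (INR J * (INR K + INR J * Off)).
  set Z := \sum_(k <- _) _.
  have Z0 : 0 <= Z by apply: Rsum_ge0 => k _; exact: pow2_ge_0.
  rewrite -(Rabs_pos_eq Z) // -Cmod_R /Z RtoC_sum.
  have -> : (\sum_(k <- index_iota 1 K.+1)
       RtoC (Cmod (\sum_(l0 <= l < l0 + J) (RtoC (b l) * w (k * l)%N))%C ^ 2) =
     \sum_(l0 <= l < l0 + J) \sum_(l0 <= l' < l0 + J) (RtoC (b l * b l') *
        \sum_(1 <= k < K.+1) (w (k * l)%N * Cconj (w (k * l')%N))))%C.
    under eq_bigr => k _ do rewrite Cmod2_sum.
    rewrite exchange_big; apply: eq_bigr => l _; rewrite exchange_big; apply: eq_bigr => l' _.
    rewrite Csum_mull; apply: eq_bigr => k _; rewrite Cmult_conj Cconj_R RtoC_mult; ring.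
  apply: Rle_trans (Cmod_sum _ _ _ _) _.
  have -> : B ^ 2 * (INR J * (INR K + INR J * Off)) =
      \sum_(l0 <= l < l0 + J) (B ^ 2 * (INR K + INR J * Off)).
    by rewrite Rsum_const (_ : l0 + J - l0 = J)%N; [ring | lia].
  apply: Rsum_le_nat => l hl.
  apply: (Rle_trans _ (\sum_(l0 <= l' < l0 + J) (B ^ 2 * ((if l' == l then INR K else 0) + Off)))).
    apply: Cmod_sum_le => l' hl'; rewrite Cmod_mult Cmod_R.
    apply: Rmult_le_compat; [exact: Rabs_pos | exact: Cmod_ge_0 | |].
      rewrite Rabs_mult /pow Rmult_1_r.
      by apply: Rmult_le_compat; try exact: Rabs_pos; apply: Hb.
    case: (eqVneq l' l) => [->|ne]; last by have := corr l l' hl hl' ne; lra.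
    apply: (Rle_trans _ (INR K)); last lra.
    apply: Rle_trans (Cmod_sum _ _ _ _) _.
    apply: (Rle_trans _ (\sum_(1 <= k < K.+1) 1)); last by rewrite Rsum_const subn1 /=; lra.
    apply: Rsum_le => k _; rewrite Cmod_mult Cmod_conj.
    have := Cmod_wave P P' F t xi (k * l)%N; rewrite -/w.
    have := Cmod_ge_0 (w (k * l)%N); nra.
  rewrite -Rsum_mull; apply: Rmult_le_compat_l; first exact: pow2_ge_0.
  rewrite big_split /= Rsum_const (_ : l0 + J - l0 = J)%N; last by lia.
  apply: Rplus_le_compat_r.
  rewrite (bigD1_seq l) /= ?iota_uniq ?mem_index_iota ?hl // eqxx big1 => [|l' /negbTE -> //].
  by lra.
have KR : INR K <= 2 * INR P / INR l0.
  apply: (Rmult_le_reg_r (INR l0)) => //.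
  have -> : 2 * INR P / INR l0 * INR l0 = INR (2 * P)%N by rewrite INR_muln (_ : INR 2 = 2) //; field; lra.
  by rewrite -INR_muln; apply: INR_leq; rewrite /K leq_divM.
(* The factor 5120 = 2 * 2560, with 2560 from [Off], is rounded up to the square 5184 = 72^2. *)
have S2 : Cmod S ^ 2 <= (A * B * INR P * / INR i) ^ 2 * (5184 * type2_gain g P J t (INR l0)).
  rewrite SE; apply: Rle_trans (Csum_cauchy_schwarz _ _ _ _) _.
  apply: (Rle_trans _ (INR K * A ^ 2 * (B ^ 2 * (INR J * (INR K + INR J * Off))))).
    by apply: Rmult_le_compat => //; apply: Rsum_ge0 => k _; exact: pow2_ge_0.
  apply: (Rle_trans _ (2 * INR P / INR l0 * A ^ 2 * (B ^ 2 * (INR J * (2 * INR P / INR l0 + INR J * Off))))).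
    have K0 := pos_INR K; have A2 := pow2_ge_0 A; have B2 := pow2_ge_0 B.
    have JO : 0 <= INR J * Off by nra.
    apply: Rmult_le_compat; [nra| |by apply: Rmult_le_compat_r|].
      by apply: Rmult_le_pos => //; apply: Rmult_le_pos; lra.
    apply: Rmult_le_compat_l => //; apply: Rmult_le_compat_l; lra.
  have -> : / INR i = INR J / INR l0.
    by rewrite /l0 INR_muln; field; lra.
  have -> : 2 * INR P / INR l0 * A ^ 2 * (B ^ 2 * (INR J * (2 * INR P / INR l0 + INR J * Off))) =
      (A * B * INR P * (INR J / INR l0)) ^ 2 * (4 * / INR J +
        5120 * (sqrt (t * INR J * g) * sqrt (INR l0) / INR P + sqrt (INR l0) / sqrt (t * g))).
    by rewrite /Off; move: (sqrt (INR l0)) qq q0 => q qq q0; rewrite -qq; field; lra.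
  apply: Rmult_le_compat_l; first exact: pow2_ge_0.
  rewrite /type2_gain.
  have : 0 < / INR J by exact: Rinv_0_lt_compat.
  have : 0 <= sqrt (t * INR J * g) * sqrt (INR l0) / INR P.
    by apply: Rdiv_le_0_compat => //; nra.
  have : 0 <= sqrt (INR l0) / sqrt (t * g) by apply: Rdiv_le_0_compat; lra.
  lra.
have i1 : 0 < / INR i by exact: Rinv_0_lt_compat.
have AB : 0 <= A * B * INR P * / INR i by apply: Rmult_le_pos; [apply: Rmult_le_pos; nra | lra].
rewrite -(sqrt_pow2 (Cmod S)); last exact: Cmod_ge_0.
apply: Rle_trans (sqrt_le_1_alt _ _ S2) _.
rewrite sqrt_mult_alt; last exact: pow2_ge_0.
rewrite sqrt_pow2 // sqrt_mult_alt; last lra.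
have -> : sqrt 5184 = 72 by rewrite (_ : 5184 = 72 ^ 2); [rewrite sqrt_pow2; lra | rewrite /pow; ring].
by right; ring.
Qed.

Lemma type2_gain_le g P J t q q' : 0 < INR P -> q <= q' ->
  0 < t * g -> type2_gain g P J t q <= type2_gain g P J t q'.
Proof.
move=> P0 qq tg; rewrite /type2_gain.
have sq : sqrt q <= sqrt q' by exact: sqrt_le_1_alt.
have s0 : 0 < sqrt (t * g) by exact: sqrt_lt_R0.
have i0 : 0 < / sqrt (t * g) by exact: Rinv_0_lt_compat.
have i1 : 0 < / INR P by exact: Rinv_0_lt_compat.
apply: Rplus_le_compat; last by apply: Rmult_le_compat_r; lra.
apply: Rplus_le_compat_l; apply: Rmult_le_compat_r; first lra.
by apply: Rmult_le_compat_l => //; exact: sqrt_pos.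
Qed.

Lemma sum_blocks (J N : nat) (g : nat -> C) :
  (\sum_(J <= l < N.+1 * J) g l = \sum_(1 <= i < N.+1) \sum_(i * J <= l < i * J + J) g l)%C.
Proof.
elim: N => [|N IH]; first by rewrite mul1n !big_geq.
rewrite [RHS]big_nat_recr //= -IH (@big_cat_nat _ _ _ (N.+1 * J)) /=; [|lia|lia].
by congr (_ + _)%C; rewrite [(N.+2 * J)%N]mulSn addnC.
Qed.

(** The support of b starts at J, so that all blocks have index i >= 1 and their weights 1 / i add
    up to a logarithm. *)
Lemma type2_sum Y F F1 G G1 (P P' J Q : nat) (a b : nat -> R) A B t xi :
  phase Y F F1 G G1 -> Y <= INR P -> 0 < t -> (P' <= 2 * P)%N -> (0 < J)%N ->
  (2 * Q <= P)%N -> 0 <= A -> 0 <= B ->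
  (forall k, (0 < k <= 2 * P)%N -> Rabs (a k) <= A) -> (forall l, Rabs (b l) <= B) ->
  (forall l, ~~ (J <= l <= Q)%N -> b l = 0) ->
  Cmod (\sum_(1 <= l < (2 * P).+1) \sum_(1 <= k < (2 * P).+1)
     (RtoC (a k) * RtoC (b l) * wave P P' F t xi (k * l)%N))%C <=
  A * B * INR P * (72 * sqrt (type2_gain (G (INR P)) P J t (INR Q))) * (1 + ln (INR (2 * P)%N)).
Proof.
move=> ph YP t0 P2 J0 QP A0 B0 Ha Hb bZ.
have P0 : 0 < INR P by have [] := ph; lra.
have P00 : (0 < P)%N by case: P P0 {YP P2 QP Ha} => // ; rewrite (_ : INR 0 = 0) //; lra.
have g0 := phase_gt0 _ _ _ _ _ _ ph YP.
have tg : 0 < t * G (INR P) by apply: Rmult_lt_0_compat.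
set X := (2 * P)%N.
pose T l := (\sum_(1 <= k < X.+1) (RtoC (a k) * RtoC (b l) * wave P P' F t xi (k * l)%N))%C.
have TZ l : ~~ (J <= l <= Q)%N -> T l = RtoC 0.
  by move=> h; rewrite /T big1 // => k _; rewrite bZ // Cmult_0_r Cmult_0_l.
have -> : (\sum_(1 <= l < X.+1) T l = \sum_(1 <= i < X.+1) \sum_(i * J <= l < i * J + J) T l)%C.
  rewrite -sum_blocks; transitivity (\sum_(J <= l < Q.+1) T l)%C.
    apply: sum_window => //; first by lia.
    by move=> k hk; case: ifP => // h; rewrite TZ ?h //; apply/negP => /andP[h1 h2]; rewrite h1 ltnS h2 in h.
  apply: esym; apply: sum_window => //; first by apply: (@leq_trans X.+1); [lia | rewrite leq_pmulr].
  by move=> k hk; case: ifP => // h; rewrite TZ //; apply/negP => /andP[h1 h2]; rewrite h1 ltnS h2 in h.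
apply: Rle_trans (Cmod_sum _ _ _ _) _.
set W := A * B * INR P * (72 * sqrt (type2_gain (G (INR P)) P J t (INR Q))).
have W0 : 0 <= W.
  by apply: Rmult_le_pos; [apply: Rmult_le_pos; nra | have := sqrt_pos (type2_gain (G (INR P)) P J t (INR Q)); lra].
apply: (Rle_trans _ (\sum_(1 <= i < X.+1) (W * / INR i))); last first.
  by rewrite -Rsum_mull; apply: Rmult_le_compat_l => //; apply: harmonic_bound; lia.
apply: Rsum_le_nat => i /andP[i0 iX].
have ri := INR_gt0 _ i0; have ii : 0 < / INR i by exact: Rinv_0_lt_compat.
case: (leqP (i * J) Q) => iQ; last first.
  rewrite big_nat big1 ?Cmod_0; first by apply: Rmult_le_pos; lra.
  by move=> l hl; apply: TZ; lia.
apply: Rle_trans (type2_block _ _ _ _ _ _ _ _ _ _ _ _ _ _ _ ph YP t0 P2 J0 i0 _ A0 B0 Ha Hb) _; first by lia.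
apply: Rmult_le_compat_r; first lra.
apply: Rmult_le_compat_l; first by apply: Rmult_le_pos; nra.
apply: Rmult_le_compat_l; first lra.
by apply: sqrt_le_1_alt; apply: type2_gain_le => //; exact: INR_leq.
Qed.

Lemma sum_upto_coef (X U : nat) (f : nat -> R) (g : nat -> C) : (U <= X)%N ->
  (\sum_(1 <= b < X.+1) (RtoC (upto U f b) * g b) = \sum_(1 <= b < U.+1) (RtoC (f b) * g b))%C.
Proof.
move=> UX; apply: sum_window => // k /andP[k0 kX]; rewrite k0 ltnS /upto.
by case: ifP => // _; rewrite Cmult_0_l.
Qed.

Lemma ln_INR_le m n : (0 < m <= n)%N -> ln (INR m) <= ln (INR n).
Proof. by move=> /andP[m0 mn]; apply: ln_le; [exact: INR_gt0 | exact: INR_leq]. Qed.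

(** This is [vaughan_identity] with both cut-offs equal to U; the terms n <= U vanish because the
    wave lives beyond P >= U. The logarithm in the first sum goes by partial summation, and U^2 <= P
    keeps b c within the reach of [type1_inner] in the second. The powers of 1 + L come from
    harmonic sums over b and c, and over the blocks. *)
Lemma lambda_exp_sum Y F F1 G G1 (P P' J U Q : nat) D t xi :
  phase Y F F1 G G1 -> Y <= INR P -> 0 < t -> (P' <= 2 * P)%N -> (0 < J)%N -> (J <= U)%N ->
  (U * U <= P)%N -> (2 * P < Q.+1 * Q.+1)%N -> (2 * Q <= P)%N ->
  (forall k, (0 < k <= 2 * P)%N -> INR (size (divisors k)) <= D) ->
  let L := ln (INR (2 * P)%N) in let g := t * G (INR P) in
  Cmod (\sum_(1 <= n < (2 * P).+1) (RtoC (von_mangoldt n) * wave P P' F t xi n))%C <=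
  960 * L * (1 + L) ^ 2 * (INR (U * U)%N * sqrt g + INR P / sqrt g) +
  2 * (D * L * INR P * (72 * sqrt (type2_gain (G (INR P)) P J t (INR Q))) * (1 + L)).
Proof.
move=> ph YP t0 P2 J0 JU UP QP Q2 HD L g.
have U0 : (0 < U)%N by lia.
have P0 : 0 < INR P by have [] := ph; lra.
have UlP : (U <= P)%N by apply: leq_trans UP; rewrite leq_pmull.
have P00 : (0 < P)%N by lia.
have g0 := phase_gt0 _ _ _ _ _ _ ph YP.
have tg : 0 < g by apply: Rmult_lt_0_compat.
have s0 : 0 < sqrt g by exact: sqrt_lt_R0.
set X := (2 * P)%N in L HD *.
have L0 : 0 <= L by apply: ln_ge0; apply: INR_ge1; lia.
have D0 : 0 <= D by apply: Rle_trans (pos_INR _) (HD 1%N _); lia.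
set w := wave P P' F t xi.
have wX n : (X < n)%N -> w n = RtoC 0 by move=> h; apply: wave_gt; lia.
have wP n : (n <= P)%N -> w n = RtoC 0 by move=> h; rewrite /w /wave ifF //; lia.
have -> : (\sum_(1 <= n < X.+1) (RtoC (von_mangoldt n) * w n) =
           \sum_(1 <= n < X.+1) (RtoC (beyond U von_mangoldt n) * w n))%C.
  apply: eq_bigr => n _; rewrite /beyond; case: ifP => // nU.
  by rewrite wP; [rewrite !Cmult_0_r | lia].
rewrite (vaughan_identity X U U w wX).
pose I b := sqrt g + INR P / (b * sqrt g).
have i1 l c : (0 < l <= P)%N -> Cmod (\sum_(1 <= k < c.+1) w (l * k)%N)%C <= 320 * I (INR l).
  by move=> hl; apply: (type1_inner _ _ _ _ _ _ _ _ _ _ _ ph YP t0 P2 hl).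
have I0 b : 0 < b -> 0 < I b.
  by move=> b0; have : 0 < INR P / (b * sqrt g); [apply: Rdiv_lt_0_compat; nra | rewrite /I; lra].
have H1 : Cmod (\sum_(1 <= b < X.+1) (RtoC (upto U mobius b) *
    \sum_(1 <= k < X.+1) (RtoC (ln (INR k)) * w (b * k)%N)))%C <=
    640 * L * (INR U * sqrt g + INR P * (1 + L) / sqrt g).
  rewrite sum_upto_coef; last by lia.
  apply: (Rle_trans _ (\sum_(1 <= b < U.+1) (640 * L * (sqrt g + INR P / sqrt g * / INR b)))).
    apply: Cmod_sum_le => b /andP[b0 bU]; have rb := INR_gt0 _ b0.
    rewrite Cmod_mult Cmod_R; have := Rabs_mobius b; have := Rabs_pos (mobius b).
    have : Cmod (\sum_(1 <= k < X.+1) (RtoC (ln (INR k)) * w (b * k)%N))%C <= (L + L) * (320 * I (INR b)).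
      apply: abel_bound; [lia | by have := I0 _ rb; lra | | |].
      - by rewrite -/L Cmod_R Rabs_pos_eq; lra.
      - apply: (Rle_trans _ (\sum_(1 <= n < X) (ln (INR n.+1) - ln (INR n)))).
          apply: Rsum_le_nat => n /andP[n0 nX]; rewrite -RtoC_minus Cmod_R Rabs_pos_eq; first lra.
          by have := ln_INR_le n n.+1 ltac:(lia); lra.
        rewrite (Rsum_telescope (fun n => ln (INR n))); last by lia.
        by rewrite (_ : INR 1 = 1) // ln_1 /L; lra.
      by move=> c hc; apply: i1; lia.
    have -> : 640 * L * (sqrt g + INR P / sqrt g * / INR b) = (L + L) * (320 * I (INR b)).
      by rewrite /I; field; lra.
    have := Cmod_ge_0 (\sum_(1 <= k < X.+1) (RtoC (ln (INR k)) * w (b * k)%N))%C.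
    nra.
  rewrite -Rsum_mull big_split /= Rsum_const subn1 /= -Rsum_mull.
  apply: Rmult_le_compat_l; first lra.
  apply: Rplus_le_compat_l.
  have -> : INR P * (1 + L) / sqrt g = INR P / sqrt g * (1 + L) by rewrite /Rdiv; ring.
  apply: Rmult_le_compat_l; first by apply/Rlt_le/Rdiv_lt_0_compat.
  apply: Rle_trans (harmonic_bound U U0) _.
  by have := ln_INR_le U X ltac:(lia); rewrite -/L; lra.
have H2 : Cmod (\sum_(1 <= b < X.+1) \sum_(1 <= c < X.+1)
      (RtoC (upto U mobius b) * RtoC (upto U von_mangoldt c) *
        \sum_(1 <= l < X.+1) w (b * c * l)%N))%C <=
    320 * L * (INR (U * U)%N * sqrt g + INR P * (1 + L) ^ 2 / sqrt g).
  have -> : (\sum_(1 <= b < X.+1) \sum_(1 <= c < X.+1)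
      (RtoC (upto U mobius b) * RtoC (upto U von_mangoldt c) *
        \sum_(1 <= l < X.+1) w (b * c * l)%N) = \sum_(1 <= b < U.+1) \sum_(1 <= c < U.+1)
      (RtoC (mobius b) * RtoC (von_mangoldt c) * \sum_(1 <= l < X.+1) w (b * c * l)%N))%C.
    transitivity (\sum_(1 <= b < X.+1) (RtoC (upto U mobius b) * \sum_(1 <= c < X.+1)
      (RtoC (upto U von_mangoldt c) * \sum_(1 <= l < X.+1) w (b * c * l)%N)))%C.
      by apply: eq_bigr => b _; rewrite Csum_mull; apply: eq_bigr => c _; ring.
    rewrite sum_upto_coef; last by lia.
    apply: eq_bigr => b _; rewrite sum_upto_coef; last by lia.
    by rewrite Csum_mull; apply: eq_bigr => c _; ring.
  apply: (Rle_trans _ (\sum_(1 <= b < U.+1) \sum_(1 <= c < U.+1)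
     (320 * L * (sqrt g + INR P / sqrt g * / INR b * / INR c)))).
    apply: Cmod_sum_le => b /andP[b0 bU]; apply: Cmod_sum_le => c /andP[c0 cU].
    have rb := INR_gt0 _ b0; have rc := INR_gt0 _ c0.
    rewrite !Cmod_mult !Cmod_R; have m1 := Rabs_mobius b; have m0 := Rabs_pos (mobius b).
    have [v0 v1] := von_mangoldt_bound c c0; rewrite (Rabs_pos_eq _ v0).
    have v2 : von_mangoldt c <= L by have := ln_INR_le c X ltac:(lia); rewrite -/L; lra.
    have hbc : (0 < b * c <= P)%N.
      by rewrite muln_gt0 b0 c0; apply: leq_trans UP; apply: leq_mul.
    have := i1 (b * c)%N X hbc.
    have -> : 320 * L * (sqrt g + INR P / sqrt g * / INR b * / INR c) = (1 * L) * (320 * I (INR (b * c)%N)).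
      by rewrite /I INR_muln; field; lra.
    move=> h; apply: Rmult_le_compat => //; [by apply: Rmult_le_pos | exact: Cmod_ge_0 |].
    by apply: Rmult_le_compat.
  under eq_bigr => b _ do rewrite -Rsum_mull big_split /= Rsum_const subn1 /= -Rsum_mull.
  rewrite -Rsum_mull big_split /= Rsum_const subn1 /=.
  apply: Rmult_le_compat_l; first lra.
  have hU : \sum_(1 <= i < U.+1) / INR i <= 1 + L.
    apply: Rle_trans (harmonic_bound U U0) _.
    by have := ln_INR_le U X ltac:(lia); rewrite -/L; lra.
  have hU0 : 0 <= \sum_(1 <= i < U.+1) / INR i.
    rewrite big_nat; apply: Rsum_ge0 => i /andP[i0 _]; exact/Rlt_le/Rinv_0_lt_compat/INR_gt0.
  rewrite INR_muln; apply: Rplus_le_compat; first lra.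
  have -> : \sum_(1 <= i < U.+1) (INR P / sqrt g * / INR i * \sum_(1 <= j < U.+1) / INR j) =
     INR P / sqrt g * ((\sum_(1 <= j < U.+1) / INR j) * \sum_(1 <= i < U.+1) / INR i).
    rewrite !Rsum_mull; apply: eq_bigr => i _; ring.
  have -> : INR P * (1 + L) ^ 2 / sqrt g = INR P / sqrt g * ((1 + L) * (1 + L)) by rewrite /Rdiv; ring.
  apply: Rmult_le_compat_l; first by apply/Rlt_le/Rdiv_lt_0_compat.
  by apply: Rmult_le_compat.
pose V := D * L * INR P * (72 * sqrt (type2_gain (G (INR P)) P J t (INR Q))) * (1 + L).
have bX k : (0 < k <= X)%N -> Rabs (mobius_tail U k) <= D.
  by move=> hk; apply: Rle_trans (mobius_tail_bound _ _) (HD k hk).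
have lX k : (0 < k <= X)%N -> Rabs (von_mangoldt k) <= L.
  move=> /andP[k0 kX]; have [v0 v1] := von_mangoldt_bound k k0; rewrite Rabs_pos_eq //.
  by apply: Rle_trans v1 _; apply: ln_INR_le; rewrite k0.
pose win (f : nat -> R) l := if (J <= l <= Q)%N then f l else 0.
have winZ f l : ~~ (J <= l <= Q)%N -> win f l = 0 by move=> /negbTE h; rewrite /win h.
pose lamU := beyond U von_mangoldt.
have lamUb k : (0 < k <= X)%N -> Rabs (lamU k) <= L.
  by move=> hk; rewrite /lamU /beyond; case: ifP => _; [rewrite Rabs_R0 | exact: lX].
have H3 : Cmod (\sum_(1 <= n < X.+1) \sum_(1 <= k < X.+1)
      (RtoC (lamU n) * RtoC (mobius_tail U k) * w (n * k)%N))%C <= 2 * V.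
  (* Since n k <= 2 P < (Q + 1)^2, one of n, k is at most Q and can play the part of l. The first
     sum takes n <= Q, the second n > Q and k <= Q. Both coefficients vanish up to U >= J, so
     restricting l to l >= J loses nothing. *)
  have -> : (\sum_(1 <= n < X.+1) \sum_(1 <= k < X.+1)
      (RtoC (lamU n) * RtoC (mobius_tail U k) * w (n * k)%N) =
     (\sum_(1 <= l < X.+1) \sum_(1 <= k < X.+1)
      (RtoC (mobius_tail U k) * RtoC (win lamU l) * w (k * l)%N)) +
     \sum_(1 <= l < X.+1) \sum_(1 <= k < X.+1)
      (RtoC (beyond Q lamU k) * RtoC (win (mobius_tail U) l) * w (k * l)%N))%C.
    rewrite [X in (_ + X)%C]exchange_big -big_split; apply: eq_big_nat => n /andP[n0 nX].
    rewrite -big_split; apply: eq_big_nat => k /andP[k0 kX] /=.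
    rewrite (mulnC k n) /win /beyond /lamU.
    case: (leqP n Q) => nQ.
      case: (leqP J n) => Jn /=; first by ring.
      by rewrite /beyond ifT; [ring | lia].
    rewrite andbF; case: (leqP k Q) => kQ.
      case: (leqP J k) => Jk /=; first by ring.
      by rewrite mobius_tail_small; [ring | lia].
    rewrite andbF wX; first by ring.
    by apply: leq_trans QP _; apply: leq_mul.
  have winb f B : 0 <= B -> (forall k, (0 < k <= X)%N -> Rabs (f k) <= B) -> forall l, Rabs (win f l) <= B.
    move=> B0 hf l; rewrite /win; case: ifP => h; last by rewrite Rabs_R0.
    by apply: hf; lia.
  apply: Rle_trans (Cmod_triangle _ _) _.
  have p1 := type2_sum _ _ _ _ _ _ _ _ _ _ _ _ _ _ xi ph YP t0 P2 J0 Q2 D0 L0 bX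
    (winb lamU L L0 lamUb) (winZ lamU).
  have bb k : (0 < k <= X)%N -> Rabs (beyond Q lamU k) <= L.
    by move=> hk; rewrite /beyond; case: ifP => _; [rewrite Rabs_R0 | exact: lamUb].
  have p2 := type2_sum _ _ _ _ _ _ _ _ _ _ _ _ _ _ xi ph YP t0 P2 J0 Q2 L0 D0 bb
    (winb (mobius_tail U) D D0 bX) (winZ (mobius_tail U)).
  have -> : 2 * V = V + V by ring.
  apply: Rplus_le_compat; first exact: p1.
  by apply: Rle_trans p2 _; rewrite /V -/X -/L; right; ring.
have T1 := Cmod_triangle.
apply: Rle_trans (Cmod_triangle _ _) _.
apply: Rplus_le_compat; last exact: H3.
apply: Rle_trans (Cmod_triangle _ _) _; rewrite Cmod_opp.
apply: (Rle_trans _ _ _ (Rplus_le_compat _ _ _ _ H1 H2)).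
have UU : INR U <= INR (U * U)%N by apply: INR_leq; rewrite leq_pmull.
have Pg : 0 < INR P / sqrt g by apply: Rdiv_lt_0_compat.
have U1 : 0 < INR (U * U)%N * sqrt g by apply: Rmult_lt_0_compat => //; apply: INR_gt0; lia.
have -> : 960 * L * (1 + L) ^ 2 * (INR (U * U)%N * sqrt g + INR P / sqrt g) =
  640 * L * (INR (U * U)%N * sqrt g * (1 + L) ^ 2 + INR P / sqrt g * (1 + L) ^ 2) +
  320 * L * (INR (U * U)%N * sqrt g * (1 + L) ^ 2 + INR P / sqrt g * (1 + L) ^ 2) by ring.
have L1 : 1 <= (1 + L) ^ 2 by rewrite /pow; nra.
have L2 : 1 + L <= (1 + L) ^ 2 by rewrite /pow; nra.
apply: Rplus_le_compat; (apply: Rmult_le_compat_l; first lra); apply: Rplus_le_compat.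
- by apply: (Rle_trans _ (INR (U * U)%N * sqrt g * 1)); [rewrite Rmult_1_r; apply: Rmult_le_compat_r; lra | apply: Rmult_le_compat_l; lra].
- have -> : INR P * (1 + L) / sqrt g = INR P / sqrt g * (1 + L) by rewrite /Rdiv; ring.
  by apply: Rmult_le_compat_l; lra.
- by apply: (Rle_trans _ (INR (U * U)%N * sqrt g * 1)); [lra | apply: Rmult_le_compat_l; lra].
- by right; rewrite /Rdiv; ring.
Qed.

Lemma sqrt_Rpower p a : sqrt (Rpower p a) = Rpower p (a / 2).
Proof.
rewrite -Rpower_sqrt; last exact: Rpower_gt0.
by rewrite Rpower_mult.
Qed.

Lemma Rmax_le a b x : Rmax a b <= x -> a <= x /\ b <= x.
Proof. by have := Rmax_l a b; have := Rmax_r a b; lra. Qed.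

Lemma floor_nat_exists x : 0 <= x -> exists n : nat, INR n <= x < INR n + 1.
Proof.
move=> x0; have [k hk] := floor_exists x.
have k0 : (-1 < k)%Z by apply: lt_IZR; lra.
by exists (Z.to_nat k); rewrite INR_IZR_INZ Z2Nat.id; [lra|lia].
Qed.

Lemma ln_le_Rpower e x : 0 < e -> 0 < x -> ln x <= Rpower x e / e.
Proof.
move=> e0 x0; have := exp_ineq1_le (e * ln x); rewrite -/(Rpower x e) => h.
apply: (Rmult_le_reg_l e) => //; have -> : e * (Rpower x e / e) = Rpower x e by field; lra.
lra.
Qed.

Lemma Rpower_mult_le p a b c : 1 <= p -> a + b <= c -> Rpower p a * Rpower p b <= Rpower p c.
Proof. by move=> p1 h; rewrite -Rpower_plus; apply: Rle_Rpower. Qed.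

(** Each logarithm and the divisor bound cost a power P^(e/4), and at most three such factors occur
    together. *)
Lemma log_divisor_loss e : 0 < e -> exists A, 1 <= A /\ forall P : nat, (0 < P)%N ->
  let L := ln (INR (2 * P)%N) in
  L * (1 + L) ^ 2 <= A * Rpower (INR P) e /\
  exists D, (forall k, (0 < k <= 2 * P)%N -> INR (size (divisors k)) <= D) /\ 0 <= D /\
    D * L * (1 + L) <= A * Rpower (INR P) e.
Proof.
move=> e0; have e4 : 0 < e / 4 by lra.
have [A [A1 HA]] := divisor_bound (e / 4) e4.
pose c := Rpower 2 (e / 4) / (e / 4).
have r2 := Rpower_gt0 2 (e / 4).
have c0 : 0 < c by apply: Rdiv_lt_0_compat.
pose B := A * Rpower 2 (e / 4) * ((1 + c) * (1 + c) * (1 + c)).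
have r21 : 1 <= Rpower 2 (e / 4) by apply: Rpower_ge1; lra.
have ccc : 1 <= (1 + c) * (1 + c) * (1 + c) by nra.
have AR : 1 <= A * Rpower 2 (e / 4) by nra.
exists B; split; first by rewrite /B; nra.
move=> P P0 L; have p1 := INR_ge1 _ P0; set p := INR P in p1 *.
set x := Rpower p (e / 4).
have x1 : 1 <= x by apply: Rpower_ge1; lra.
have px : Rpower p e = x * (x * (x * x)).
  by rewrite /x -!Rpower_plus; congr Rpower; field.
have E2 : Rpower (INR (2 * P)%N) (e / 4) = Rpower 2 (e / 4) * x.
  by rewrite Rpower_INR_mul.
have Lc : L <= c * x.
  apply: Rle_trans (ln_le_Rpower (e / 4) _ e4 _) _; first by apply: INR_gt0; lia.
  by rewrite E2 /c; right; field; lra.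
have L0 : 0 <= L by apply: ln_ge0; apply: INR_ge1; lia.
have L1 : 1 + L <= (1 + c) * x by nra.
have L1' : L <= (1 + c) * x by lra.
have LL : (1 + L) * (1 + L) <= (1 + c) * x * ((1 + c) * x) by apply: Rmult_le_compat; lra.
have cx : 1 <= (1 + c) * x by nra.
have xx : 1 <= x * x by nra.
have xxx : 1 <= x * (x * x) by nra.
split.
  have -> : L * (1 + L) ^ 2 = L * ((1 + L) * (1 + L)) by ring.
  apply: (Rle_trans _ ((1 + c) * x * ((1 + c) * x * ((1 + c) * x)))).
    by apply: Rmult_le_compat; nra.
  have -> : (1 + c) * x * ((1 + c) * x * ((1 + c) * x)) = (1 + c) * (1 + c) * (1 + c) * (x * (x * x)) by ring.
  rewrite px /B; apply: Rmult_le_compat; try nra.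
exists (A * (Rpower 2 (e / 4) * x)); split.
  move=> k hk; apply: Rle_trans (HA k _) _; first by lia.
  apply: Rmult_le_compat_l; first lra.
  rewrite -E2; apply: Rle_Rpower_l; first lra.
  by split; [apply: INR_gt0; lia | apply: INR_leq; lia].
split; first by apply: Rmult_le_pos; nra.
apply: (Rle_trans _ (A * (Rpower 2 (e / 4) * x) * ((1 + c) * x * ((1 + c) * x)))).
  rewrite Rmult_assoc; apply: Rmult_le_compat_l; first by apply: Rmult_le_pos; nra.
  by apply: Rmult_le_compat; lra.
rewrite px /B.
have -> : A * (Rpower 2 (e / 4) * x) * ((1 + c) * x * ((1 + c) * x)) =
   (A * Rpower 2 (e / 4) * ((1 + c) * (1 + c))) * (x * (x * x)) by ring.
apply: Rmult_le_compat; [by apply: Rmult_le_pos; nra|nra| |nra].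
by apply: Rmult_le_compat_l; nra.
Qed.

Definition growth (G : R -> R) : Prop :=
  exists Y, forall y, Y <= y -> Rpower y (9 / 10) <= G y <= 2 * y.

(** Put p = INR P, so t G p is at most 4 p^(1 + mu). The linear sums cost U^2 sqrt (t G p), of order
    p^(2/5 + 1/2 + mu/2). In the bilinear sums 1 / J and sqrt (t J G Q) / p are of order p^(-1/6)
    and p^(-1/6 + mu/2), so J balances them at mu = 0. The square root of the gain saves p^(1/12 -
    mu/4). *)
Lemma lambda_sum_bound Y F F1 G G1 mu e : phase Y F F1 G G1 -> growth G ->
  0 <= mu <= 1 / 6 -> 0 < e ->
  exists A Y', 0 < A /\ forall (P P' : nat) t xi, Y' <= INR P -> (P' <= 2 * P)%N ->
    1 <= t <= 2 * Rpower (INR P) mu ->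
    Cmod (\sum_(1 <= n < (2 * P).+1) (RtoC (von_mangoldt n) * wave P P' F t xi n))%C <=
    A * (Rpower (INR P) (9 / 10 + mu / 2 + e) + Rpower (INR P) (11 / 12 + mu / 4 + e)).
Proof.
move=> ph [Yg grow] mu0 e0.
have [A [A1 HA]] := log_divisor_loss e e0.
exists (2880 * A + 432 * A), (Rmax 8 (Rmax Y Yg)); split; first lra.
move=> P P' t xi YP P2 t1.
have [h8 /Rmax_le [hY hG]] := Rmax_le _ _ _ YP.
have [gl gu] := grow _ hG.
have P8 : (8 <= P)%N by apply/leP/INR_le; rewrite (_ : INR 8 = 8) //; rewrite /INR; lra.
set p := INR P in h8 hY hG gl gu t1 YP *.
have p1 : 1 <= p by lra.
(* Vaughan's cut-offs are [p^(1/5)] and the type II blocks have length [p^(1/6)]. *)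
have [|U [U1 U2]] := floor_nat_exists (Rpower p (1 / 5)); first exact/Rlt_le/Rpower_gt0.
have [|J [J1 J2]] := floor_nat_exists (Rpower p (1 / 6)); first exact/Rlt_le/Rpower_gt0.
have [|Q [Q1 Q2]] := floor_nat_exists (sqrt (2 * p)); first exact: sqrt_pos.
have r6 : 1 <= Rpower p (1 / 6) by apply: Rpower_ge1; lra.
have r56 : Rpower p (1 / 6) <= Rpower p (1 / 5) by apply: Rle_Rpower; lra.
have J0 : (0 < J)%N by case: J J1 J2 => // _; rewrite (_ : INR 0 = 0) //; lra.
have JU : (J <= U)%N.
  rewrite -ltnS; apply/leP/INR_lt; rewrite S_INR; lra.
have UU : INR (U * U)%N <= Rpower p (2 / 5).
  rewrite INR_muln; apply: (Rle_trans _ (Rpower p (1 / 5) * Rpower p (1 / 5))).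
    by apply: Rmult_le_compat; try exact: pos_INR.
  by apply: Rpower_mult_le; lra.
have UP : (U * U <= P)%N.
  apply/leP/INR_le; apply: Rle_trans UU _; rewrite -/p -{2}(Rpower_1 p); last lra.
  by apply: Rle_Rpower; lra.
have s2p : sqrt (2 * p) * sqrt (2 * p) = 2 * p by apply: sqrt_sqrt; lra.
have QP : (2 * P < Q.+1 * Q.+1)%N.
  apply/leP/INR_lt; rewrite !INR_muln (S_INR Q) (_ : INR 2 = 2) // -/p.
  by have := pos_INR Q; have := sqrt_pos (2 * p); nra.
have Q2P : (2 * Q <= P)%N.
  apply/leP/INR_le; rewrite INR_muln (_ : INR 2 = 2) // -/p.
  have s4 : 4 <= sqrt (2 * p).
    have -> : 4 = sqrt (4 * 4) by rewrite sqrt_square; lra.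
    by apply: sqrt_le_1_alt; lra.
  nra.
have [H1 [D [HD [D0 H2]]]] := HA P ltac:(lia).
have t0 : 0 < t by lra.
have := lambda_exp_sum _ _ _ _ _ _ _ _ _ _ D t xi ph hY t0 P2 J0 JU UP QP Q2P HD.
rewrite -/p; move: H1 H2; rewrite -/p; set L := ln _ => H1 H2 /=; set S := Cmod _ => HS.
have g9 : 0 < Rpower p (9 / 10) by exact: Rpower_gt0.
have tg1 : Rpower p (9 / 10) <= t * G p by nra.
have tg2 : t * G p <= 4 * Rpower p (1 + mu).
  rewrite Rpower_plus Rpower_1; last lra.
  apply: (Rle_trans _ (2 * Rpower p mu * (2 * p))); last by right; ring.
  by apply: Rmult_le_compat; lra.
have s4 : sqrt 4 = 2 by rewrite (_ : 4 = 2 * 2); [rewrite sqrt_square; lra | ring].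
have sg1 : Rpower p (9 / 20) <= sqrt (t * G p).
  rewrite (_ : 9 / 20 = 9 / 10 / 2); last by field.
  by rewrite -sqrt_Rpower; apply: sqrt_le_1_alt.
have sg2 : sqrt (t * G p) <= 2 * Rpower p (1 / 2 + mu / 2).
  rewrite (_ : 1 / 2 + mu / 2 = (1 + mu) / 2); last by field.
  by rewrite -sqrt_Rpower -{1}s4 -sqrt_mult_alt; [apply: sqrt_le_1_alt | lra].
have sg0 : 0 < sqrt (t * G p) by have := Rpower_gt0 p (9 / 20); lra.
have inv a : / Rpower p a = Rpower p (- a) by rewrite Rpower_Ropp.
have T1 : INR (U * U)%N * sqrt (t * G p) + p / sqrt (t * G p) <= 3 * Rpower p (9 / 10 + mu / 2).
  have h1 : INR (U * U)%N * sqrt (t * G p) <= 2 * Rpower p (9 / 10 + mu / 2).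
    apply: (Rle_trans _ (Rpower p (2 / 5) * (2 * Rpower p (1 / 2 + mu / 2)))).
      by apply: Rmult_le_compat => //; [exact: pos_INR | exact: sqrt_pos].
    have := Rpower_mult_le p (2 / 5) (1 / 2 + mu / 2) (9 / 10 + mu / 2) p1; lra.
  have h2 : p / sqrt (t * G p) <= Rpower p (9 / 10 + mu / 2).
    apply: (Rle_trans _ (p * / Rpower p (9 / 20))).
      apply: Rmult_le_compat_l; first lra; apply: Rinv_le_contravar => //; exact: Rpower_gt0.
    by rewrite inv -{1}(Rpower_1 p); [apply: Rpower_mult_le; lra | lra].
  lra.
have gain : type2_gain (G p) P J t (INR Q) <= 9 * Rpower p (- (1 / 6) + mu / 2).
  rewrite /type2_gain -/p.
  have Jr : Rpower p (1 / 6) / 2 <= INR J.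
    have : 1 <= INR J by exact: INR_ge1.
    lra.
  have h1 : / INR J <= 2 * Rpower p (- (1 / 6) + mu / 2).
    apply: (Rle_trans _ (/ (Rpower p (1 / 6) / 2))).
      by apply: Rinv_le_contravar => //; have := Rpower_gt0 p (1 / 6); lra.
    rewrite (_ : / (Rpower p (1 / 6) / 2) = 2 * / Rpower p (1 / 6)).
      rewrite inv; apply: Rmult_le_compat_l; first lra.
      by apply: Rle_Rpower; lra.
    by field; have := Rpower_gt0 p (1 / 6); lra.
  have Qr : sqrt (INR Q) <= 2 * Rpower p (1 / 4).
    apply: (Rle_trans _ (sqrt (4 * Rpower p (1 / 2)))).
      apply: sqrt_le_1_alt; apply: (Rle_trans _ (sqrt (4 * p))).
        by apply: Rle_trans Q1 _; apply: sqrt_le_1_alt; lra.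
      rewrite sqrt_mult_alt ?s4; last lra.
      rewrite (_ : Rpower p (1 / 2) = sqrt p); first by have := sqrt_pos p; lra.
      by rewrite -Rpower_sqrt; [congr Rpower; lra | lra].
    rewrite sqrt_mult_alt ?s4 ?sqrt_Rpower; last lra.
    by rewrite (_ : 1 / 2 / 2 = 1 / 4); lra.
  have h2 : sqrt (t * INR J * G p) * sqrt (INR Q) / p <= 4 * Rpower p (- (1 / 6) + mu / 2).
    have hs : sqrt (t * INR J * G p) <= 2 * Rpower p (7 / 12 + mu / 2).
      apply: (Rle_trans _ (sqrt (4 * Rpower p (7 / 6 + mu)))).
        apply: sqrt_le_1_alt.
        apply: (Rle_trans _ (4 * Rpower p (1 + mu) * Rpower p (1 / 6))).
          have -> : t * INR J * G p = t * G p * INR J by ring.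
          by apply: Rmult_le_compat => //; [nra | exact: pos_INR].
        have := Rpower_mult_le p (1 + mu) (1 / 6) (7 / 6 + mu) p1; lra.
      rewrite sqrt_mult_alt ?s4 ?sqrt_Rpower; last lra.
      by rewrite (_ : (7 / 6 + mu) / 2 = 7 / 12 + mu / 2); lra.
    apply: (Rle_trans _ (2 * Rpower p (7 / 12 + mu / 2) * (2 * Rpower p (1 / 4)) * Rpower p (- 1))).
      rewrite Rpower_Ropp Rpower_1; last lra.
      apply: Rmult_le_compat_r; first by apply/Rlt_le/Rinv_0_lt_compat; lra.
      by apply: Rmult_le_compat => //; exact: sqrt_pos.
    right; have -> : - (1 / 6) + mu / 2 = (7 / 12 + mu / 2) + 1 / 4 + - 1 by field.
    by rewrite !Rpower_plus; ring.
  have h3 : sqrt (INR Q) / sqrt (t * G p) <= 2 * Rpower p (- (1 / 6) + mu / 2).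
    apply: (Rle_trans _ (2 * Rpower p (1 / 4) * / Rpower p (9 / 20))).
      apply: Rmult_le_compat => //; [exact: sqrt_pos | by apply/Rlt_le/Rinv_0_lt_compat |].
      by apply: Rinv_le_contravar => //; exact: Rpower_gt0.
    rewrite inv; have := Rpower_mult_le p (1 / 4) (- (9 / 20)) (- (1 / 6) + mu / 2) p1; lra.
  have := Rpower_gt0 p (- (1 / 6) + mu / 2); lra.
have T2 : sqrt (type2_gain (G p) P J t (INR Q)) <= 3 * Rpower p (- (1 / 12) + mu / 4).
  apply: Rle_trans (sqrt_le_1_alt _ _ gain) _.
  rewrite sqrt_mult_alt; last lra.
  rewrite sqrt_Rpower (_ : sqrt 9 = 3); last by rewrite (_ : 9 = 3 * 3); [rewrite sqrt_square; lra | ring].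
  by rewrite (_ : (- (1 / 6) + mu / 2) / 2 = - (1 / 12) + mu / 4); [lra | field].
have Pe := Rpower_gt0 p e.
have L0 : 0 <= L by apply: ln_ge0; apply: INR_ge1; lia.
have X1 : 960 * L * (1 + L) ^ 2 * (INR (U * U)%N * sqrt (t * G p) + p / sqrt (t * G p)) <=
    2880 * A * Rpower p (9 / 10 + mu / 2 + e).
  apply: (Rle_trans _ (960 * (A * Rpower p e) * (3 * Rpower p (9 / 10 + mu / 2)))).
    apply: Rmult_le_compat => //; last lra.
      by have : 0 <= L * (1 + L) ^ 2; [apply: Rmult_le_pos => //; exact: pow2_ge_0 | lra].
    apply: Rplus_le_le_0_compat; first by apply: Rmult_le_pos; [exact: pos_INR | lra].
    by apply/Rlt_le/Rdiv_lt_0_compat; lra.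
  by right; rewrite (Rpower_plus _ e); ring.
have X2 : 2 * (D * L * p * (72 * sqrt (type2_gain (G p) P J t (INR Q))) * (1 + L)) <=
    432 * A * Rpower p (11 / 12 + mu / 4 + e).
  have -> : 2 * (D * L * p * (72 * sqrt (type2_gain (G p) P J t (INR Q))) * (1 + L)) =
     144 * (D * L * (1 + L)) * (p * sqrt (type2_gain (G p) P J t (INR Q))) by ring.
  apply: (Rle_trans _ (144 * (A * Rpower p e) * (p * (3 * Rpower p (- (1 / 12) + mu / 4))))).
    apply: Rmult_le_compat; [| | lra |].
    - by have : 0 <= D * L * (1 + L); [apply: Rmult_le_pos; nra | lra].
    - by apply: Rmult_le_pos; [lra | exact: sqrt_pos].
    - by apply: Rmult_le_compat_l; lra.
  right; have -> : 11 / 12 + mu / 4 + e = 1 + (- (1 / 12) + mu / 4) + e by field.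
  by rewrite !Rpower_plus Rpower_1; [ring | lra].
have := Rpower_gt0 p (9 / 10 + mu / 2 + e); have := Rpower_gt0 p (11 / 12 + mu / 4 + e).
move: HS X1 X2; rewrite /p => HS X1 X2 y1 y2.
apply: Rle_trans HS _; nra.
Qed.

(** * The sawtooth function *)

Definition saw x := frac_part x - 1 / 2.
(** A partial sum of the Fourier series of 1/2 - {x}, that is of - saw x; the truncation error is
    therefore [saw x + saw_series M x]. *)
Definition saw_series (M : nat) x := \sum_(1 <= m < M.+1) (sin (2 * PI * INR m * x) / (PI * INR m)).
(** Minus the truncation error on (0, 1). With x in place of its fractional part it is smooth on the
    whole line, including at 0. *)
Definition saw_rem (M : nat) x := 1 / 2 - x - saw_series M x.
Definition dirichlet (M : nat) x := 1 + \sum_(1 <= m < M.+1) (2 * cos (2 * PI * INR m * x)).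

Lemma saw_rem_derive M x : is_derive (saw_rem M) x (- dirichlet M x).
Proof.
elim: M => [|M IH].
  apply: (is_derive_ext (fun x => 1 / 2 - x)).
    by move=> t; rewrite /saw_rem /saw_series big_geq //; lra.
  by rewrite /dirichlet big_geq //; auto_derive => //; ring.
apply: (is_derive_ext (fun x => saw_rem M x - sin (2 * PI * INR M.+1 * x) / (PI * INR M.+1))).
  by move=> t; rewrite /saw_rem /saw_series [in RHS]big_nat_recr //=; ring.
have -> : - dirichlet M.+1 x = - dirichlet M x - 2 * cos (2 * PI * INR M.+1 * x).
  by rewrite /dirichlet big_nat_recr //=; ring.
apply: (is_derive_minus _ _ _ _ _ IH).
auto_derive => //; field; split; first by apply: not_0_INR.
exact: PI_neq0.
Qed.

Lemma dirichlet_kernel M x : dirichlet M x * sin (PI * x) = sin (INR (2 * M).+1 * (PI * x)).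
Proof.
elim: M => [|M IH].
  by rewrite /dirichlet big_geq // muln0 (_ : INR 1 = 1) // !Rmult_1_l Rplus_0_r Rmult_1_l.
have -> : dirichlet M.+1 x = dirichlet M x + 2 * cos (2 * PI * INR M.+1 * x).
  by rewrite /dirichlet big_nat_recr //=; ring.
have N k : INR (2 * k).+1 = 2 * INR k + 1 by rewrite S_INR INR_muln (_ : INR 2 = 2).
rewrite Rmult_plus_distr_r IH !N (S_INR M); set m := INR M.
have -> : (2 * m + 1) * (PI * x) = 2 * PI * (m + 1) * x - PI * x by ring.
have -> : (2 * (m + 1) + 1) * (PI * x) = 2 * PI * (m + 1) * x + PI * x by ring.
by rewrite sin_minus sin_plus; ring.
Qed.

Lemma dirichlet_bound M x : Rabs (dirichlet M x) <= INR (2 * M).+1.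
Proof.
rewrite /dirichlet; apply: Rle_trans (Rabs_triang _ _) _; rewrite Rabs_R1 S_INR INR_muln (_ : INR 2 = 2) // Rplus_comm.
apply: Rplus_le_compat_r; elim: M => [|M IH].
  by rewrite big_geq // Rabs_R0; have := pos_INR 0; lra.
rewrite big_nat_recr //=; apply: Rle_trans (Rabs_triang _ _) _.
have h := COS_bound (2 * PI * INR M.+1 * x).
have : Rabs (2 * cos (2 * PI * INR M.+1 * x)) <= 2 by apply: Rabs_le; lra.
have := S_INR M.
lra.
Qed.

Lemma saw_series_half M : saw_series M (1 / 2) = 0.
Proof.
rewrite /saw_series big1 // => m _.
rewrite (_ : 2 * PI * INR m * (1 / 2) = INR m * PI); last by field.
have -> : sin (INR m * PI) = 0 by apply: sin_eq_0_1; exists (Z.of_nat m); rewrite -INR_IZR_INZ.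
by rewrite /Rdiv Rmult_0_l.
Qed.

(* Integrating [- D_M = - sin ((2M+1) pi x) / sin (pi x)] by parts from [x] to [1/2]. *)
Lemma saw_rem_decay M x : 0 < x <= 1 / 2 -> Rabs (saw_rem M x) <= / (INR (2 * M).+1 * x).
Proof.
move=> hx; set N := INR (2 * M).+1; have pp := PI_RGT_0.
have N0 : 0 < N by exact: INR_gt0.
have sp y : 0 < y <= 1 / 2 -> 0 < sin (PI * y) by move=> hy; apply: sin_gt_0; nra.
have np y : 0 < y <= 1 / 2 -> 0 < N * PI * sin (PI * y).
  by move=> hy; apply: Rmult_lt_0_compat; [nra | exact: sp].
(* T is [saw_rem] less the boundary term of the integration by parts. Since |T'| <= V', both V - T
   and V + T increase, so T is bounded through its value 0 at 1/2 without integrating anything. *)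
pose T y := saw_rem M y - cos (N * (PI * y)) / (N * PI * sin (PI * y)).
pose T' y := cos (N * (PI * y)) * cos (PI * y) / (N * sin (PI * y) ^ 2).
pose V y := - / (N * PI * sin (PI * y)).
pose V' y := cos (PI * y) / (N * sin (PI * y) ^ 2).
have dT y : 0 < y <= 1 / 2 -> is_derive T y (T' y).
  move=> hy; have s0 := sp y hy.
  have -> : T' y = - dirichlet M y -
      (- (N * PI) * sin (N * (PI * y)) * (N * PI * sin (PI * y)) -
       cos (N * (PI * y)) * (N * PI * (PI * cos (PI * y)))) / (N * PI * sin (PI * y)) ^ 2.
    rewrite /T' -dirichlet_kernel -/N; field; repeat split; lra.
  apply: is_derive_minus; first exact: saw_rem_derive.
  have npi := np y hy; auto_derive; first lra.
  by field; repeat split; lra.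
have dV y : 0 < y <= 1 / 2 -> is_derive V y (V' y).
  move=> hy; have s0 := sp y hy.
  have npi := np y hy; rewrite /V /V'; auto_derive; first lra.
  by field; repeat split; lra.
have bT y : 0 < y <= 1 / 2 -> Rabs (T' y) <= V' y.
  move=> hy; have s0 := sp y hy.
  have c0 : 0 <= cos (PI * y) by apply: cos_ge_0; nra.
  have v0 : 0 <= V' y by apply: Rdiv_le_0_compat => //; apply: Rmult_lt_0_compat => //; exact: pow_lt.
  have -> : T' y = cos (N * (PI * y)) * V' y by rewrite /T' /V' /Rdiv; ring.
  rewrite Rabs_mult (Rabs_pos_eq (V' y)) //.
  have : Rabs (cos (N * (PI * y))) <= 1 by apply: Rabs_le; exact: COS_bound.
  nra.
have [||c1 h1 E1] := mvt (fun y => V y - T y) (fun y => V' y - T' y) x (1 / 2).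
- lra.
- by move=> y hy; apply: is_derive_minus; [apply: dV | apply: dT]; lra.
have [||c2 h2 E2] := mvt (fun y => V y + T y) (fun y => V' y + T' y) x (1 / 2).
- lra.
- by move=> y hy; apply: is_derive_plus; [apply: dV | apply: dT]; lra.
have b1 := bT c1 ltac:(lra); have b2 := bT c2 ltac:(lra).
have {}E1 : 0 <= V (1 / 2) - T (1 / 2) - (V x - T x).
  rewrite E1; apply: Rmult_le_pos; [have := Rle_abs (T' c1); lra | lra].
have {}E2 : 0 <= V (1 / 2) + T (1 / 2) - (V x + T x).
  rewrite E2; apply: Rmult_le_pos; [have := Rle_abs (- T' c2); rewrite Rabs_Ropp; lra | lra].
have Th : T (1 / 2) = 0.
  rewrite /T /saw_rem saw_series_half.
  rewrite (_ : N * (PI * (1 / 2)) = PI / 2 + INR M * PI); last first.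
    by rewrite /N S_INR INR_muln (_ : INR 2 = 2) //; field.
  have -> : cos (PI / 2 + INR M * PI) = 0.
    by apply: cos_eq_0_1; exists (Z.of_nat M); rewrite -INR_IZR_INZ; ring.
  by rewrite /Rdiv; ring.
have s0 := sp x hx.
have Vh : V (1 / 2) <= 0.
  have sh := sp (1 / 2) ltac:(lra).
  have : 0 < / (N * PI * sin (PI * (1 / 2))) by apply/Rinv_0_lt_compat/Rmult_lt_0_compat => //; nra.
  rewrite /V; lra.
have Tx : Rabs (T x) <= / (N * PI * sin (PI * x)).
  by apply: Rabs_le; rewrite /V in E1 E2 Vh *; lra.
have cx : Rabs (cos (N * (PI * x)) / (N * PI * sin (PI * x))) <= / (N * PI * sin (PI * x)).
  have i0 : 0 < / (N * PI * sin (PI * x)) by apply/Rinv_0_lt_compat/Rmult_lt_0_compat => //; nra.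
  rewrite /Rdiv Rabs_mult (Rabs_pos_eq (/ _)); last lra.
  have : Rabs (cos (N * (PI * x))) <= 1 by apply: Rabs_le; exact: COS_bound.
  nra.
have tri : Rabs (saw_rem M x) <= 2 * / (N * PI * sin (PI * x)).
  have -> : saw_rem M x = T x + cos (N * (PI * x)) / (N * PI * sin (PI * x)) by rewrite /T; ring.
  by apply: Rle_trans (Rabs_triang _ _) _; lra.
apply: Rle_trans tri _.
have sx : x <= sin (PI * x) by apply: sin_pi_ge; lra.
have p2 : 2 <= PI by have := PI2_1; lra.
have -> : / (N * x) = 2 * / (N * 2 * x) by field; lra.
apply: Rmult_le_compat_l; first lra; apply: Rinv_le_contravar.
  by apply: Rmult_lt_0_compat; lra.
apply: Rmult_le_compat; try lra; nra.
Qed.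

(** For x beyond 1 / (2 M + 1) the decay estimate gives at most 1. Closer to 0 the function moves by
    at most 1 from its value 1/2 at 0, its derivative being at most 2 M + 1. *)
Lemma saw_rem_bounded M x : 0 < x <= 1 / 2 -> Rabs (saw_rem M x) <= 3 / 2.
Proof.
move=> hx; set N := INR (2 * M).+1; have N0 : 0 < N by exact: INR_gt0.
case: (Rle_lt_dec (N * x) 1) => h; last first.
  apply: Rle_trans (saw_rem_decay M x hx) _.
  apply: (Rle_trans _ 1); last lra.
  by rewrite -/N -Rinv_1; apply: Rinv_le_contravar; lra.
have [||c hc E] := mvt (saw_rem M) (fun y => - dirichlet M y) 0 x; first lra.
  by move=> y _; exact: saw_rem_derive.
have z : saw_rem M 0 = 1 / 2.
  rewrite /saw_rem /saw_series big1 ?Rminus_0_r // => m _.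
  by rewrite Rmult_0_r sin_0 /Rdiv Rmult_0_l.
have -> : saw_rem M x = 1 / 2 + (- dirichlet M c * (x - 0)) by lra.
apply: Rle_trans (Rabs_triang _ _) _.
rewrite (Rabs_pos_eq (1 / 2)) ?Rabs_mult ?Rabs_Ropp; last lra.
rewrite (Rabs_pos_eq (x - 0)); last lra.
have := dirichlet_bound M c; rewrite -/N => hb.
have : Rabs (dirichlet M c) * (x - 0) <= N * (x - 0) by apply: Rmult_le_compat_r; lra.
lra.
Qed.

(** The Fejer kernel, scaled to take the value 1 at the integers. *)
Definition fejer (H : nat) x := Cmod (\sum_(0 <= h < H) e2pi (INR h * x))%C ^ 2 / INR H ^ 2.

Lemma fejer_ge0 H x : 0 <= fejer H x.
Proof.
case: H => [|H]; first by rewrite /fejer big_geq // Cmod_0 /pow /Rdiv !Rmult_0_l; lra.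
by apply: Rdiv_le_0_compat; [exact: pow2_ge_0 | apply: pow_lt; exact: INR_gt0].
Qed.

Lemma fejer_1 x : fejer 1 x = 1.
Proof.
by rewrite /fejer big_nat1 Cmod_e2pi (_ : INR 1 = 1) //; field.
Qed.

(** All angles 2 pi h x are at most pi / 3, so every cosine in the real part is at least 1/2. *)
Lemma fejer_lower H x : (0 < H)%N -> 0 <= x -> INR H * x <= 1 / 6 -> 1 / 4 <= fejer H x.
Proof.
move=> H0 x0 Hx; have h0 := INR_gt0 _ H0; have pp := PI_RGT_0.
have re : INR H / 2 <= Re (\sum_(0 <= h < H) e2pi (INR h * x))%C.
  have -> : Re (\sum_(0 <= h < H) e2pi (INR h * x))%C = \sum_(0 <= h < H) cos (2 * PI * (INR h * x)).
    by elim/big_ind2: _ => // [u1 u2 v1 v2 <- <- //].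
  apply: (Rle_trans _ (\sum_(0 <= h < H) (1 / 2))); first by rewrite Rsum_const subn0; lra.
  apply: Rsum_le_nat => h /andP[_ hH].
  have hh : 0 <= INR h * x <= 1 / 6.
    split; first by apply: Rmult_le_pos => //; exact: pos_INR.
    apply: Rle_trans Hx; apply: Rmult_le_compat_r => //; apply: INR_leq; lia.
  rewrite -cos_PI3; apply: cos_decr_1; nra.
have cm := re_le_Cmod (\sum_(0 <= h < H) e2pi (INR h * x))%C.
have cm2 := Rle_abs (Re (\sum_(0 <= h < H) e2pi (INR h * x))%C).
apply: (Rmult_le_reg_r (INR H ^ 2)); first exact: pow_lt.
rewrite (_ : fejer H x * INR H ^ 2 = Cmod (\sum_(0 <= h < H) e2pi (INR h * x))%C ^ 2).
  by rewrite (_ : 1 / 4 * INR H ^ 2 = (INR H / 2) ^ 2); [apply: pow_incr; lra | field].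
by rewrite /fejer; field; lra.
Qed.

(** The remainder is of order min (1, 1 / (M x)). The kernels with H <= 1 / (6 x) are at least 1/4,
    so the average of the first M kernels is at least of this order. The constant 24 = 4 * 6 leaves
    a factor 1/2 for rounding 1 / (6 x) down. *)
Lemma saw_rem_fejer M x : (0 < M)%N -> 0 < x <= 1 / 2 ->
  Rabs (saw_rem M x) <= 24 * (/ INR M * \sum_(1 <= H < M.+1) fejer H x).
Proof.
move=> M0 hx; have m0 := INR_gt0 _ M0.
have im : 0 < / INR M by exact: Rinv_0_lt_compat.
have low N : (0 < N <= M)%N -> INR N * x <= 1 / 6 -> INR N / 4 <= \sum_(1 <= H < M.+1) fejer H x.
  move=> /andP[N0 NM] hN; rewrite (@big_cat_nat _ _ _ N.+1) //=.
  have : 0 <= \sum_(N.+1 <= H < M.+1) fejer H x by apply: Rsum_ge0 => i _; exact: fejer_ge0.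
  have : \sum_(1 <= H < N.+1) (1 / 4) <= \sum_(1 <= H < N.+1) fejer H x.
    apply: Rsum_le_nat => H /andP[H0 HN]; apply: fejer_lower => //; first lra.
    by apply: Rle_trans hN; apply: Rmult_le_compat_r; [lra | apply: INR_leq; lia].
  rewrite Rsum_const subn1 /=; lra.
have dec := saw_rem_decay M x hx.
have dec2 : / (INR (2 * M).+1 * x) <= / INR M * (/ x / 2).
  have -> : / INR M * (/ x / 2) = / (2 * INR M * x) by field; lra.
  apply: Rinv_le_contravar; first by apply: Rmult_lt_0_compat; lra.
  by rewrite S_INR INR_muln (_ : INR 2 = 2) //; apply: Rmult_le_compat_r; lra.
case: (Rle_lt_dec (INR M * x) (1 / 6)) => h.
  apply: Rle_trans (saw_rem_bounded M x hx) _.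
  have := low M ltac:(lia) h => h2.
  have : / INR M * (INR M / 4) <= / INR M * \sum_(1 <= H < M.+1) fejer H x.
    by apply: Rmult_le_compat_l; lra.
  rewrite (_ : / INR M * (INR M / 4) = 1 / 4); [lra | field; lra].
apply: Rle_trans dec _; apply: Rle_trans dec2 _.
rewrite -Rmult_assoc (Rmult_comm 24) Rmult_assoc; apply: Rmult_le_compat_l; first lra.
case: (Rle_lt_dec x (1 / 6)) => hx6.
  have [|N [N1 N2]] := floor_nat_exists (1 / (6 * x)); first by apply: Rdiv_le_0_compat; lra.
  have q1 : 1 <= 1 / (6 * x).
    apply: (Rmult_le_reg_r (6 * x)); first lra.
    rewrite (_ : 1 / (6 * x) * (6 * x) = 1); [lra | field; lra].
  have N0 : (0 < N)%N by case: N N1 N2 => // _; rewrite (_ : INR 0 = 0) //; lra.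
  have n1 := INR_ge1 _ N0.
  have hN : INR N * x <= 1 / 6.
    rewrite (_ : 1 / 6 = 1 / (6 * x) * x); [apply: Rmult_le_compat_r; lra | field; lra].
  have NM : (N <= M)%N.
    apply/leP/INR_le; apply: (Rmult_le_reg_r x); lra.
  have := low N ltac:(lia) hN.
  have -> : / x / 2 = 3 * (1 / (6 * x)) by field; lra.
  lra.
(* For x > 1/6 the kernel with H = 1, which is constantly 1, suffices. *)
rewrite big_ltn // fejer_1.
have : 0 <= \sum_(2 <= H < M.+1) fejer H x by apply: Rsum_ge0 => i _; exact: fejer_ge0.
have : / x <= / (1 / 6) by apply: Rinv_le_contravar; lra.
rewrite (_ : / (1 / 6) = 6); last by field.
lra.
Qed.

Lemma e2pi_shift x k : e2pi (x + IZR k) = e2pi x.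
Proof. by rewrite e2piD e2pi_Z Cmult_1_r. Qed.

Lemma fejer_shift H x k : fejer H (x + IZR k) = fejer H x.
Proof.
rewrite /fejer; congr (Cmod _ ^ 2 / _); apply: eq_bigr => h _.
by rewrite Rmult_plus_distr_l {2}INR_IZR_INZ -mult_IZR e2pi_shift.
Qed.

Lemma fejer_opp H x : fejer H (- x) = fejer H x.
Proof.
rewrite /fejer -(Cmod_conj (\sum_(0 <= h < H) e2pi (INR h * x))%C) Csum_conj.
congr (Cmod _ ^ 2 / _); apply: eq_bigr => h _.
by rewrite Cconj_e2pi; congr e2pi; ring.
Qed.

Lemma saw_series_shift M x k : saw_series M (x + IZR k) = saw_series M x.
Proof.
apply: eq_bigr => m _; congr (_ / _).
have := e2pi_shift (INR m * x) (Z.of_nat m * k)%Z.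
rewrite mult_IZR -INR_IZR_INZ -Rmult_plus_distr_l => -[_].
by rewrite -!Rmult_assoc.
Qed.

Lemma saw_series_opp M x : saw_series M (- x) = - saw_series M x.
Proof.
rewrite -[RHS]Rmult_1_l -Ropp_mult_distr_r Ropp_mult_distr_l Rsum_mull.
apply: eq_bigr => m _.
by rewrite (_ : 2 * PI * INR m * - x = - (2 * PI * INR m * x)) ?sin_neg /Rdiv; ring.
Qed.

Lemma saw_error M x : (0 < M)%N ->
  Rabs (saw x + saw_series M x) <= 24 * (/ INR M * \sum_(1 <= H < M.+1) fejer H x).
Proof.
move=> M0; have m0 := INR_gt0 _ M0.
set k := Int_part x; pose y := frac_part x.
have xy : x = y + IZR k by rewrite /y /frac_part -/k; ring.
have [y1 y2] := base_fp x.
rewrite {2 3}xy saw_series_shift.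
under eq_bigr => H _ do rewrite fejer_shift.
rewrite /saw -/y in y1 y2 *.
(* At an integer [saw] is - 1/2 and the series is 0, while every kernel equals 1. *)
case: (Req_dec y 0) => [y0|yn].
  have -> : saw_series M y = 0.
    rewrite /saw_series big1 // => m _.
    by rewrite y0 Rmult_0_r sin_0 /Rdiv Rmult_0_l.
  have -> : \sum_(1 <= H < M.+1) fejer H y = \sum_(1 <= H < M.+1) 1.
    apply: eq_big_nat => H /andP[H0 _]; rewrite /fejer y0.
    under eq_bigr => h _ do rewrite Rmult_0_r e2pi_0.
    rewrite -RtoC_sum Rsum_const subn0 Rmult_1_r Cmod_R Rabs_pos_eq; last exact: pos_INR.
    by have := INR_gt0 _ H0 => ?; field; lra.
  rewrite y0 Rsum_const subn1 /= (_ : 0 - 1 / 2 + 0 = - (1 / 2)); last by ring.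
  rewrite Rabs_Ropp Rabs_pos_eq; last lra.
  rewrite Rmult_1_r Rinv_l; lra.
case: (Rle_lt_dec y (1 / 2)) => h.
  have := saw_rem_fejer M y M0 ltac:(lra).
  rewrite -Rabs_Ropp /saw_rem (_ : - (1 / 2 - y - saw_series M y) = y - 1 / 2 + saw_series M y) //.
  by ring.
have := saw_rem_fejer M (1 - y) M0 ltac:(lra).
have e1 : 1 - y = - y + IZR 1 by lra.
rewrite /saw_rem {2 3}e1 saw_series_shift saw_series_opp.
under eq_bigr => H _ do rewrite fejer_shift fejer_opp.
by rewrite (_ : 1 / 2 - (1 - y) - - saw_series M y = y - 1 / 2 + saw_series M y) //; lra.
Qed.

(** Expanding the square in [fejer H] leaves exponential sums with multiplier h - h': the H diagonal
    ones are trivial and at most H^2 others are bounded by E. Division by H^2 gives (b - a) / H + E,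
    and averaging over H <= M produces the logarithm. *)
Lemma saw_error_sum M (x : nat -> R) a b E : (0 < M)%N -> (a <= b)%N -> 0 <= E ->
  (forall j, (0 < j <= M)%N -> Cmod (\sum_(a <= n < b) e2pi (INR j * x n))%C <= E) ->
  \sum_(a <= n < b) Rabs (saw (x n) + saw_series M (x n)) <=
  24 * (INR (b - a) * ((1 + ln (INR M)) / INR M) + E).
Proof.
move=> M0 ab E0 HE; have m0 := INR_gt0 _ M0.
have im : 0 < / INR M by exact: Rinv_0_lt_compat.
apply: (Rle_trans _ (\sum_(a <= n < b) (24 * (/ INR M * \sum_(1 <= H < M.+1) fejer H (x n))))).
  by apply: Rsum_le_nat => n _; exact: saw_error.
rewrite -Rsum_mull -Rsum_mull exchange_big /=; apply: Rmult_le_compat_l; first lra.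
have -> : INR (b - a) * ((1 + ln (INR M)) / INR M) + E =
    / INR M * (INR (b - a) * (1 + ln (INR M)) + INR M * E) by field; lra.
apply: Rmult_le_compat_l; first lra.
apply: (Rle_trans _ (\sum_(1 <= H < M.+1) (INR (b - a) * / INR H + E))); last first.
  rewrite big_split /= -Rsum_mull Rsum_const subn1 /=.
  apply: Rplus_le_compat_r; apply: Rmult_le_compat_l; first exact: pos_INR.
  exact: harmonic_bound.
apply: Rsum_le_nat => H /andP[H0 HM]; have h0 := INR_gt0 _ H0.
have h2 : 0 < INR H ^ 2 by exact: pow_lt.
rewrite -big_distrl /=.
apply: (Rmult_le_reg_r (INR H ^ 2)) => //.
rewrite Rmult_assoc Rinv_l ?Rmult_1_r; last lra.
have -> : (INR (b - a) * / INR H + E) * INR H ^ 2 = INR H * (INR (b - a) + INR H * E) by field; lra.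
set Z := \sum_(a <= n < b) _.
have Z0 : 0 <= Z by apply: Rsum_ge0 => n _; exact: pow2_ge_0.
rewrite -(Rabs_pos_eq Z) // -Cmod_R /Z RtoC_sum.
under eq_bigr => n _ do rewrite Cmod2_sum.
rewrite exchange_big; apply: Rle_trans (Cmod_sum _ _ _ _) _.
apply: (Rle_trans _ (\sum_(0 <= h < H) (INR (b - a) + INR H * E))); last by rewrite Rsum_const subn0; lra.
apply: Rsum_le_nat => h hh; rewrite exchange_big; apply: Rle_trans (Cmod_sum _ _ _ _) _.
apply: (Rle_trans _ (\sum_(0 <= h' < H) ((if h' == h then INR (b - a) else 0) + E))); last first.
  rewrite big_split /= Rsum_const subn0; apply: Rplus_le_compat_r.
  rewrite (bigD1_seq h) /= ?iota_uniq ?mem_index_iota // eqxx big1 => [|l' /negbTE -> //].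
  by lra.
apply: Rsum_le_nat => h' hh'.
under eq_bigr => n _ do rewrite Cconj_e2pi e2piB.
case: (eqVneq h' h) => [->|ne].
  apply: (Rle_trans _ (INR (b - a))); last lra.
  exact: (sum_e2pi_trivial (fun n => INR h * x n - INR h * x n)).
rewrite Rplus_0_l; case: (ltnP h' h) => lt.
  have := HE (h - h')%N ltac:(lia).
  have e : INR h = INR (h - h') + INR h' by rewrite -INR_addn subnK // ltnW.
  rewrite (eq_bigr (fun n => e2pi (INR h * x n - INR h' * x n))) // => n _.
  by congr e2pi; rewrite e; ring.
have := HE (h' - h)%N ltac:(lia).
have e : INR h' = INR (h' - h) + INR h by rewrite -INR_addn subnK.
rewrite -Cmod_conj Csum_conj (eq_bigr (fun n => e2pi (INR h * x n - INR h' * x n))) // => n _.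
by rewrite Cconj_e2pi; congr e2pi; rewrite e; ring.
Qed.

(** * Sums over dyadic windows *)

Definition prime_log (n : nat) : R := if prime n then ln (INR n) else 0.

Lemma prime_log_bound n : (0 < n)%N -> 0 <= prime_log n <= ln (INR n).
Proof.
by move=> n0; have := ln_ge0 _ (INR_ge1 _ n0); rewrite /prime_log; case: ifP => _; lra.
Qed.

Lemma von_mangoldt_prime_log n : von_mangoldt n - prime_log n = if prime n then 0 else von_mangoldt n.
Proof. by rewrite /prime_log; case: ifP => h; [rewrite von_mangoldt_prime //|]; ring. Qed.

(** The sums with [von_mangoldt] and with [prime_log] differ by proper prime powers, which
    contribute about sqrt P times a logarithm. *)
Lemma prime_sum_bound Y F F1 G G1 mu e : phase Y F F1 G G1 -> growth G ->
  0 <= mu <= 1 / 6 -> 0 < e ->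
  exists A Y', 0 < A /\ forall (P c : nat) t xi, Y' <= INR P -> (P <= c <= 2 * P)%N ->
    1 <= t <= 2 * Rpower (INR P) mu ->
    Cmod (\sum_(P.+1 <= n < c.+1) (RtoC (prime_log n) * e2pi (xi * INR n + t * F (INR n))))%C <=
    A * (Rpower (INR P) (9 / 10 + mu / 2 + e) + Rpower (INR P) (11 / 12 + mu / 4 + e)).
Proof.
move=> ph gr hmu e0.
have [A [Y' [A0 HA]]] := lambda_sum_bound _ _ _ _ _ mu e ph gr hmu e0.
have [B [B1 HB]] := log_divisor_loss e e0.
exists (A + 6 * B), (Rmax 2 Y'); split; first lra.
move=> P c t xi YP /andP[Pc c2P] ht.
have [h2 hY'] := Rmax_le _ _ _ YP.
have := HA P c t xi hY' c2P ht.
set p := INR P in h2 hY' YP ht *; set X := (_ + _) => HX.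
have P0 : (0 < P)%N by apply/leP/INR_lt; rewrite (_ : INR 0 = 0) // -/p; lra.
have [H1 _] := HB P P0; move: H1; rewrite -/p; set L := ln _ => H1.
have L0 : 0 <= L by apply: ln_ge0; apply: INR_ge1; lia.
have LB : L <= B * Rpower p e.
  apply: Rle_trans H1; rewrite -{1}[L]Rmult_1_r; apply: Rmult_le_compat_l => //.
  by rewrite /pow; nra.
have [|M0 [M1 M2]] := floor_nat_exists (sqrt (2 * p)); first exact: sqrt_pos.
have s2p : sqrt (2 * p) * sqrt (2 * p) = 2 * p by apply: sqrt_sqrt; lra.
have MX : (0 < 2 * P < M0.+1 ^ 2)%N.
  apply/andP; split; first lia.
  apply/leP/INR_lt; rewrite INR_muln INR_expn (S_INR M0) (_ : INR 2 = 2) // -/p /pow.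
  by have := pos_INR M0; have := sqrt_pos (2 * p); nra.
have pp := sum_proper_prime_powers _ _ MX; rewrite -/L in pp.
have sp : Rpower p (1 / 2) = sqrt p by rewrite -Rpower_sqrt; [congr Rpower; lra | lra].
have Mr : INR M0.+1 <= 3 * Rpower p (1 / 2).
  rewrite sp S_INR; have s1 : 1 <= sqrt p by rewrite -{1}sqrt_1; apply: sqrt_le_1_alt; lra.
  have s2 : sqrt (2 * p) <= 2 * sqrt p.
    have -> : 2 * sqrt p = sqrt (2 * 2 * p) by rewrite (sqrt_mult_alt (2 * 2)) ?sqrt_square; lra.
    by apply: sqrt_le_1_alt; lra.
  lra.
set S := (\sum_(P.+1 <= n < c.+1) (RtoC (prime_log n) * e2pi (xi * INR n + t * F (INR n))))%C.
set S1 := (\sum_(1 <= n < (2 * P).+1) (RtoC (von_mangoldt n) * wave P c F t xi n))%C in HX.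
set S2 := (\sum_(P.+1 <= n < c.+1) (RtoC (von_mangoldt n - prime_log n) * e2pi (xi * INR n + t * F (INR n))))%C.
have SE : S = (S1 - S2)%C.
  have -> : S1 = (\sum_(P.+1 <= n < c.+1) (RtoC (von_mangoldt n) * e2pi (xi * INR n + t * F (INR n))))%C.
    apply: sum_window => // k hk; rewrite /wave ltnS; case: ifP => // _; exact: Cmult_0_r.
  rewrite /S2 Csum_sub; apply: eq_bigr => n _; rewrite RtoC_minus; ring.
have B2 : Cmod S2 <= 6 * B * Rpower p (9 / 10 + mu / 2 + e).
  apply: (Rle_trans _ (2 * L * INR M0.+1)).
    apply: Rle_trans pp; apply: Rle_trans (Cmod_sum _ _ _ _) _.
    rewrite [X in _ <= X]big_mkcond /=.
    rewrite (@big_cat_nat _ _ _ P.+1 1 (2 * P).+1) //=; last by lia.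
    rewrite (@big_cat_nat _ _ _ c.+1 P.+1 (2 * P).+1) //=.
    have T0 a b : 0 <= \sum_(a.+1 <= i < b) (if ~~ prime i then von_mangoldt i else 0).
      rewrite big_nat; apply: Rsum_ge0 => i hi; case: ifP => _; last lra.
      by have := von_mangoldt_bound i ltac:(lia); lra.
    have := T0 0%N P.+1; have := T0 c (2 * P).+1.
    suff : \sum_(P.+1 <= i < c.+1) Cmod (RtoC (von_mangoldt i - prime_log i) * e2pi (xi * INR i + t * F (INR i)))%C
       <= \sum_(P.+1 <= i < c.+1) (if ~~ prime i then von_mangoldt i else 0) by lra.
    apply: Rsum_le_nat => i hi; rewrite Cmod_mult Cmod_e2pi Rmult_1_r Cmod_R von_mangoldt_prime_log.
    have := von_mangoldt_bound i ltac:(lia).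
    by case: (prime i) => /= h; rewrite Rabs_pos_eq; lra.
  apply: (Rle_trans _ (2 * (B * Rpower p e) * (3 * Rpower p (1 / 2)))).
    by apply: Rmult_le_compat; [lra | exact: pos_INR | lra | lra].
  have := Rpower_mult_le p e (1 / 2) (9 / 10 + mu / 2 + e) ltac:(lra) ltac:(lra).
  nra.
rewrite SE; apply: Rle_trans (Cmod_triangle _ _) _; rewrite Cmod_opp.
have := Rpower_gt0 p (11 / 12 + mu / 4 + e); rewrite /X in HX * => q.
nra.
Qed.

Lemma frac_part_unique x (k : Z) r : x = IZR k + r -> 0 <= r < 1 -> frac_part x = r.
Proof.
move=> -> hr; rewrite /frac_part -(Int_part_spec (IZR k + r) k); lra.
Qed.

(** Subtracting s crosses an integer exactly when {x} < s; the fractional part then gains 1 - s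
    instead of losing s. *)
Lemma saw_indicator x s : 0 < s <= 1 / 2 ->
  saw (x - s) - saw x = (if Rlt_dec (frac_part x) s then 1 else 0) - s.
Proof.
move=> hs; rewrite /saw; have [f1 f2] := base_fp x.
have xE : x = IZR (Int_part x) + frac_part x by rewrite /frac_part; ring.
case: Rlt_dec => h.
  have -> : frac_part (x - s) = frac_part x - s + 1.
    by apply: (frac_part_unique _ (Int_part x - 1)); [rewrite minus_IZR|]; lra.
  by rewrite /=; lra.
have -> : frac_part (x - s) = frac_part x - s by apply: (frac_part_unique _ (Int_part x)); lra.
by rewrite /=; lra.
Qed.

(** In 2 i Im u = u - conj u the conjugation is moved from u to v. When u carries the phase m F and
    v the frequency xi, both sums keep the phase m F with m > 0, at the frequencies xi and - xi. *)
Lemma Cmod_sum_Im a b (u v : nat -> C) :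
  Cmod (\sum_(a <= n < b) (RtoC (Im (u n)) * v n))%C <=
  (Cmod (\sum_(a <= n < b) (u n * v n))%C + Cmod (\sum_(a <= n < b) (u n * Cconj (v n)))%C) / 2.
Proof.
have E : (RtoC 2 * Ci * \sum_(a <= n < b) (RtoC (Im (u n)) * v n) =
   (\sum_(a <= n < b) (u n * v n)) - Cconj (\sum_(a <= n < b) (u n * Cconj (v n))))%C.
  rewrite Csum_conj Csum_sub Csum_mull; apply: eq_bigr => n _.
  rewrite Cmult_conj Cconj_conj -(_ : ((u n - Cconj (u n)) * v n = u n * v n - Cconj (u n) * v n)%C); last by ring.
  by rewrite im_alt'; ring.
have := f_equal Cmod E; rewrite !Cmod_mult Cmod_Ci Cmod_R (Rabs_pos_eq 2); last lra.
move=> E2; have := Cmod_triangle (\sum_(a <= n < b) (u n * v n))%C (- Cconj (\sum_(a <= n < b) (u n * Cconj (v n))))%C.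
rewrite Cmod_opp Cmod_conj -/(Cminus _ _) -E2; lra.
Qed.

(* Subtracting [1] keeps the weight bounded by [O(m)] although [1 / s] is unbounded. *)
Definition weight (m s : R) : C := (RtoC (/ s) * (e2pi (- (m * s)) - RtoC 1))%C.

Lemma weight_bound m s : 0 <= m -> 0 < s -> Cmod (weight m s) <= 2 * PI * m.
Proof.
move=> m0 s0; rewrite /weight Cmod_mult Cmod_R Rabs_pos_eq; last exact/Rlt_le/Rinv_0_lt_compat.
have := e2pi_lip (- (m * s)) 0; rewrite e2pi_0 Rminus_0_r Rabs_Ropp Rabs_pos_eq; last nra.
move=> h; apply: (Rmult_le_reg_l s) => //.
rewrite -Rmult_assoc Rinv_r ?Rmult_1_l; lra.
Qed.

(** Over the common denominator s t, the difference splits into a change of the exponential and a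
    change of the factor 1 / s; each contributes at most 2 pi m |t - s| / t. *)
Lemma weight_variation m s t : 0 <= m -> 0 < s -> 0 < t ->
  Cmod (weight m t - weight m s)%C <= 4 * PI * m * (Rabs (t - s) / t).
Proof.
move=> m0 s0 t0; have pp := PI_RGT_0.
have si : RtoC s <> RtoC 0 by move=> [] ?; lra.
have ti : RtoC t <> RtoC 0 by move=> [] ?; lra.
have E : (RtoC (s * t) * (weight m t - weight m s) =
    RtoC s * (e2pi (- (m * t)) - e2pi (- (m * s))) + RtoC (s - t) * (e2pi (- (m * s)) - RtoC 1))%C.
  rewrite /weight RtoC_mult RtoC_minus !RtoC_inv; try lra.
  by field.
have h1 := e2pi_lip (- (m * t)) (- (m * s)).
have h2 := e2pi_lip (- (m * s)) 0; rewrite e2pi_0 Rminus_0_r Rabs_Ropp (Rabs_pos_eq (m * s)) in h2; last nra.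
have e1 : Rabs (- (m * t) - - (m * s)) = m * Rabs (t - s).
  rewrite (_ : - (m * t) - - (m * s) = - (m * (t - s))); last by ring.
  by rewrite Rabs_Ropp Rabs_mult (Rabs_pos_eq m).
rewrite e1 in h1.
have H : s * t * Cmod (weight m t - weight m s)%C <= s * (4 * PI * m * Rabs (t - s)).
  have -> : s * t * Cmod (weight m t - weight m s)%C = Cmod (RtoC (s * t) * (weight m t - weight m s))%C.
    by rewrite Cmod_mult Cmod_R Rabs_pos_eq //; nra.
  rewrite E; apply: Rle_trans (Cmod_triangle _ _) _; rewrite !Cmod_mult !Cmod_R.
  rewrite (Rabs_pos_eq s) ?(Rabs_minus_sym s t); last lra.
  have := Rabs_pos (t - s) => r0.
  have g1 : s * Cmod (e2pi (- (m * t)) - e2pi (- (m * s)))%C <= s * (2 * PI * (m * Rabs (t - s))).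
    by apply: Rmult_le_compat_l; lra.
  have g2 : Rabs (t - s) * Cmod (e2pi (- (m * s)) - RtoC 1)%C <= Rabs (t - s) * (2 * PI * (m * s)).
    exact: Rmult_le_compat_l.
  lra.
apply: (Rmult_le_reg_l (s * t)); first nra.
apply: Rle_trans H _; right; field; lra.
Qed.

(** What the sums need to know about psi: a relative variation O(1/n), for partial summation, and
    nearly the size n^(-d), where d will be 1 - 1/c2. *)
Definition slow_weight (d : R) (psi : R -> R) : Prop :=
  (forall n, (0 < n)%N -> 0 < psi (INR n) <= 1 / 2) /\
  (exists A Y, 0 < A /\ forall n, Y <= INR n -> (0 < n)%N ->
     Rabs (psi (INR n.+1) - psi (INR n)) <= A * psi (INR n.+1) / INR n) /\
  (forall e, 0 < e -> exists Y, forall n, Y <= INR n -> (0 < n)%N ->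
     / psi (INR n) <= Rpower (INR n) (d + e)).

Lemma sum_inv_window (P c : nat) : (0 < P)%N -> (P <= c <= 2 * P)%N ->
  \sum_(P.+1 <= n < c) / INR n <= 1.
Proof.
move=> P0 /andP[Pc cP]; have p0 := INR_gt0 _ P0.
apply: (Rle_trans _ (\sum_(P.+1 <= n < c) / INR P)).
  by apply: Rsum_le_nat => n hn; apply: Rinv_le_contravar => //; apply: INR_leq; lia.
rewrite Rsum_const; apply: (Rle_trans _ (INR P * / INR P)); last by rewrite Rinv_r; lra.
apply: Rmult_le_compat_r; first exact/Rlt_le/Rinv_0_lt_compat.
by apply: INR_leq; lia.
Qed.

Lemma Im_weight m s x :
  Im (weight m s * e2pi (m * x))%C = / s * (sin (2 * PI * m * (x - s)) - sin (2 * PI * m * x)).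
Proof.
have -> : (weight m s * e2pi (m * x) = RtoC (/ s) * (e2pi (m * (x - s)) - e2pi (m * x)))%C.
  rewrite (_ : m * (x - s) = - (m * s) + m * x); last by ring.
  by rewrite e2piD /weight; ring.
rewrite /e2pi /RtoC /Cmult /Cminus /Cplus /Copp /= (_ : 2 * PI * (m * (x - s)) = 2 * PI * m * (x - s)); last by ring.
by rewrite (_ : 2 * PI * (m * x) = 2 * PI * m * x); ring.
Qed.

Lemma saw_series_diff M x s :
  / s * (saw_series M (x - s) - saw_series M x) =
  \sum_(1 <= m < M.+1) (/ (PI * INR m) * Im (weight (INR m) s * e2pi (INR m * x))%C).
Proof.
rewrite (_ : saw_series M (x - s) - saw_series M x = saw_series M (x - s) + - 1 * saw_series M x); last by ring.
rewrite /saw_series Rsum_mull -big_split Rsum_mull; apply: eq_bigr => m _.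
by rewrite Im_weight /Rdiv /=; ring.
Qed.

Lemma weight_sum (psi F : R -> R) (P P' : nat) A X m xi : (0 < P)%N -> (P < P' <= 2 * P)%N ->
  0 <= m -> 0 <= A -> 0 <= X ->
  (forall n, (0 < n)%N -> 0 < psi (INR n)) ->
  (forall n, (P < n)%N -> Rabs (psi (INR n.+1) - psi (INR n)) <= A * psi (INR n.+1) / INR n) ->
  (forall c x, (P <= c <= 2 * P)%N ->
     Cmod (\sum_(P.+1 <= n < c.+1) (RtoC (prime_log n) * e2pi (x * INR n + m * F (INR n))))%C <= X) ->
  Cmod (\sum_(P.+1 <= n < P'.+1) (RtoC (Im (weight m (psi (INR n)) * e2pi (m * F (INR n)))%C)
     * (RtoC (prime_log n) * e2pi (xi * INR n))))%C <= (2 + 4 * A) * PI * m * X.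
Proof.
move=> P0 PP' m0 A0 X0 psi0 var HX; have pp := PI_RGT_0.
have half x : Cmod (\sum_(P.+1 <= n < P'.+1) (weight m (psi (INR n)) *
     (RtoC (prime_log n) * e2pi (x * INR n + m * F (INR n)))))%C <= (2 * PI * m + 4 * PI * m * A) * X.
  apply: abel_bound => //; [lia| | |].
  - by apply: weight_bound => //; apply: psi0; lia.
  - apply: (Rle_trans _ (\sum_(P.+1 <= n < P') (4 * PI * m * A * / INR n))).
      apply: Rsum_le_nat => n hn; have s1 := psi0 n.+1 ltac:(lia); have n0 : 0 < INR n by apply: INR_gt0; lia.
      apply: Rle_trans (weight_variation _ _ _ m0 (psi0 n ltac:(lia)) s1) _.
      rewrite (Rmult_assoc _ A); apply: Rmult_le_compat_l; first by apply: Rmult_le_pos; lra.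
      apply: (Rmult_le_reg_r (psi (INR n.+1))) => //.
      have := var n ltac:(lia) => v.
      rewrite (_ : A * / INR n * psi (INR n.+1) = A * psi (INR n.+1) / INR n); last by field; lra.
      by rewrite /Rdiv Rmult_assoc Rinv_l ?Rmult_1_r; lra.
    rewrite -Rsum_mull -[X in _ <= X]Rmult_1_r; apply: Rmult_le_compat_l.
      by apply: Rmult_le_pos => //; apply: Rmult_le_pos; lra.
    by apply: sum_inv_window => //; lia.
  - by move=> c hc; apply: HX; lia.
apply: Rle_trans (Cmod_sum_Im _ _ _ _) _.
set T1 := Cmod _; set T2 := Cmod _.
have -> : T1 = Cmod (\sum_(P.+1 <= n < P'.+1) (weight m (psi (INR n)) *
     (RtoC (prime_log n) * e2pi (xi * INR n + m * F (INR n)))))%C.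
  congr Cmod; apply: eq_bigr => n _; rewrite e2piD; ring.
have -> : T2 = Cmod (\sum_(P.+1 <= n < P'.+1) (weight m (psi (INR n)) *
     (RtoC (prime_log n) * e2pi (- xi * INR n + m * F (INR n)))))%C.
  congr Cmod; apply: eq_bigr => n _; rewrite Cmult_conj Cconj_R Cconj_e2pi e2piD.
  by rewrite (_ : - (xi * INR n) = - xi * INR n); ring.
by have := half xi; have := half (- xi); lra.
Qed.

(** The sums over all integers that [saw_error_sum] asks for: [phase_sum] with l = 1 and xi = 0. The
    shift by psi is removed by partial summation, e(- j psi) having variation at most 2 pi j A on
    the window. *)
Lemma phase_diff_weight_sum Y F F1 G G1 (psi : R -> R) (P P' j : nat) A :
  phase Y F F1 G G1 -> Y <= INR P -> (0 < P)%N -> (P < P' <= 2 * P)%N -> (0 < j)%N -> 0 <= A ->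
  (forall n, (0 < n)%N -> 0 < psi (INR n) <= 1 / 2) ->
  (forall n, (P < n)%N -> Rabs (psi (INR n.+1) - psi (INR n)) <= A * psi (INR n.+1) / INR n) ->
  let B := 320 * (sqrt (INR j * G (INR P)) + INR P / sqrt (INR j * G (INR P))) in
  Cmod (\sum_(P.+1 <= n < P'.+1) e2pi (INR j * F (INR n)))%C <= B /\
  Cmod (\sum_(P.+1 <= n < P'.+1) e2pi (INR j * (F (INR n) - psi (INR n))))%C <= (1 + 2 * PI * INR j * A) * B.
Proof.
move=> ph YP P0 PP' j0 A0 psi0 var B; have pp := PI_RGT_0; have j1 := INR_gt0 _ j0.
have p0 := INR_gt0 _ P0.
have g0 := phase_gt0 _ _ _ _ _ _ ph YP.
have s0 : 0 < sqrt (INR j * G (INR P)) by apply: sqrt_lt_R0; exact: Rmult_lt_0_compat.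
have B0 : 0 <= B by have : 0 < INR P / sqrt (INR j * G (INR P)); [exact: Rdiv_lt_0_compat | rewrite /B; lra].
have base c : (P < c.+1 <= (2 * P).+1)%N -> Cmod (\sum_(P.+1 <= n < c.+1) e2pi (INR j * F (INR n)))%C <= B.
  move=> hc; have := phase_sum _ _ _ _ _ P 1 P.+1 c.+1 (INR j) 0 ph YP j1 ltac:(lia) ltac:(lia).
  rewrite (_ : INR 1 = 1) // Rmult_1_l => H.
  rewrite (eq_bigr (fun n => e2pi (0 * INR n + INR j * F (INR (n * 1)%N)))).
    by apply: H => k hk; lia.
  by move=> n _; rewrite muln1 Rmult_0_l Rplus_0_l.
split; first by apply: base; lia.
rewrite (eq_bigr (fun n => (e2pi (- (INR j * psi (INR n))) * e2pi (INR j * F (INR n)))%C)); last first.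
  by move=> n _; rewrite -e2piD; congr e2pi; ring.
apply: abel_bound => //; [lia|by rewrite Cmod_e2pi; lra| |by move=> c hc; apply: base; lia].
apply: (Rle_trans _ (\sum_(P.+1 <= n < P') (2 * PI * INR j * A * / INR n))).
  apply: Rsum_le_nat => n hn; have n0 : 0 < INR n by apply: INR_gt0; lia.
  apply: Rle_trans (e2pi_lip _ _) _.
  rewrite (_ : - (INR j * psi (INR n.+1)) - - (INR j * psi (INR n)) = - (INR j * (psi (INR n.+1) - psi (INR n)))); last by ring.
  rewrite Rabs_Ropp Rabs_mult (Rabs_pos_eq (INR j)); last lra.
  have v := var n ltac:(lia); have s1 := psi0 n.+1 ltac:(lia).
  have v2 : Rabs (psi (INR n.+1) - psi (INR n)) <= A * / INR n.
    apply: Rle_trans v _; rewrite /Rdiv; apply: Rmult_le_compat_r; first exact/Rlt_le/Rinv_0_lt_compat.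
    nra.
  rewrite -Rmult_assoc (Rmult_assoc _ A); apply: Rmult_le_compat_l => //.
  by apply: Rmult_le_pos; lra.
rewrite -Rsum_mull -[X in _ <= X]Rmult_1_r; apply: Rmult_le_compat_l.
  by apply: Rmult_le_pos => //; apply: Rmult_le_pos; lra.
by apply: sum_inv_window => //; lia.
Qed.

(** Membership in B without the domain condition h1 x0 <= n, which holds automatically for large
    n. *)
Definition psi_indicator (F psi : R -> R) (n : nat) : R :=
  if Rlt_dec (frac_part (F (INR n))) (psi (INR n)) then 1 else 0.

(** By [saw_indicator] the coefficient is a difference of two values of [saw] divided by psi. Each
    value is a remainder minus the truncated series: the series gives M prime sums, each divided by
    pi m, and the remainders are estimated in absolute value. *)
Lemma window_split (F psi : R -> R) M (P P' : nat) xi X1 X2 :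
  (forall n, (0 < n)%N -> 0 < psi (INR n) <= 1 / 2) ->
  (forall m, (0 < m <= M)%N -> Cmod (\sum_(P.+1 <= n < P'.+1)
     (RtoC (Im (weight (INR m) (psi (INR n)) * e2pi (INR m * F (INR n)))%C)
     * (RtoC (prime_log n) * e2pi (xi * INR n))))%C <= PI * INR m * X1) ->
  \sum_(P.+1 <= n < P'.+1) (prime_log n * / psi (INR n) *
     (Rabs (saw (F (INR n) - psi (INR n)) + saw_series M (F (INR n) - psi (INR n))) +
      Rabs (saw (F (INR n)) + saw_series M (F (INR n))))) <= X2 ->
  Cmod (\sum_(P.+1 <= n < P'.+1) (RtoC (prime_log n * (/ psi (INR n) * psi_indicator F psi n - 1))
     * e2pi (xi * INR n)))%C <= INR M * X1 + X2.
Proof.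
move=> psi0 H1 H2; have pp := PI_RGT_0.
pose r x := saw x + saw_series M x.
have E : (\sum_(P.+1 <= n < P'.+1) (RtoC (prime_log n * (/ psi (INR n) * psi_indicator F psi n - 1))
     * e2pi (xi * INR n)) =
   (\sum_(P.+1 <= n < P'.+1) (RtoC (prime_log n * / psi (INR n) *
       (r (F (INR n) - psi (INR n))%R - r (F (INR n)))%R) * e2pi (xi * INR n)))
   - \sum_(1 <= m < M.+1) (RtoC (/ (PI * INR m)) * \sum_(P.+1 <= n < P'.+1)
      (RtoC (Im (weight (INR m) (psi (INR n)) * e2pi (INR m * F (INR n)))%C)
     * (RtoC (prime_log n) * e2pi (xi * INR n)))))%C.
  under [X in (_ - X)%C]eq_bigr => m _ do rewrite Csum_mull.
  rewrite [X in (_ - X)%C]exchange_big Csum_sub; apply: eq_big_nat => n hn.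
  have s0 := psi0 n ltac:(lia).
  have -> : prime_log n * (/ psi (INR n) * psi_indicator F psi n - 1) =
     prime_log n * / psi (INR n) * (r (F (INR n) - psi (INR n)) - r (F (INR n)))
     - prime_log n * (/ psi (INR n) * (saw_series M (F (INR n) - psi (INR n)) - saw_series M (F (INR n)))).
    have := saw_indicator (F (INR n)) _ s0; rewrite -/(psi_indicator F psi n) => h.
    have -> : psi_indicator F psi n = saw (F (INR n) - psi (INR n)) - saw (F (INR n)) + psi (INR n) by lra.
    by rewrite /r; field; lra.
  rewrite saw_series_diff; set a := prime_log n * / psi (INR n) * _; set S := \sum_(_ <= _ < _) _.
  set T := (\sum_(_ <= _ < _) _)%C.
  have -> : T = (RtoC S * (RtoC (prime_log n) * e2pi (xi * INR n)))%C.
    rewrite /T /S RtoC_sum Csum_mulr; apply: eq_bigr => m _.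
    by rewrite RtoC_mult; ring.
  by rewrite RtoC_minus (RtoC_mult (prime_log n) S); ring.
rewrite E; apply: Rle_trans (Cmod_triangle _ _) _; rewrite Cmod_opp Rplus_comm; apply: Rplus_le_compat.
  apply: Rle_trans (Cmod_sum _ _ _ _) _.
  apply: (Rle_trans _ (\sum_(1 <= m < M.+1) X1)); last by rewrite Rsum_const subn1 /=; lra.
  apply: Rsum_le_nat => m hm; have m0 : 0 < INR m by apply: INR_gt0; lia.
  have pm : 0 < PI * INR m by exact: Rmult_lt_0_compat.
  rewrite Cmod_mult Cmod_R Rabs_pos_eq; last exact/Rlt_le/Rinv_0_lt_compat.
  apply: (Rmult_le_reg_l (PI * INR m)) => //; rewrite -Rmult_assoc Rinv_r ?Rmult_1_l; last lra.
  by apply: H1; lia.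
apply: Rle_trans H2; apply: Cmod_sum_le => n hn; have s0 := psi0 n ltac:(lia).
have is0 : 0 < / psi (INR n) by apply: Rinv_0_lt_compat; lra.
have l0 := prime_log_bound n ltac:(lia).
rewrite Cmod_mult Cmod_e2pi Rmult_1_r Cmod_R Rabs_mult (Rabs_pos_eq (_ * _)); last nra.
apply: Rmult_le_compat_l; first nra.
apply: Rle_trans (Rabs_triang _ _) _; rewrite Rabs_Ropp /r; lra.
Qed.

(** The cut-off is M = P^mu, up to rounding. Truncation leaves P^(1 - mu), the factor 1 / psi costs
    P^(d + e) and the logarithms P^e, so that mu = d + chi + 3 e yields exactly P^(1 - chi - e). *)
Lemma window_bound Y F F1 G G1 d psi chi : phase Y F F1 G G1 -> growth G -> slow_weight d psi ->
  0 <= d -> 0 < chi -> 17 * d + 31 * chi <= 1 ->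
  exists K Y', 0 < K /\ forall (P P' : nat) xi, Y' <= INR P -> (P <= P' <= 2 * P)%N ->
    Cmod (\sum_(P.+1 <= n < P'.+1) (RtoC (prime_log n * (/ psi (INR n) * psi_indicator F psi n - 1))
     * e2pi (xi * INR n)))%C <= K * Rpower (INR P) (1 - chi - 1 / 1000).
Proof.
move=> ph gr [psi0 [[A2 [Y2 [A20 var]]] low]] d0 chi0 hd.
pose e := 1 / 1000; have eE : e = 1 / 1000 by [].
(* The exponents fit since [3/2 d + 5/2 chi < 1/10] and [5/4 d + 9/4 chi < 1/12]. *)
pose mu := d + chi + 3 * e.
have mu0 : 0 <= mu <= 1 / 6 by rewrite /mu; lra.
have e0 : 0 < e by lra.
have [A1 [Y1 [A10 HA1]]] := prime_sum_bound _ _ _ _ _ mu e ph gr mu0 e0.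
have [Y3 HY3] := low e e0.
have [B [B1 HB]] := log_divisor_loss e e0.
have [Y4 HG] := gr.
pose K1 := 4 * ((2 + 4 * A2) * A1).
pose C3 := 320 * 3 * (1 + 16 * A2).
pose K2 := 96 * B * (1 + C3).
have C30 : 0 < C3 by rewrite /C3; nra.
have K10 : 0 < K1 by rewrite /K1; nra.
have K20 : 0 < K2 by rewrite /K2; nra.
exists (K1 + K2), (Rmax (Rmax 2 (Rmax Y Y1)) (Rmax Y2 (Rmax Y3 Y4))); split; first lra.
move=> P P' xi YP /andP[PP P2].
have [/Rmax_le [h2 /Rmax_le [hY hY1]] /Rmax_le [hY2 /Rmax_le [hY3 hY4]]] := Rmax_le _ _ _ YP.
set p := INR P in YP h2 hY hY1 hY2 hY3 hY4 *.
have p1 : 1 <= p by lra.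
have P0 : (0 < P)%N by apply/leP/INR_lt; rewrite (_ : INR 0 = 0) // -/p; lra.
set T := Rpower p (1 - chi - 1 / 1000).
have T0 : 0 < T by exact: Rpower_gt0.
case: (ltnP P P') => PP'; last by rewrite big_geq ?Cmod_0; [nra | lia].
have rm1 : 1 <= Rpower p mu by apply: Rpower_ge1; lra.
have [M [M1 M2]] := ceil_nat_exists (Rpower p mu) ltac:(lra).
have M0 : (0 < M)%N by apply/leP/INR_lt; rewrite (_ : INR 0 = 0) //; lra.
have Mr := INR_gt0 _ M0.
have varP n : (P < n)%N -> Rabs (psi (INR n.+1) - psi (INR n)) <= A2 * psi (INR n.+1) / INR n.
  by move=> hn; apply: var; [apply: Rle_trans hY2 _; apply: INR_leq; lia | lia].
pose X := A1 * (Rpower p (9 / 10 + mu / 2 + e) + Rpower p (11 / 12 + mu / 4 + e)).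
have X0 : 0 <= X.
  by have := Rpower_gt0 p (9 / 10 + mu / 2 + e); have := Rpower_gt0 p (11 / 12 + mu / 4 + e); rewrite /X; nra.
have [H1 _] := HB P P0; move: H1; rewrite -/p; set L := ln _ => H1.
have L0 : 0 <= L by apply: ln_ge0; apply: INR_ge1; lia.
have L2B : L * (1 + L) <= B * Rpower p e.
  by apply: Rle_trans H1; apply: Rmult_le_compat_l => //; rewrite /pow; nra.
have LB : L <= B * Rpower p e by nra.
have pe := Rpower_gt0 p e.
(* Bounds the integer sums for all j <= M. Van der Corput gives p^(11/20 + mu/2), with 11/20 = 1 -
   9/20 from the lower bound for G; a further p^mu comes from the variation of e(- j psi). *)
pose E := C3 * Rpower p (11 / 20 + 3 / 2 * mu).
have E0 : 0 < E by apply: Rmult_lt_0_compat => //; exact: Rpower_gt0.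
have [gl gu] := HG p hY4.
have g0 : 0 < G p by have := Rpower_gt0 p (9 / 10); lra.
have s4 : sqrt 4 = 2 by rewrite (_ : 4 = 2 * 2); [rewrite sqrt_square; lra | ring].
have pi4 := PI_4; have pi0 := PI_RGT_0.
have jB j : (0 < j <= M)%N -> let B' := 320 * (sqrt (INR j * G p) + p / sqrt (INR j * G p)) in
    0 <= B' /\ (1 + 2 * PI * INR j * A2) * B' <= E.
  move=> /andP[j0 jM] B'; have j1 := INR_ge1 _ j0; have jr := INR_leq _ _ jM.
  have jg : Rpower p (9 / 10) <= INR j * G p by nra.
  have jg2 : INR j * G p <= 4 * Rpower p (1 + mu).
    rewrite Rpower_plus Rpower_1; last lra.
    by apply: (Rle_trans _ (2 * Rpower p mu * (2 * p))); [apply: Rmult_le_compat; lra | lra].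
  have a1 : sqrt (INR j * G p) <= 2 * Rpower p (11 / 20 + mu / 2).
    apply: (Rle_trans _ (2 * Rpower p ((1 + mu) / 2))).
      by rewrite -sqrt_Rpower -{1}s4 -sqrt_mult_alt; [apply: sqrt_le_1_alt | lra].
    by apply: Rmult_le_compat_l; [lra | apply: Rle_Rpower; lra].
  have a3 : Rpower p (9 / 20) <= sqrt (INR j * G p).
    rewrite (_ : 9 / 20 = 9 / 10 / 2); last by field.
    by rewrite -sqrt_Rpower; apply: sqrt_le_1_alt.
  have r9 := Rpower_gt0 p (9 / 20).
  have a2 : p / sqrt (INR j * G p) <= Rpower p (11 / 20 + mu / 2).
    apply: (Rle_trans _ (p * / Rpower p (9 / 20))).
      by apply: Rmult_le_compat_l; [lra | apply: Rinv_le_contravar].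
    by rewrite -Rpower_Ropp -{1}(Rpower_1 p); [apply: Rpower_mult_le; lra | lra].
  have B0 : 0 <= B'.
    by have : 0 < p / sqrt (INR j * G p); [apply: Rdiv_lt_0_compat; lra | rewrite /B'; have := sqrt_pos (INR j * G p); lra].
  split=> //.
  have a4 : 1 + 2 * PI * INR j * A2 <= (1 + 16 * A2) * Rpower p mu.
    have q1 : PI * INR j <= 4 * (2 * Rpower p mu) by apply: Rmult_le_compat; lra.
    have q2 : PI * INR j * A2 <= 4 * (2 * Rpower p mu) * A2 by apply: Rmult_le_compat_r; lra.
    lra.
  apply: (Rle_trans _ ((1 + 16 * A2) * Rpower p mu * (320 * (3 * Rpower p (11 / 20 + mu / 2))))).
    apply: Rmult_le_compat => //; last by rewrite /B'; lra.
    have : 0 <= PI * INR j * A2 by apply: Rmult_le_pos; nra.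
    lra.
  right; rewrite /E /C3; have -> : 11 / 20 + 3 / 2 * mu = mu + (11 / 20 + mu / 2) by field.
  by rewrite (Rpower_plus mu); ring.
have esum j : (0 < j <= M)%N ->
    Cmod (\sum_(P.+1 <= n < P'.+1) e2pi (INR j * F (INR n)))%C <= E /\
    Cmod (\sum_(P.+1 <= n < P'.+1) e2pi (INR j * (F (INR n) - psi (INR n))))%C <= E.
  move=> hj; have /andP[j0 jM] := hj.
  have PPw : (P < P' <= 2 * P)%N by rewrite PP'.
  have [b1 b2] := phase_diff_weight_sum _ _ _ _ _ _ _ _ _ _ ph hY P0 PPw j0 (Rlt_le _ _ A20) psi0 varP.
  have [c1 c2] := jB j hj; rewrite -/p in b1 b2.
  split; last by apply: Rle_trans b2 c2.
  apply: Rle_trans b1 _; apply: Rle_trans c2.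
  have : 0 <= 2 * PI * INR j * A2.
    by apply: Rmult_le_pos; [apply: Rmult_le_pos; [lra | exact: pos_INR] | lra].
  nra.
pose R0 := 24 * (p * ((1 + L) * Rpower p (- mu)) + E).
have errb (x : nat -> R) : (forall j, (0 < j <= M)%N -> Cmod (\sum_(P.+1 <= n < P'.+1) e2pi (INR j * x n))%C <= E) ->
    \sum_(P.+1 <= n < P'.+1) Rabs (saw (x n) + saw_series M (x n)) <= R0.
  move=> hx; apply: Rle_trans (saw_error_sum M x _ _ E M0 _ (Rlt_le _ _ E0) hx) _; first by lia.
  apply: Rmult_le_compat_l; first lra; apply: Rplus_le_compat_r.
  have lM : ln (INR M) <= L.
    apply: ln_le => //; rewrite INR_muln (_ : INR 2 = 2) // -/p.
    have : Rpower p mu <= p by rewrite -{2}(Rpower_1 p); [apply: Rle_Rpower; lra | lra].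
    lra.
  have lM0 : 0 <= ln (INR M) by apply: ln_ge0; exact: INR_ge1.
  apply: Rmult_le_compat; first exact: pos_INR.
  - by apply: Rdiv_le_0_compat; lra.
  - by apply: INR_leq; lia.
  apply: Rmult_le_compat; [lra|by apply/Rlt_le/Rinv_0_lt_compat|lra|].
  by rewrite Rpower_Ropp; apply: Rinv_le_contravar => //; lra.
have R00 : 0 <= R0.
  have : 0 <= p * ((1 + L) * Rpower p (- mu)).
    by apply: Rmult_le_pos; [lra | apply: Rmult_le_pos; [lra | exact/Rlt_le/Rpower_gt0]].
  rewrite /R0; lra.
pose X2 := L * (2 * Rpower p (d + e)) * (2 * R0).
apply: Rle_trans (window_split F psi M P P' xi ((2 + 4 * A2) * X) X2 psi0 _ _) _.
- move=> m hm; have m1 : 1 <= INR m by apply: INR_ge1; lia.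
  have mM : INR m <= INR M by apply: INR_leq; lia.
  rewrite (_ : PI * INR m * ((2 + 4 * A2) * X) = (2 + 4 * A2) * PI * INR m * X); last by ring.
  apply: weight_sum => //; [lia|lra|lra|by move=> n hn; have := psi0 n hn; lra|].
  move=> c x hc; rewrite /X /p; apply: HA1 => //.
  by rewrite -/p; lra.
- apply: (Rle_trans _ (\sum_(P.+1 <= n < P'.+1) (L * (2 * Rpower p (d + e)) *
     (Rabs (saw (F (INR n) - psi (INR n)) + saw_series M (F (INR n) - psi (INR n))) +
      Rabs (saw (F (INR n)) + saw_series M (F (INR n))))))).
    apply: Rsum_le_nat => n hn; have n0 : (0 < n)%N by lia.
    have [l0 l1] := prime_log_bound n n0.
    have nP : INR n <= 2 * p by rewrite -[2]/(INR 2) /p -INR_muln; apply: INR_leq; lia.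
    have nP2 : p <= INR n by apply: INR_leq; lia.
    apply: Rmult_le_compat_r; first by apply: Rplus_le_le_0_compat; exact: Rabs_pos.
    apply: Rmult_le_compat => //; first by apply/Rlt_le/Rinv_0_lt_compat; have := psi0 n n0; lra.
      by apply: Rle_trans l1 _; apply: ln_INR_le; lia.
    apply: Rle_trans (HY3 n _ n0) _; first lra.
    apply: (Rle_trans _ (Rpower (2 * p) (d + e))); first by apply: Rle_Rpower_l; lra.
    rewrite -Rpower_mult_distr; [|lra|lra]; apply: Rmult_le_compat_r; first exact/Rlt_le/Rpower_gt0.
    by rewrite -{2}(Rpower_1 2); [apply: Rle_Rpower; lra | lra].
  rewrite -Rsum_mull big_split /=; apply: Rmult_le_compat_l.
    by apply: Rmult_le_pos => //; have := Rpower_gt0 p (d + e); lra.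
  have e1 := errb (fun n => F (INR n) - psi (INR n)) (fun j hj => proj2 (esum j hj)).
  have e2 := errb (fun n => F (INR n)) (fun j hj => proj1 (esum j hj)).
  by rewrite /= in e1 e2; lra.
have Z1 : INR M * ((2 + 4 * A2) * X) <= K1 * T.
  apply: (Rle_trans _ (2 * Rpower p mu * ((2 + 4 * A2) * X))).
    by apply: Rmult_le_compat_r; [apply: Rmult_le_pos; lra | lra].
  have q1 := Rpower_mult_le p mu (9 / 10 + mu / 2 + e) (1 - chi - 1 / 1000) p1 ltac:(rewrite /mu; lra).
  have q2 := Rpower_mult_le p mu (11 / 12 + mu / 4 + e) (1 - chi - 1 / 1000) p1 ltac:(rewrite /mu; lra).
  have -> : 2 * Rpower p mu * ((2 + 4 * A2) * X) = 2 * ((2 + 4 * A2) * A1) *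
     (Rpower p mu * Rpower p (9 / 10 + mu / 2 + e) + Rpower p mu * Rpower p (11 / 12 + mu / 4 + e)).
    by rewrite /X; ring.
  have -> : K1 * T = 2 * ((2 + 4 * A2) * A1) * (2 * T) by rewrite /K1; ring.
  by apply: Rmult_le_compat_l; [nra | rewrite /T; lra].
have Z2 : X2 <= K2 * T.
  have pd := Rpower_gt0 p (d + e); have pm := Rpower_gt0 p (- mu).
  have -> : X2 = 96 * ((L * (1 + L)) * (Rpower p (d + e) * (p * Rpower p (- mu))) + L * (Rpower p (d + e) * E)).
    by rewrite /X2 /R0; ring.
  have q1 : L * (1 + L) * (Rpower p (d + e) * (p * Rpower p (- mu))) <= B * T.
    apply: (Rle_trans _ (B * Rpower p e * (Rpower p (d + e) * (p * Rpower p (- mu))))).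
      by apply: Rmult_le_compat_r => //; apply: Rmult_le_pos; [lra | apply: Rmult_le_pos; lra].
    rewrite Rmult_assoc; apply: Rmult_le_compat_l; first lra.
    rewrite (_ : p * Rpower p (- mu) = Rpower p (1 + - mu)); last by rewrite Rpower_plus Rpower_1; lra.
    by rewrite -!Rpower_plus; apply: Rle_Rpower => //; rewrite /mu; lra.
  have q2 : L * (Rpower p (d + e) * E) <= B * C3 * T.
    apply: (Rle_trans _ (B * Rpower p e * (Rpower p (d + e) * E))).
      by apply: Rmult_le_compat_r => //; apply: Rmult_le_pos; lra.
    have -> : B * Rpower p e * (Rpower p (d + e) * E) =
      B * C3 * (Rpower p e * (Rpower p (d + e) * Rpower p (11 / 20 + 3 / 2 * mu))) by rewrite /E; ring.
    apply: Rmult_le_compat_l; first nra.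
    by rewrite -!Rpower_plus; apply: Rle_Rpower => //; rewrite /mu; lra.
  rewrite /K2; lra.
lra.
Qed.

(** * Inverses of regularly varying functions *)

Lemma is_lim_infty_eventually f (l : R) e : is_lim f p_infty l -> 0 < e ->
  exists Y, forall x, Y <= x -> Rabs (f x - l) < e.
Proof.
move=> /is_lim_spec H e0; have [M HM] := H (mkposreal e e0).
by exists (M + 1) => x hx; apply: HM; lra.
Qed.

Lemma D_in_is_derive f d a x : D_in f d (ray a) x -> a < x -> is_derive f x (d x).
Proof.
move=> H ax; apply/is_derive_Reals => e e0.
have [alp [alp0 Ha]] := H e e0.
have m0 : 0 < Rmin alp (x - a) by apply: Rmin_glb_lt; lra.
exists (mkposreal _ m0) => k k0 /= hk.
have h1 := Rmin_l alp (x - a); have h2 := Rmin_r alp (x - a).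
have := Ha (x + k); rewrite /R_dist /= /Rdist (_ : x + k - x = k); last by ring.
apply; split; last lra.
split; last by move=> E; apply: k0; lra.
by rewrite /ray; move: hk => /Rabs_def2; lra.
Qed.

Lemma continue_in_clamp f a : (forall x, a <= x -> continue_in f (ray a) x) ->
  forall t, continuity_pt (fun s => f (Rmax s a)) t.
Proof.
move=> H t e e0; have [alp [alp0 Ha]] := H (Rmax t a) (Rmax_r t a) e e0.
exists alp; split=> // s [_ /=]; rewrite /R_dist /Rdist /dist /= => hs.
case: (Req_dec (Rmax t a) (Rmax s a)) => [<-|ne]; first by rewrite Rminus_diag Rabs_R0.
apply: (Ha (Rmax s a)); split; first by split; [rewrite /ray; have := Rmax_r s a; lra | exact: ne].
rewrite /= /Rdist; apply: Rle_lt_trans hs.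
by rewrite /Rmax; do 2 case: Rle_dec => ?; split_Rabs; lra.
Qed.

(* [theta / t] is integrated by extending [theta] to the left of [x0] by a constant. *)
Lemma exp_form_derive x0 th th1 x : 1 <= x0 -> x0 < x ->
  (forall s, x0 <= s -> D_in th th1 (ray x0) s) ->
  is_derive (fun x => RInt (fun t => th t / t) x0 x) x (th x / x).
Proof.
move=> h0 hx H.
pose g t := th (Rmax t x0) / Rmax t x0.
have cg t : continuous g t.
  apply/continuity_pt_filterlim; apply: continuity_pt_div.
  - apply: continue_in_clamp => s hs; exact: cont_deriv (H s hs).
  - apply: (continue_in_clamp (fun s => s)) => s hs e e0; exists e; split=> // u [_ hu]; exact: hu.
  - by have := Rmax_r t x0; lra.
have e0 : 0 < x - x0 by lra.
have eg : th x / x = g x by rewrite /g Rmax_left; lra.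
rewrite eg; apply: (is_derive_ext_loc (fun b => RInt g x0 b)).
  exists (mkposreal _ e0) => b /= hb; apply: RInt_ext => t ht.
  have hb' : x0 < b by move: hb; rewrite /ball /= /AbsRing_ball /abs /minus /plus /opp /= => /Rabs_def2; lra.
  by rewrite Rmin_left ?Rmax_right in ht; try lra; rewrite /g Rmax_left; lra.
apply: (is_derive_RInt g _ x0); last exact: cg.
exists (mkposreal _ e0) => b _; apply: RInt_correct.
by apply: ex_RInt_continuous => t _; exact: cg.
Qed.

(** A common interface for [class_L0] with c = 1 and [class_L] with c > 1. The unifying quantity is
    c - 1 + theta: it is theta itself when c = 1, the yardstick built into [class_L0], and tends to
    c - 1 > 0 otherwise. *)
Record regular (x0 c : R) (h th th1 th2 : R -> R) : Prop := Regular {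
  reg_x0 : 1 <= x0;
  reg_c : 1 <= c;
  reg_incr : strictly_increasing_on (ray x0) h;
  reg_ge : forall x, x0 <= x -> x <= h x;
  reg_h : forall x, x0 < x -> is_derive h x (h x * (c + th x) / x);
  reg_th : forall x, x0 < x -> is_derive th x (th1 x) /\ is_derive th1 x (th2 x);
  reg_lim : forall e, 0 < e -> exists Y, forall x, Y <= x -> Rabs (th x) < e;
  reg_small : forall k, 0 < k -> exists Y, forall x, Y <= x -> 0 < c - 1 + th x /\
     Rabs (x * th1 x) <= k * (c - 1 + th x) /\ Rabs (x ^ 2 * th2 x) <= k * (c - 1 + th x);
  reg_low : forall e, 0 < e -> exists C Y, 0 < C /\ forall x, Y <= x -> C * Rpower x (- e) <= c - 1 + th x
}.

Lemma class_R_regular x0 c h : 1 <= x0 -> 1 <= c -> class_R x0 c h ->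
  exists th th1 th2, regular x0 c h th th1 th2.
Proof.
move=> x01 c1 [h1 [hinc [_ [ell [hE hl]]]]].
have ge (l1 : forall x, x0 <= x -> 1 <= ell x) x : x0 <= x -> x <= h x.
  move=> hx; rewrite hE //; have x1 : 1 <= x by lra.
  have : x <= Rpower x c by rewrite -{1}(Rpower_1 x); [apply: Rle_Rpower | lra].
  by have := l1 x hx; nra.
have der th th1 th2 : C2_on (ray x0) th th1 th2 -> Defs.exp_form x0 th ell ->
    (forall x, x0 < x -> is_derive h x (h x * (c + th x) / x)) /\
    (forall x, x0 < x -> is_derive th x (th1 x) /\ is_derive th1 x (th2 x)).
  move=> C2 ef; split=> x hx; last first.
    by have [d1 [d2 _]] := C2 x (Rlt_le _ _ hx); split; apply: D_in_is_derive; eauto.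
  have d := exp_form_derive x0 th th1 x x01 hx (fun s hs => proj1 (C2 s hs)).
  have e0 : 0 < x - x0 by lra.
  apply: (is_derive_ext_loc (fun x => Rpower x c * exp (RInt (fun t => th t / t) x0 x))).
    exists (mkposreal _ e0) => b /= hb.
    have hb' : x0 <= b by move: hb; rewrite /ball /= /AbsRing_ball /abs /minus /plus /opp /= => /Rabs_def2; lra.
    by rewrite hE // ef.
  rewrite hE ?ef; try lra.
  rewrite (_ : Rpower x c * exp (RInt (fun t => th t / t) x0 x) * (c + th x) / x =
    (c / x * Rpower x c) * exp (RInt (fun t => th t / t) x0 x) +
    Rpower x c * (th x / x * exp (RInt (fun t => th t / t) x0 x))); last by field; lra.
  apply: is_derive_mult; last by move=> *; exact: Rmult_comm.
    by rewrite /Rpower; auto_derive; [lra | field; lra].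
  apply: (is_derive_comp exp); last exact: d.
  by apply/is_derive_Reals; exact: derivable_pt_lim_exp.
case: hl => [[cE [l1 [[th [th1 [th2 [C2 [ef [tpos [_ [lim0 [lim1 [lim2 low]]]]]]]]]] _]]]|
             [c1' [l1 [th [th1 [th2 [C2 [ef [lim0 [lim1 lim2]]]]]]]]]].
  have [d1 d2] := der _ _ _ C2 ef.
  exists th, th1, th2; split=> //; first exact: ge.
  - by move=> e e0; have [Y HY] := is_lim_infty_eventually _ _ _ lim0 e0; exists Y => x /HY; rewrite Rminus_0_r.
  - move=> k k0; have [Y1 H1] := is_lim_infty_eventually _ _ _ lim1 k0.
    have [Y2 H2] := is_lim_infty_eventually _ _ _ lim2 k0.
    exists (Rmax x0 (Rmax Y1 Y2)) => x hx.
    have [m1 /Rmax_le [m2 m3]] := Rmax_le _ _ _ hx.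
    have tp := tpos x m1; have := H1 x m2; have := H2 x m3.
    rewrite !Rminus_0_r !Rabs_div ?(Rabs_pos_eq (th x)); try lra.
    have div u : u / th x < k -> u <= k * th x.
      by move=> hu; rewrite (_ : u = u / th x * th x); [apply: Rmult_le_compat_r; lra | field; lra].
    by move=> /div ? /div ?; split; [lra | split; rewrite cE (_ : 1 - 1 + th x = th x); lra].
  move=> e e0; have [C [C0 HC]] := low e e0; exists C, x0; split=> // x hx.
  by have := HC x hx; lra.
have [d1 d2] := der _ _ _ C2 ef.
(* For c > 1 the quantity c - 1 + theta eventually exceeds (c - 1) / 2, which turns the absolute
   limits of [class_L] into relative ones. *)
have c0 : 0 < (c - 1) / 2 by lra.
exists th, th1, th2; split=> //; first exact: ge.
- by move=> e e0; have [Y HY] := is_lim_infty_eventually _ _ _ lim0 e0; exists Y => x /HY; rewrite Rminus_0_r.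
- move=> k k0; have kc : 0 < k * ((c - 1) / 2) by nra.
  have [Y1 H1] := is_lim_infty_eventually _ _ _ lim1 kc.
  have [Y2 H2] := is_lim_infty_eventually _ _ _ lim2 kc.
  have [Y3 H3] := is_lim_infty_eventually _ _ _ lim0 c0.
  exists (Rmax Y3 (Rmax Y1 Y2)) => x hx.
  have [m1 /Rmax_le [m2 m3]] := Rmax_le _ _ _ hx.
  have := H1 x m2; have := H2 x m3; have := H3 x m1.
  rewrite !Rminus_0_r => /Rabs_def2 t1 t2 t3.
  have : k * ((c - 1) / 2) <= k * (c - 1 + th x) by apply: Rmult_le_compat_l; lra.
  lra.
move=> e e0; have [Y3 H3] := is_lim_infty_eventually _ _ _ lim0 c0.
exists ((c - 1) / 2), (Rmax 1 Y3); split=> // x hx.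
have [m1 m2] := Rmax_le _ _ _ hx.
have := H3 x m2; rewrite Rminus_0_r => /Rabs_def2 t1.
have : Rpower x (- e) <= 1 by rewrite -(Rpower_O x); [apply: Rle_Rpower; lra | lra].
have := Rpower_gt0 x (- e); nra.
Qed.

Lemma inverse_ge x0 h phi X y : strictly_increasing_on (ray x0) h -> inverse_on_ray x0 h phi ->
  x0 <= X -> h X <= y -> X <= phi y /\ h (phi y) = y.
Proof.
move=> inc [_ inv] hX hy.
have h0 : h x0 <= h X.
  by case: (Req_dec x0 X) => [->|ne]; [lra | apply/Rlt_le/inc; rewrite /ray; lra].
have [p1 p2] := inv y ltac:(lra); split=> //.
case: (Rle_lt_dec X (phi y)) => // lt.
have : h (phi y) < h X by apply: inc.
lra.
Qed.

(** Continuity of phi comes from monotonicity alone: phi (y + k) is trapped between x - eta and x +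
    eta. The difference quotient of phi is then the inverse of that of h. *)
Lemma inverse_derive x0 h phi y d : strictly_increasing_on (ray x0) h -> inverse_on_ray x0 h phi ->
  h x0 < y -> is_derive h (phi y) d -> 0 < d -> is_derive phi y (/ d).
Proof.
move=> inc inv hy /is_derive_Reals hd d0.
have [_ inv2] := inv; have [px0 hp] := inv2 y (Rlt_le _ _ hy).
set x := phi y in hd px0 hp *.
have xx0 : x0 < x.
  case: (Req_dec x0 x) => E; last lra.
  by move: hp; rewrite -E; lra.
apply/is_derive_Reals => e e0.
(* The first bound keeps the quotient v of h above d / 2, so v d > d^2 / 2; the second then makes |v
   - d| / (v d) less than e. *)
pose e' := Rmin (d / 2) (e * d ^ 2 / 2).
have d2 : 0 < d ^ 2 by exact: pow_lt.
have e'0 : 0 < e' by apply: Rmin_glb_lt; nra.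
have [[del del0] Hd] := hd e' e'0; rewrite /= in Hd.
pose eta := Rmin (del / 2) (x - x0).
have eta0 : 0 < eta by apply: Rmin_glb_lt; lra.
have eta1 : eta <= del / 2 by exact: Rmin_l.
have eta2 : eta <= x - x0 by exact: Rmin_r.
have lo : h (x - eta) < y by rewrite -hp; apply: inc; rewrite /ray; lra.
have hi : y < h (x + eta) by rewrite -{1}hp; apply: inc; rewrite /ray; lra.
pose dk := Rmin (y - h (x - eta)) (h (x + eta) - y).
have dk0 : 0 < dk by apply: Rmin_glb_lt; lra.
exists (mkposreal _ dk0) => k k0 /= hk.
have k1 : dk <= y - h (x - eta) by exact: Rmin_l.
have k2 : dk <= h (x + eta) - y by exact: Rmin_r.
have {}hk := Rabs_def2 _ _ hk.
have [b1 b2] := inverse_ge x0 h phi (x - eta) (y + k) inc inv ltac:(lra) ltac:(lra).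
have b3 : phi (y + k) <= x + eta.
  case: (Rle_lt_dec (phi (y + k)) (x + eta)) => // lt.
  have : h (x + eta) < h (phi (y + k)) by apply: inc; rewrite /ray; lra.
  lra.
set u := phi (y + k) - x.
have uE : phi (y + k) = x + u by rewrite /u; ring.
have u0 : u <> 0.
  by move=> E; apply: k0; move: b2; rewrite uE E Rplus_0_r hp; lra.
have := Hd u u0 ltac:(apply: Rabs_def1; rewrite /u; lra).
rewrite -uE b2 hp (_ : y + k - y = k); last by ring.
set v := k / u => hv.
have m1 : e' <= d / 2 by exact: Rmin_l.
have m2 : e' <= e * d ^ 2 / 2 by exact: Rmin_r.
have v0 : d / 2 < v by have := Rabs_def2 _ _ hv; lra.
have -> : u / k - / d = - ((v - d) / (v * d)) by rewrite /v; field; repeat split; lra.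
rewrite Rabs_Ropp Rabs_div; last by apply: Rmult_integral_contrapositive; lra.
rewrite (Rabs_pos_eq (v * d)); last nra.
apply: (Rmult_lt_reg_r (v * d)); first nra.
rewrite (_ : Rabs (v - d) / (v * d) * (v * d) = Rabs (v - d)); last by field; lra.
apply: Rlt_le_trans hv _; apply: Rle_trans m2 _.
rewrite (_ : e * d ^ 2 / 2 = e * (d / 2 * d)); last by field.
by apply: Rmult_le_compat_l; [lra | apply: Rmult_le_compat_r; lra].
Qed.

(* With [x = phi y], [w = 1 / (c + theta x)] and the operator [D = y d/dy], one has [D phi = phi w]
   and [D w = - p w^3], where [p = x theta' x]; [inv_G] is [- y^2 phi''], [y * inv_G1] is
   [D inv_G], and [r = x^2 theta'' x]. *)
Definition inv_w (c : R) (th phi : R -> R) y := / (c + th (phi y)).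
Definition inv_p (th1 phi : R -> R) y := phi y * th1 (phi y).
Definition inv_r (th2 phi : R -> R) y := phi y ^ 2 * th2 (phi y).
Definition inv_G c th th1 phi y :=
  phi y * (inv_w c th phi y - inv_w c th phi y ^ 2 + inv_p th1 phi y * inv_w c th phi y ^ 3).
Definition inv_G1 c th th1 th2 phi y :=
  let w := inv_w c th phi y in let p := inv_p th1 phi y in let r := inv_r th2 phi y in
  (w * inv_G c th th1 phi y +
   phi y * (- p * w ^ 3 + 2 * p * w ^ 4 + (p + r) * w ^ 4 - 3 * p ^ 2 * w ^ 5)) / y.

Lemma inverse_eventually x0 c h th th1 th2 phi X : regular x0 c h th th1 th2 -> inverse_on_ray x0 h phi ->
  exists Y, 1 <= Y /\ forall y, Y <= y -> h x0 < y /\ X <= phi y /\ x0 < phi y /\ phi y <= y /\ h (phi y) = y.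
Proof.
move=> rg inv; have inc := reg_incr _ _ _ _ _ _ rg; have x01 := reg_x0 _ _ _ _ _ _ rg.
pose X' := Rmax X (x0 + 1).
have m1 : X <= X' by exact: Rmax_l.
have m2 : x0 + 1 <= X' by exact: Rmax_r.
exists (Rmax 1 (h X')); split; first exact: Rmax_l.
move=> y /Rmax_le [_ h2].
have [p1 p2] := inverse_ge x0 h phi X' y inc inv ltac:(lra) ltac:(lra).
have hh : h x0 < h X' by apply: inc; rewrite /ray; lra.
have := reg_ge _ _ _ _ _ _ rg (phi y) ltac:(lra).
by rewrite p2; repeat split; lra.
Qed.

Lemma inverse_calculus x0 c h th th1 th2 phi : regular x0 c h th th1 th2 -> inverse_on_ray x0 h phi ->
  exists Y, 1 <= Y /\ forall y, Y <= y ->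
    is_derive phi y (phi y * inv_w c th phi y / y) /\
    is_derive (fun y => phi y * inv_w c th phi y / y) y (- inv_G c th th1 phi y / y ^ 2) /\
    is_derive (inv_G c th th1 phi) y (inv_G1 c th th1 th2 phi y).
Proof.
move=> rg inv; have inc := reg_incr _ _ _ _ _ _ rg; have x01 := reg_x0 _ _ _ _ _ _ rg.
have c1 := reg_c _ _ _ _ _ _ rg.
have [X HX] := reg_lim _ _ _ _ _ _ rg (1 / 2) ltac:(lra).
have [Y [Y1 HY]] := inverse_eventually _ _ _ _ _ _ _ X rg inv.
exists Y; split=> // y hy; have [q1 [q2 [q3 [q4 q5]]]] := HY y hy.
have := HX (phi y) q2 => /Rabs_def2 t.
have d1 : is_derive phi y (phi y * inv_w c th phi y / y).
  have -> : phi y * inv_w c th phi y / y = / (h (phi y) * (c + th (phi y)) / phi y).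
    by rewrite q5 /inv_w; field; lra.
  apply: (inverse_derive x0 h phi) => //; first exact: reg_h rg _ _.
  by rewrite q5; apply: Rdiv_lt_0_compat; [nra | lra].
have [dt1 dt2] := reg_th _ _ _ _ _ _ rg (phi y) q3.
have E1 := is_derive_unique _ _ _ d1; have E2 := is_derive_unique _ _ _ dt1.
have E3 := is_derive_unique _ _ _ dt2.
have X1 : ex_derive phi y by exists (phi y * inv_w c th phi y / y).
have X2 : ex_derive th (phi y) by exists (th1 (phi y)).
have X3 : ex_derive th1 (phi y) by exists (th2 (phi y)).
split=> //; split; rewrite /inv_G1 /inv_G /inv_w /inv_p /inv_r.
  auto_derive; first by repeat split => //; lra.
  by rewrite E1 E2 /inv_w; field; lra.
auto_derive; first by repeat split => //; lra.
by rewrite E1 E2 E3 /inv_w (_ : INR 2 = 2) // (_ : INR 3 = 3); [field; lra | rewrite /INR; lra].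
Qed.

Lemma inv_w_limit x0 c h th th1 th2 phi e : regular x0 c h th th1 th2 -> inverse_on_ray x0 h phi ->
  0 < e -> exists Y, forall y, Y <= y -> / c - e <= inv_w c th phi y <= / c + e.
Proof.
move=> rg inv e0; have c1 := reg_c _ _ _ _ _ _ rg.
pose e' := Rmin (1 / 2) (e / 2).
have e'0 : 0 < e' by apply: Rmin_glb_lt; lra.
have m1 : e' <= 1 / 2 by exact: Rmin_l.
have m2 : e' <= e / 2 by exact: Rmin_r.
have [X HX] := reg_lim _ _ _ _ _ _ rg e' e'0.
have [Y [Y1 HY]] := inverse_eventually _ _ _ _ _ _ _ X rg inv.
exists Y => y hy; have [q1 [q2 [q3 [q4 q5]]]] := HY y hy.
have := HX (phi y) q2 => /Rabs_def2; rewrite /inv_w; set t := th _ => ht.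
have E : / (c + t) - / c = - t / (c * (c + t)) by field; lra.
have D : 1 / 2 <= c * (c + t) by nra.
have B : Rabs (/ (c + t) - / c) <= e.
  rewrite E Rabs_div; last lra; rewrite Rabs_Ropp (Rabs_pos_eq (c * _)); last lra.
  apply: (Rmult_le_reg_r (c * (c + t))); first lra.
  rewrite (_ : Rabs t / (c * (c + t)) * (c * (c + t)) = Rabs t); last by field; lra.
  apply: (Rle_trans _ (e / 2)); first by apply: Rabs_le; lra.
  nra.
by move/Rabs_le_between: B; lra.
Qed.

(* [ln phi] has derivative [w / y], and [w] tends to [1 / c]. *)
Lemma inverse_lower x0 c h th th1 th2 phi g : regular x0 c h th th1 th2 -> inverse_on_ray x0 h phi ->
  g < / c -> exists C Y, 0 < C /\ forall y, Y <= y -> C * Rpower y g <= phi y.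
Proof.
move=> rg inv gc; have x01 := reg_x0 _ _ _ _ _ _ rg.
have [Y1 H1] := inv_w_limit _ _ _ _ _ _ _ (/ c - g) rg inv ltac:(lra).
have [Y2 [_ H2]] := inverse_eventually _ _ _ _ _ _ _ 1 rg inv.
have [Y3 [Y31 H3]] := inverse_calculus _ _ _ _ _ _ _ rg inv.
pose Y := Rmax Y1 (Rmax Y2 Y3).
have [m1 /Rmax_le [m2 m3]] := Rmax_le _ _ _ (Rle_refl Y).
pose u y := ln (phi y) - g * ln y.
exists (exp (u Y)), Y; split; first exact: exp_pos.
move=> y hy.
have p1 s : Y <= s -> 1 <= phi s by move=> hs; have [_ []] := H2 s ltac:(lra).
have [||z hz E] := mvt u (fun s => (inv_w c th phi s - g) / s) Y y; first lra.
  move=> s hs; have [d _] := H3 s ltac:(lra); have ps := p1 s ltac:(lra).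
  rewrite /u; auto_derive; first by repeat split; [exists (phi s * inv_w c th phi s / s) | lra | lra].
  by rewrite (is_derive_unique _ _ _ d); field; lra.
have inc : u Y <= u y.
  have w := H1 z ltac:(lra).
  have : 0 <= (inv_w c th phi z - g) / z by apply: Rdiv_le_0_compat; lra.
  nra.
have py := p1 y ltac:(lra).
rewrite -(exp_ln (phi y)); last lra.
rewrite /Rpower -exp_plus; have : u Y + g * ln y <= ln (phi y) by rewrite /u in inc *; lra.
case/Rle_lt_or_eq_dec => [h2|->]; [exact/Rlt_le/exp_increasing | lra].
Qed.

Lemma Rpower_eventually_ge (C a : R) : 0 < C -> 0 < a -> exists Y, 1 <= Y /\ forall y, Y <= y -> C <= Rpower y a.
Proof.
move=> C0 a0; have r0 := Rpower_gt0 C (/ a); exists (1 + Rpower C (/ a)); split; first lra.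
move=> y hy; apply: (Rle_trans _ (Rpower (Rpower C (/ a)) a)).
  by rewrite Rpower_mult Rinv_l ?Rpower_1; lra.
by apply: Rle_Rpower_l; lra.
Qed.

(** Let E = c - 1 + theta, which is at most 1/15 + 3/100 < 1/10 eventually. From w (1 + E) = 1 one
    gets w - w^2 = w^2 E, so G is close to phi w^2 E. As E may tend to 0, the terms with p and r are
    harmless only because they are at most E / 100. *)
Lemma inverse_phase x0 c h th th1 th2 phi : regular x0 c h th th1 th2 -> inverse_on_ray x0 h phi ->
  c < 16 / 15 ->
  exists Y, phase Y phi (fun y => phi y * inv_w c th phi y / y)
     (inv_G c th th1 phi) (inv_G1 c th th1 th2 phi) /\
    forall y, Y <= y -> 8 / 10 * (phi y * (c - 1 + th (phi y))) <= inv_G c th th1 phi y <= 2 * y.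
Proof.
move=> rg inv c16; have c1 := reg_c _ _ _ _ _ _ rg; have x01 := reg_x0 _ _ _ _ _ _ rg.
have [X1 HX1] := reg_lim _ _ _ _ _ _ rg (3 / 100) ltac:(lra).
have [X2 HX2] := reg_small _ _ _ _ _ _ rg (1 / 100) ltac:(lra).
have [Y1 [Y11 H1]] := inverse_calculus _ _ _ _ _ _ _ rg inv.
have [Y2 [Y21 H2]] := inverse_eventually _ _ _ _ _ _ _ (Rmax X1 X2) rg inv.
suff main y : Rmax Y1 Y2 <= y -> 0 < inv_G c th th1 phi y /\
    8 / 10 * (phi y * (c - 1 + th (phi y))) <= inv_G c th th1 phi y <= 2 * y /\
    inv_G c th th1 phi y / 2 <= y * inv_G1 c th th1 th2 phi y <= 2 * inv_G c th th1 phi y.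
  have m1 := Rmax_l Y1 Y2; have m2 := Rmax_r Y1 Y2.
  exists (Rmax Y1 Y2); split; last by move=> y /main; lra.
  split; first lra.
  move=> y hy; have [d1 [d2 d3]] := H1 y ltac:(lra); have := main y hy; repeat split => //; lra.
move=> /Rmax_le [m1 m2].
have [q1 [/Rmax_le [n1 n2] [q3 [q4 q5]]]] := H2 y m2.
have t := Rabs_def2 _ _ (HX1 (phi y) n1).
have [e0 [hp hr]] := HX2 (phi y) n2.
have -> : y * inv_G1 c th th1 th2 phi y = inv_w c th phi y * inv_G c th th1 phi y +
   phi y * (- inv_p th1 phi y * inv_w c th phi y ^ 3 + 2 * inv_p th1 phi y * inv_w c th phi y ^ 4 +
     (inv_p th1 phi y + inv_r th2 phi y) * inv_w c th phi y ^ 4 -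
     3 * inv_p th1 phi y ^ 2 * inv_w c th phi y ^ 5).
  by rewrite /inv_G1; field; lra.
rewrite -/(inv_p th1 phi y) in hp; rewrite -/(inv_r th2 phi y) in hr.
have wE : inv_w c th phi y * (1 + (c - 1 + th (phi y))) = 1 by rewrite /inv_w; field; lra.
rewrite /inv_G; move: (inv_w c th phi y) wE (inv_p th1 phi y) hp (inv_r th2 phi y) hr.
move: (c - 1 + th (phi y)) e0 (ltac:(lra) : c - 1 + th (phi y) <= 1 / 10).
move: (phi y) q3 q4 => f f0 fy E E0 E1 w wE p hp r hr.
have f1 : 0 < f by lra.
have w1 : 9 / 10 <= w <= 1 by nra.
have ww : w - w ^ 2 = w ^ 2 * E.
  have : w * (w * (1 + E)) = w * 1 by rewrite wE.
  by rewrite /pow; lra.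
have {}hp : - (E / 100) <= p <= E / 100 by move/Rabs_le_between: hp; lra.
have {}hr : - (E / 100) <= r <= E / 100 by move/Rabs_le_between: hr; lra.
rewrite ww.
have w2 : 81 / 100 <= w ^ 2 <= 1 by rewrite /pow; nra.
have w30 : w ^ 3 = w ^ 2 * w by ring.
have w40 : w ^ 4 = w ^ 2 * w ^ 2 by ring.
have w50 : w ^ 5 = w ^ 2 * (w ^ 2 * w) by ring.
rewrite w30 w40 w50; move: (w ^ 2) w2 => v hv.
have vw : 0 <= v * w <= 1 by nra.
pose S := E + p * w.
have S1 : 99 / 100 * E <= S <= 101 / 100 * E.
  have : - (E / 100) <= p * w <= E / 100 by nra.
  rewrite /S; lra.
have -> : v * E + p * (v * w) = v * S by rewrite /S; ring.
(* Now G = phi w^2 S and y G' = phi w^2 (w S + T), with S close to E, T at most 7 E / 100 and w in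
   [9/10, 1]; so y G' is close to w G. *)
pose T := - p * w + 2 * p * v + (p + r) * v - 3 * p ^ 2 * (v * w).
have T1 : - (7 / 100 * E) <= T <= 7 / 100 * E.
  have a1 : - (E / 100) <= p * w <= E / 100 by clear -E0 hp w1; nra.
  have a2 : - (E / 100) <= p * v <= E / 100 by clear -E0 hp hv; nra.
  have a3 : - (E / 100) <= r * v <= E / 100 by clear -E0 hr hv; nra.
  have a4 : 0 <= p ^ 2 <= E / 100 * (1 / 1000) by clear -E0 E1 hp; rewrite /pow; nra.
  have a5 : 0 <= p ^ 2 * (v * w) <= E / 100 * (1 / 1000) by clear -a4 vw; nra.
  rewrite /T; lra.
have -> : - p * (v * w) + 2 * p * (v * v) + (p + r) * (v * v) - 3 * p ^ 2 * (v * (v * w)) = v * T.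
  by rewrite /T; ring.
have fv : 0 < f * v by nra.
have -> : f * (v * S) = f * v * S by ring.
have -> : w * (f * v * S) + f * (v * T) = f * v * (w * S + T) by ring.
have ES : E <= 100 / 99 * S by lra.
split; first by apply: Rmult_lt_0_compat; lra.
split; last first.
  split.
    rewrite /Rdiv Rmult_assoc; apply: Rmult_le_compat_l; first lra.
    have : 9 / 10 * S <= w * S by nra.
    lra.
  rewrite (_ : 2 * (f * v * S) = f * v * (2 * S)); last by ring.
  apply: Rmult_le_compat_l; first lra.
  have : w * S <= 1 * S by nra.
  lra.
split.
  rewrite Rmult_comm (Rmult_assoc f) (Rmult_assoc f); apply: Rmult_le_compat_l; first lra.
  nra.
apply: (Rle_trans _ (f * 1)); last lra.
rewrite Rmult_assoc; apply: Rmult_le_compat_l; nra.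
Qed.

(** Here c < 16/15 gives phi y of order at least y^(15/16), and c - 1 + theta costs phi^(1/100).
    Since 15/16 * 99/100 > 9/10 + 1/100, a power y^(1/100) is left to absorb the constants. *)
Lemma inverse_growth x0 c h th th1 th2 phi : regular x0 c h th th1 th2 -> inverse_on_ray x0 h phi ->
  c < 16 / 15 -> growth (inv_G c th th1 phi).
Proof.
move=> rg inv c16; have c1 := reg_c _ _ _ _ _ _ rg; have x01 := reg_x0 _ _ _ _ _ _ rg.
have [Y1 [_ H1]] := inverse_phase _ _ _ _ _ _ _ rg inv c16.
have ic : 15 / 16 < / c.
  by rewrite (_ : 15 / 16 = / (16 / 15)); [apply: Rinv_lt_contravar; lra | field].
have [C1 [Y2 [C10 H2]]] := inverse_lower _ _ _ _ _ _ _ (15 / 16) rg inv ic.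
have [C2 [X [C20 HX]]] := reg_low _ _ _ _ _ _ rg (1 / 100) ltac:(lra).
have [Y3 [Y31 H3]] := inverse_eventually _ _ _ _ _ _ _ (Rmax 1 X) rg inv.
pose C := 8 / 10 * (C2 * Rpower C1 (99 / 100)).
have r1 := Rpower_gt0 C1 (99 / 100).
have C0 : 0 < C by rewrite /C; nra.
have [Y4 [Y41 H4]] := Rpower_eventually_ge (/ C) (1 / 100) (Rinv_0_lt_compat _ C0) ltac:(lra).
exists (Rmax (Rmax Y1 Y2) (Rmax Y3 Y4)) => y /Rmax_le [/Rmax_le [m1 m2] /Rmax_le [m3 m4]].
have [g1 g2] := H1 y m1; split=> //.
apply: Rle_trans g1.
have [q1 [/Rmax_le [n1 n2] [q3 [q4 q5]]]] := H3 y m3.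
have low := HX (phi y) n2; have l2 := H2 y m2; have l4 := H4 y m4.
have y1 : 1 <= y by lra.
have ry := Rpower_gt0 y (15 / 16).
apply: (Rle_trans _ (8 / 10 * (C2 * Rpower (phi y) (99 / 100)))); last first.
  apply: Rmult_le_compat_l; first lra.
  have -> : C2 * Rpower (phi y) (99 / 100) = phi y * (C2 * Rpower (phi y) (- (1 / 100))).
    rewrite (_ : 99 / 100 = 1 + - (1 / 100)); last by field.
    by rewrite Rpower_plus Rpower_1; [ring | lra].
  by apply: Rmult_le_compat_l; lra.
apply: (Rle_trans _ (C * Rpower y (15 / 16 * (99 / 100)))); last first.
  rewrite /C Rmult_assoc Rmult_assoc; apply: Rmult_le_compat_l; first lra; apply: Rmult_le_compat_l; first lra.
  rewrite -Rpower_mult Rpower_mult_distr //.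
  by apply: Rle_Rpower_l; [lra | split => //; nra].
apply: (Rle_trans _ (C * (Rpower y (1 / 100) * Rpower y (9 / 10)))).
  rewrite -Rmult_assoc -{1}(Rmult_1_l (Rpower y (9 / 10))); apply: Rmult_le_compat_r.
    exact/Rlt_le/Rpower_gt0.
  by apply: (Rmult_le_reg_l (/ C)); [exact: Rinv_0_lt_compat | rewrite -Rmult_assoc Rinv_l; lra].
by apply: Rmult_le_compat_l; [lra | apply: Rpower_mult_le; lra].
Qed.

Lemma exp_sub1_bound v : Rabs v <= 1 / 2 -> Rabs (exp v - 1) <= 2 * Rabs v.
Proof.
move=> /Rabs_le_between hv; have h1 := exp_ineq1_le v; have h2 := exp_ineq1_le (- v).
have e0 := exp_pos v; have ee : exp v * exp (- v) = 1 by rewrite -exp_plus Rplus_opp_r exp_0.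
have h3 : exp v * (1 - v) <= 1 by nra.
by split_Rabs; nra.
Qed.

(** With psi ~ phi' = phi w / y and psi' ~ phi'' = - G / y^2 one finds |psi'| <= 16 psi / y, while
    [inverse_lower] bounds phi' below by nearly y^(1/c - 1). *)
Lemma slow_weight_of_regular x0 c h th th1 th2 phi psi : regular x0 c h th th1 th2 ->
  inverse_on_ray x0 h phi -> c < 17 / 16 -> admissible_psi phi psi -> slow_weight (1 - / c) psi.
Proof.
move=> rg inv c17 [psi0 [psi1 [psi2 [C2 [as1 [as2 _]]]]]].
have c1 := reg_c _ _ _ _ _ _ rg; have x01 := reg_x0 _ _ _ _ _ _ rg.
have ic : 16 / 17 < / c.
  by rewrite (_ : 16 / 17 = / (17 / 16)); [apply: Rinv_lt_contravar; lra | field].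
have ic1 : / c <= 1 by rewrite -Rinv_1; apply: Rinv_le_contravar; lra.
have [Y1 [Y11 H1]] := inverse_calculus _ _ _ _ _ _ _ rg inv.
have [X2 HX2] := reg_small _ _ _ _ _ _ rg 1 ltac:(lra).
have [X3 HX3] := reg_lim _ _ _ _ _ _ rg (1 / 10) ltac:(lra).
have [Y2 [Y21 H2]] := inverse_eventually _ _ _ _ _ _ _ (Rmax X2 X3) rg inv.
have [Y3 H3] := inv_w_limit _ _ _ _ _ _ _ (1 / 10) rg inv ltac:(lra).
have [Y4 H4] := is_lim_infty_eventually _ _ (1 / 2) as1 ltac:(lra).
have [Y5 H5] := is_lim_infty_eventually _ _ (1 / 2) as2 ltac:(lra).
pose D y := phi y * inv_w c th phi y / y.
have base : exists Y, 2 <= Y /\ forall y, Y <= y ->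
    [/\ 0 < phi y, 8 / 10 <= inv_w c th phi y <= 12 / 10, D y / 2 <= psi y <= 2 * D y &
     Rabs (psi1 y) <= 16 * psi y / y].
  (* The added 2 ensures that the formula for phi' holds in a neighbourhood of radius 1, as needed
     to differentiate it again. *)
  exists (2 + (Rmax (Rmax Y1 Y2) (Rmax Y3 (Rmax Y4 Y5)))).
  split; first by have := Rmax_l (Rmax Y1 Y2) (Rmax Y3 (Rmax Y4 Y5)); have := Rmax_l Y1 Y2; lra.
  move=> y hy; set R := Rmax (Rmax Y1 Y2) _ in hy.
  have [/Rmax_le [m3 m4] /Rmax_le [m5 /Rmax_le [m7 m8]]] := Rmax_le _ _ _ (Rle_refl R).
  have [q1 [/Rmax_le [n1 n2] [q3 [q4 q5]]]] := H2 y ltac:(lra).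
  have w := H3 y ltac:(lra).
  have [d1 [d2 _]] := H1 y ltac:(lra).
  have [_ [pb _]] := HX2 (phi y) ltac:(lra).
  have t := Rabs_def2 _ _ (HX3 (phi y) ltac:(lra)).
  rewrite -/(inv_p th1 phi y) in pb.
  have D0 : 0 < D y by apply: Rdiv_lt_0_compat; [apply: Rmult_lt_0_compat; lra | lra].
  have E1 : Derive_n phi 1 y = D y by exact: is_derive_unique.
  have E2 : Derive_n phi 2 y = - inv_G c th th1 phi y / y ^ 2.
    transitivity (Derive D y); last exact: is_derive_unique.
    apply: Derive_ext_loc; have e0 : 0 < 1 by lra.
    exists (mkposreal _ e0) => z /= hz; apply: is_derive_unique.
    have : y - 1 < z by move: hz; rewrite /ball /= /AbsRing_ball /abs /minus /plus /opp /= => /Rabs_def2; lra.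
    by move=> hz2; have [] := H1 z ltac:(lra).
  have := Rabs_def2 _ _ (H4 y ltac:(lra)); have := Rabs_def2 _ _ (H5 y ltac:(lra)).
  rewrite E1 E2; set g := - _ / _ => r2 r1.
  have p1 : psi y = psi y / D y * D y by field; lra.
  have pD : D y / 2 <= psi y <= 2 * D y by rewrite p1; nra.
  split=> //; try lra.
  (* Division by 0 returns 0, so a quotient within 1/2 of 1 has a nonzero denominator. *)
  have g0 : g <> 0.
    by move=> gz; move: r2; rewrite gz /Rdiv Rinv_0; lra.
  have pg : Rabs (psi1 y) <= 2 * Rabs g.
    have -> : psi1 y = psi1 y / g * g by field.
    rewrite Rabs_mult; apply: Rmult_le_compat_r; first exact: Rabs_pos.
    by apply: Rabs_le; lra.
  have gb : Rabs g <= 4 * D y / y.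
    rewrite /g /inv_G; set W := inv_w c th phi y in w *; set p := inv_p th1 phi y in pb *.
    have -> : - (phi y * (W - W ^ 2 + p * W ^ 3)) / y ^ 2 = D y / y * (- (1 - W + p * W ^ 2)).
      by rewrite /D -/W; field; lra.
    rewrite Rabs_mult (Rabs_pos_eq (D y / y)); last by apply: Rdiv_le_0_compat; lra.
    rewrite (_ : 4 * D y / y = D y / y * 4); last by field; lra.
    apply: Rmult_le_compat_l; first by apply: Rdiv_le_0_compat; lra.
    have pb2 : - (1 / 4) <= p <= 1 / 4 by move/Rabs_le_between: pb; lra.
    have W2 : 0 <= W ^ 2 <= 2.
      by split; [exact: pow2_ge_0 | apply: Rle_trans (pow_incr _ (12 / 10) 2 _) _; rewrite /pow; lra].
    have pW : - (1 / 2) <= p * W ^ 2 <= 1 / 2 by clear -pb2 W2; move: (W ^ 2) W2 => v hv; nra.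
    by rewrite Rabs_Ropp; apply: Rabs_le; lra.
  apply: Rle_trans pg _; have : 4 * D y / y <= 8 * psi y / y; last lra.
  by apply: Rmult_le_compat_r; [apply/Rlt_le/Rinv_0_lt_compat; lra | lra].
have [Y [Y20 HY]] := base.
have dpsi y : 1 < y -> is_derive psi y (psi1 y).
  by move=> hy; have [d _] := C2 y (Rlt_le _ _ hy); exact: D_in_is_derive d hy.
split; first by move=> n n0; apply: psi0; exact: INR_ge1.
split.
  exists 32, (Rmax 32 Y); split; first lra.
  move=> n hn n0; have [m1 m2] := Rmax_le _ _ _ hn.
  set x := INR n in hn m1 m2 *; have xS : INR n.+1 = x + 1 by exact: S_INR.
  have pp y : 1 <= y -> 0 < psi y by move=> /psi0; lra.
  (* The bound sought is relative to psi (n + 1), hence the logarithm; [exp_sub1_bound] returns to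
     psi and doubles 16 to 32. *)
  have [||z hz E] := mvt (fun s => ln (psi s)) (fun s => psi1 s / psi s) x (x + 1); first lra.
    move=> s hs; have d := dpsi s ltac:(lra); have ps := pp s ltac:(lra).
    auto_derive; first by split; [exists (psi1 s) | split].
    by rewrite (is_derive_unique _ _ _ d); field; lra.
  rewrite xS; set v := ln (psi x) - ln (psi (x + 1)).
  have p0 := pp x ltac:(lra); have p1 := pp (x + 1) ltac:(lra); have pz := pp z ltac:(lra).
  have vb : Rabs v <= 16 / x.
    have -> : v = - (psi1 z / psi z) by rewrite /v; lra.
    rewrite Rabs_Ropp Rabs_div ?(Rabs_pos_eq (psi z)); try lra.
    have [_ _ _ b] := HY z ltac:(lra).
    apply: (Rle_trans _ (16 / z)).
      apply: (Rmult_le_reg_r (psi z)) => //.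
      rewrite (_ : Rabs (psi1 z) / psi z * psi z = Rabs (psi1 z)); last by field; lra.
      by rewrite (_ : 16 / z * psi z = 16 * psi z / z); [|field; lra].
    by apply: Rmult_le_compat_l; [lra | apply: Rinv_le_contravar; lra].
  have x32 : 16 / x <= 1 / 2.
    apply: (Rmult_le_reg_r x); first lra.
    by rewrite (_ : 16 / x * x = 16); [lra | field; lra].
  have ev : exp v = psi x / psi (x + 1).
    by rewrite /v /Rminus exp_plus exp_Ropp !exp_ln.
  have := exp_sub1_bound v ltac:(lra); rewrite ev => hb.
  have -> : psi (x + 1) - psi x = - (psi (x + 1) * (psi x / psi (x + 1) - 1)) by field; lra.
  rewrite Rabs_Ropp Rabs_mult (Rabs_pos_eq (psi (x + 1))); last lra.
  rewrite (_ : 32 * psi (x + 1) / x = psi (x + 1) * (2 * (16 / x))); last by field; lra.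
  by apply: Rmult_le_compat_l; lra.
move=> e e0.
have [C [Y6 [C0 H6]]] := inverse_lower _ _ _ _ _ _ _ (/ c - e / 2) rg inv ltac:(lra).
have [Y7 [Y71 H7]] := Rpower_eventually_ge (3 / C) (e / 2) ltac:(apply: Rdiv_lt_0_compat; lra) ltac:(lra).
exists (Rmax Y (Rmax Y6 Y7)) => n /Rmax_le [m1 /Rmax_le [m2 m3]] n0.
set x := INR n in m1 m2 m3 *.
have [f0 w [pl _] _] := HY x m1.
have l6 := H6 x m2; have l7 := H7 x m3.
have rx := Rpower_gt0 x (/ c - e / 2).
have lowD : C * Rpower x (/ c - e / 2) / (3 * x) <= psi x.
  apply: Rle_trans pl; rewrite /D.
  rewrite (_ : phi x * inv_w c th phi x / x / 2 = (phi x * inv_w c th phi x * (3 / 2)) / (3 * x)); last by field; lra.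
  apply: Rmult_le_compat_r; first by apply/Rlt_le/Rinv_0_lt_compat; lra.
  nra.
have lp : 0 < C * Rpower x (/ c - e / 2) / (3 * x) by apply: Rdiv_lt_0_compat; nra.
apply: (Rle_trans _ _ _ (Rinv_le_contravar _ _ lp lowD)).
have -> : / (C * Rpower x (/ c - e / 2) / (3 * x)) = 3 / C * (x * / Rpower x (/ c - e / 2)).
  by field; lra.
rewrite -Rpower_Ropp.
have -> : 1 - / c + e = e / 2 + (1 + - (/ c - e / 2)) by field; lra.
rewrite !Rpower_plus Rpower_1; last lra.
apply: Rmult_le_compat_r => //.
by apply: Rmult_le_pos; [lra | exact/Rlt_le/Rpower_gt0].
Qed.

(** * Complete sums and arithmetic progressions *)

(* Halving [N]: the windows [(N / 2, N]] contribute a convergent geometric series. *)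
Lemma dyadic_sum (th K C0 : R) (N0 : nat) : 0 < th <= 1 -> 0 <= K -> 0 <= C0 -> (0 < N0)%N ->
  exists K', forall u : nat -> C,
    (forall P P', (N0 <= P)%N -> (P <= P' <= 2 * P)%N ->
       Cmod (\sum_(P.+1 <= n < P'.+1) u n)%C <= K * Rpower (INR P) th) ->
    \sum_(1 <= n < 2 * N0) Cmod (u n) <= C0 ->
    forall N, (0 < N)%N -> Cmod (\sum_(1 <= n < N.+1) u n)%C <= K' * Rpower (INR N) th.
Proof.
move=> th0 K0 C00 N00.
(* The ratio of the geometric series: [uphalf N] is at most 3 N / 4 for the N that occur. *)
pose r := Rpower (3 / 4) th.
have r0 : 0 < r by exact: Rpower_gt0.
have r1 : r < 1.
  rewrite /r /Rpower -exp_0; apply: exp_increasing.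
  have : ln (3 / 4) < 0 by rewrite -ln_1; apply: ln_increasing; lra.
  nra.
(* The constant is fixed before u, which will carry the frequency xi. *)
exists (C0 + K / (1 - r)) => u Hw Hs N; have Kr : 0 <= K / (1 - r) by apply: Rdiv_le_0_compat; lra.
have [k] := ubnP N; elim: k N => // k IH N Nk Np.
have N1 : 1 <= Rpower (INR N) th by apply: Rpower_ge1; [exact: INR_ge1 | lra].
case: (ltnP N (2 * N0)) => hN.
  apply: (Rle_trans _ C0); last nra.
  apply: Rle_trans Hs; apply: Rle_trans (Cmod_sum _ _ _ _) _.
  rewrite (@big_cat_nat _ _ _ N.+1 1 (2 * N0)) //=.
  have : 0 <= \sum_(N.+1 <= n < 2 * N0) Cmod (u n) by apply: Rsum_ge0 => n _; exact: Cmod_ge_0.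
  lra.
set P := uphalf N; have PN : (P < N)%N by rewrite /P; lia.
have PP : (N0 <= P)%N by rewrite /P; lia.
have N2P : (N <= 2 * P)%N by rewrite /P; lia.
have P34 : (4 * P <= 3 * N)%N by rewrite /P; lia.
have P0 : (0 < P)%N by lia.
rewrite (@big_cat_nat _ _ _ P.+1) //=; last by lia.
apply: Rle_trans (Cmod_triangle _ _) _.
have h1 := IH P ltac:(lia) P0.
have h2 := Hw P N PP ltac:(lia).
have h3 : Rpower (INR P) th <= r * Rpower (INR N) th.
  rewrite /r Rpower_mult_distr; [|lra|exact: INR_gt0].
  apply: Rle_Rpower_l; first lra; split; first exact: INR_gt0.
  have i4 : INR 4 = 4 by rewrite /INR; lra.
  have i3 : INR 3 = 3 by rewrite /INR; lra.
  have := INR_leq _ _ P34; rewrite (INR_muln 4 P) (INR_muln 3 N) i4 i3; lra.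
have -> : (C0 + K / (1 - r)) * Rpower (INR N) th =
    C0 * Rpower (INR N) th + (K / (1 - r) + K) * (r * Rpower (INR N) th) +
    K * (1 - r) * Rpower (INR N) th.
  by field; lra.
have q1 : C0 * Rpower (INR P) th <= C0 * Rpower (INR N) th.
  by apply: Rmult_le_compat_l => //; nra.
have q2 : (K / (1 - r) + K) * Rpower (INR P) th <= (K / (1 - r) + K) * (r * Rpower (INR N) th).
  by apply: Rmult_le_compat_l; lra.
have q3 : 0 <= K * (1 - r) * Rpower (INR N) th by apply: Rmult_le_pos; nra.
lra.
Qed.

Lemma e2pi_eq1 x : e2pi x = RtoC 1 -> exists k : Z, x = IZR k.
Proof.
move=> h; have := Cmod_e2piB x 0; rewrite h e2pi_0 Rminus_0_r.
have -> : (RtoC 1 - RtoC 1)%C = RtoC 0 by ring.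
rewrite Cmod_0 => h2; have s0 : sin (PI * x) = 0.
  by case: (Req_dec (sin (PI * x)) 0) => // ne; have := Rabs_pos_lt _ ne; lra.
have [k hk] := sin_eq_0_0 _ s0; exists k; have := PI_RGT_0 => pp.
by apply: (Rmult_eq_reg_l PI); lra.
Qed.

(** If Q does not divide k, put x = k / Q: telescoping gives (e(x) - 1) S = e(k) - 1 = 0, and e(x)
    differs from 1. *)
Lemma character_sum (Q : nat) (k : Z) : (0 < Q)%N ->
  (\sum_(0 <= s < Q) e2pi (INR s * (IZR k / INR Q)) =
   if Zdivide_dec (Z.of_nat Q) k then RtoC (INR Q) else RtoC 0)%C.
Proof.
move=> Q0; have q0 := INR_gt0 _ Q0.
case: Zdivide_dec => [dv|nd] /=.
  case: dv => j ->.
  under eq_bigr => s _.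
    rewrite (_ : INR s * (IZR (j * Z.of_nat Q) / INR Q) = IZR (Z.of_nat s * j)); first rewrite e2pi_Z; first over.
    by rewrite !mult_IZR -!INR_IZR_INZ; field; lra.
  by rewrite -RtoC_sum Rsum_const subn0 Rmult_1_r.
set S := (\sum_(_ <= _ < _) _)%C; set x := IZR k / INR Q in S *.
have E : ((e2pi x - RtoC 1) * S = RtoC 0)%C.
  transitivity (\sum_(0 <= s < Q) (e2pi (INR s.+1 * x) - e2pi (INR s * x)))%C.
    rewrite Csum_mull; apply: eq_bigr => s _.
    by rewrite S_INR Rmult_plus_distr_r Rmult_1_l e2piD; ring.
  rewrite (Csum_telescope (fun s => e2pi (INR s * x))) // (_ : INR 0 * x = 0) ?e2pi_0.
    by rewrite (_ : INR Q * x = IZR k) ?e2pi_Z; [ring | rewrite /x; field; lra].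
  by rewrite (_ : INR 0 = 0) //; ring.
case: (Ceq_dec (e2pi x) (RtoC 1)) => h.
  case: nd; have [j hj] := e2pi_eq1 _ h; exists j; apply: eq_IZR.
  by rewrite mult_IZR -INR_IZR_INZ -hj /x; field; lra.
have nz : (e2pi x - RtoC 1)%C <> RtoC 0.
  by move=> z; apply: h; rewrite -(Cplus_0_r (RtoC 1)) -z; ring.
by rewrite -(Cmult_1_l S) -(Cinv_l _ nz) -Cmult_assoc E Cmult_0_r.
Qed.

Lemma sum_n_m_bigop (f : nat -> C) N : sum_n_m f 1 N = (\sum_(1 <= n < N.+1) f n)%C.
Proof.
elim: N => [|N IH]; first by rewrite sum_n_m_zero ?big_geq //; lia.
rewrite sum_n_Sm; last by lia.
by rewrite IH [RHS]big_nat_recr.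
Qed.

Lemma nat_primeE n : nat_prime n <-> prime n.
Proof.
split=> [pn|/primeP [n1 H]].
  have [p1 _] := pn; apply/primeP; split; first lia.
  move=> d /dvdnP [k nE].
  have dv : (Z.of_nat d | Z.of_nat n)%Z by exists (Z.of_nat k); lia.
  by have := prime_divisors _ pn _ dv; rewrite /=; lia.
apply/prime_alt; split; first lia.
move=> m hm [k nE].
have dv : (Z.to_nat m %| n)%N by apply/dvdnP; exists (Z.to_nat k); nia.
by have := H _ dv; rewrite /=; lia.
Qed.

Lemma mod_eq_divide (n a q : Z) : (0 < q)%Z -> (n mod q = a mod q <-> (q | n - a))%Z.
Proof.
move=> q0; split=> [h|[k hk]].
  exists (n / q - a / q)%Z.
  by have := Z.div_mod n q ltac:(lia); have := Z.div_mod a q ltac:(lia); lia.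
by rewrite (_ : n = a + k * q)%Z ?Z_mod_plus_full; lia.
Qed.

(** The coefficient of e(n xi) in the difference of the two sums of the theorem, before restriction
    to a residue class. *)
Definition prime_weight (x0 : R) (h phi psi : R -> R) (n : nat) : R :=
  prime_log n * (/ psi (INR n) *
    (if excluded_middle_informative (set_B x0 h phi psi n) then 1 else 0) - 1).

(** Beyond N0 the domain condition in [set_B] holds and [window_bound] applies. The finitely many
    smaller terms are bounded by C0, which depends neither on N nor on xi. *)
Lemma prime_weight_sum x0 h phi psi Y F1 G G1 d chi : phase Y phi F1 G G1 -> growth G ->
  slow_weight d psi -> 0 <= d -> 0 < chi -> 17 * d + 31 * chi <= 1 ->
  exists K, forall N xi, (0 < N)%N ->
    Cmod (\sum_(1 <= n < N.+1) (RtoC (prime_weight x0 h phi psi n) * e2pi (xi * INR n)))%C <=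
    K * Rpower (INR N) (1 - chi - 1 / 1000).
Proof.
move=> ph gr sw d0 chi0 hd.
have [K [Y' [K0 HK]]] := window_bound _ _ _ _ _ d psi chi ph gr sw d0 chi0 hd.
have [N0 [N1 _]] := ceil_nat_exists (Rmax 1 (Rmax Y' (h x0))) (Rle_trans _ _ _ Rle_0_1 (Rmax_l _ _)).
have [m1 /Rmax_le [m2 m3]] := Rmax_le _ _ _ N1.
have N00 : (0 < N0)%N by apply/leP/INR_lt; rewrite (_ : INR 0 = 0) //; lra.
pose C0 := \sum_(1 <= n < 2 * N0) Rabs (prime_weight x0 h phi psi n).
have C00 : 0 <= C0 by apply: Rsum_ge0 => n _; exact: Rabs_pos.
have th0 : 0 < 1 - chi - 1 / 1000 <= 1 by lra.
have [K' HK'] := dyadic_sum _ K C0 N0 th0 (Rlt_le _ _ K0) C00 N00.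
exists K' => N xi; apply: HK'.
  move=> P P' hP hP'; have PN : INR N0 <= INR P by exact: INR_leq.
  have := HK P P' xi ltac:(lra) hP'.
  rewrite (eq_big_nat _ _ (F2 := fun n => (RtoC (prime_weight x0 h phi psi n) * e2pi (xi * INR n))%C)) //.
  move=> n hn; rewrite /prime_weight /psi_indicator; congr (RtoC (_ * (_ * _ - _)) * _)%C.
  have nP : INR P <= INR n by apply: INR_leq; lia.
  case: Rlt_dec => b1; case: excluded_middle_informative => b2 //=; exfalso.
    by apply: b2; split; [lra | exact: b1].
  by apply: b1; case: b2.
by right; apply: eq_bigr => n _; rewrite Cmod_mult Cmod_e2pi Cmod_R Rmult_1_r.
Qed.

(** The sum over a residue class is an average, with factor 1 / q, of q full sums at the frequencies
    xi + s / q. The same K therefore serves for every a and q. *)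
Lemma prime_weight_progression (x0 : R) (h phi psi : R -> R) (K th : R) :
  (forall N xi, (0 < N)%N ->
    Cmod (\sum_(1 <= n < N.+1) (RtoC (prime_weight x0 h phi psi n) * e2pi (xi * INR n)))%C <=
    K * Rpower (INR N) th) ->
  forall (a q : Z) (N : nat) (xi : R), (0 < q)%Z -> (1 <= N)%coq_nat ->
  Cmod
    (Cminus
       (sum_upto N
          (fun p => nat_prime p /\ set_B x0 h phi psi p /\ (Z.of_nat p mod q = a mod q)%Z)
          (fun p => Cmult (RtoC (/ psi (INR p) * ln (INR p))) (e2pi (INR p * xi))))
       (sum_upto N
          (fun p => nat_prime p /\ (Z.of_nat p mod q = a mod q)%Z)
          (fun p => Cmult (RtoC (ln (INR p))) (e2pi (INR p * xi))))) <= K * Rpower (INR N) th.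
Proof.
move=> H a q N xi q0 /leP N0.
pose Q := Z.to_nat q; have QE : Z.of_nat Q = q by rewrite /Q; lia.
have Q0 : (0 < Q)%N by rewrite /Q; lia.
have rQ := INR_gt0 _ Q0.
pose g := prime_weight x0 h phi psi.
rewrite /sum_upto !sum_n_m_bigop Csum_sub.
set S := (\sum_(_ <= _ < _) _)%C.
have -> : S = (
   RtoC (/ INR Q) * \sum_(0 <= s < Q) (e2pi (- (INR s * (IZR a / INR Q))) *
     \sum_(1 <= n < N.+1) (RtoC (g n) * e2pi ((xi + INR s / INR Q) * INR n))))%C.
  rewrite /S; under [X in (_ = _ * X)%C]eq_bigr => s _ do rewrite Csum_mull.
  rewrite exchange_big Csum_mull; apply: eq_big_nat => n hn /=.
  have -> : (\sum_(0 <= s < Q) (e2pi (- (INR s * (IZR a / INR Q))) *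
      (RtoC (g n) * e2pi ((xi + INR s / INR Q) * INR n))) =
     RtoC (g n) * e2pi (INR n * xi) * \sum_(0 <= s < Q) e2pi (INR s * (IZR (Z.of_nat n - a) / INR Q)))%C.
    rewrite Csum_mull; apply: eq_bigr => s _.
    rewrite (_ : (xi + INR s / INR Q) * INR n =
      INR n * xi + (INR s * (IZR (Z.of_nat n - a) / INR Q) + INR s * (IZR a / INR Q))); last first.
      by rewrite minus_IZR -INR_IZR_INZ; field; lra.
    have inv := e2piD (- (INR s * (IZR a / INR Q))) (INR s * (IZR a / INR Q)).
    rewrite Rplus_opp_l e2pi_0 in inv.
    rewrite !e2piD; move: inv; move: (e2pi (- _)) (e2pi (INR s * (IZR a / INR Q))) => y z inv.
    transitivity ((y * z) * (RtoC (g n) * e2pi (INR n * xi) * e2pi (INR s * (IZR (Z.of_nat n - a) / INR Q))))%C.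
      by ring.
    by rewrite -inv; ring.
  rewrite character_sum // QE.
  have Qi : (RtoC (/ INR Q) * RtoC (INR Q) = RtoC 1)%C by rewrite -RtoC_mult Rinv_l; [|lra].
  have md := mod_eq_divide (Z.of_nat n) a q q0.
  have z0 : (@zero C_AbelianMonoid : C) = RtoC 0 by [].
  case: Zdivide_dec => dv /=; last first.
    rewrite !Cmult_0_r; case: excluded_middle_informative => [[_ [_ /md //]]|_] /=.
    by case: excluded_middle_informative => [[_ /md //]|_] /=; rewrite ?z0; ring.
  transitivity (RtoC (g n) * e2pi (INR n * xi))%C; last first.
    transitivity ((RtoC (/ INR Q) * RtoC (INR Q)) * (RtoC (g n) * e2pi (INR n * xi)))%C; last by ring.
    by rewrite Qi; ring.
  have cong : (Z.of_nat n mod q)%Z = (a mod q)%Z by apply/md.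
  rewrite /g /prime_weight /prime_log.
  case: (boolP (prime n)) => pn; last first.
    have npn : ~ nat_prime n by move/nat_primeE => h2; rewrite h2 in pn.
    case: excluded_middle_informative => [[//]|_] /=.
    by case: excluded_middle_informative => [[//]|_] /=; rewrite ?z0 Rmult_0_l; ring.
  have npn : nat_prime n by apply/nat_primeE.
  case: (excluded_middle_informative (nat_prime n /\ _ = _)) => [_|[]] //=.
  case: (excluded_middle_informative (set_B _ _ _ _ _)) => b /=.
    case: excluded_middle_informative => [_|[]] //=.
    by rewrite Rmult_1_r RtoC_mult RtoC_mult RtoC_minus; ring.
  case: excluded_middle_informative => [[_ [//]]|_] /=.
  by rewrite z0 Rmult_0_r RtoC_mult RtoC_minus; ring.
rewrite Cmod_mult Cmod_R Rabs_pos_eq; last exact/Rlt_le/Rinv_0_lt_compat.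
apply: (Rmult_le_reg_l (INR Q)) => //.
rewrite -Rmult_assoc Rinv_r ?Rmult_1_l; last lra.
apply: Rle_trans (Cmod_sum _ _ _ _) _.
apply: (Rle_trans _ (\sum_(0 <= s < Q) (K * Rpower (INR N) th))); last by rewrite Rsum_const subn0; lra.
apply: Rsum_le_nat => s _; rewrite Cmod_mult Cmod_e2pi Rmult_1_l; exact: H.
Qed.

End PrimeSums.

Theorem lemma1p10 :
  forall (x0 c1 c2 : R) (h1 h2 phi1 phi2 psi : R -> R),
    1 <= x0 ->
    1 <= c1 < 16 / 15 ->
    1 <= c2 < 17 / 16 ->
    class_R x0 c1 h1 ->
    class_R x0 c2 h2 ->
    inverse_on_ray x0 h1 phi1 ->
    inverse_on_ray x0 h2 phi2 ->
    admissible_psi phi2 psi ->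
    forall chi : R,
      0 < chi ->
      16 * (1 - 1 / c1) + 17 * (1 - 1 / c2) + 31 * chi <= 1 ->
      exists chi' : R, 0 < chi' /\
      exists K : R,
        forall (a q : Z) (N : nat) (xi : R),
          (0 <= a <= q - 1)%Z ->
          Z.gcd a q = 1%Z ->
          (1 <= N)%nat ->
          Cmod
            (Cminus
               (sum_upto N
                  (fun p => nat_prime p /\ set_B x0 h1 phi1 psi p /\
                            (Z.of_nat p mod q = a mod q)%Z)
                  (fun p => Cmult (RtoC (/ psi (INR p) * ln (INR p)))
                                  (e2pi (INR p * xi))))
               (sum_upto N
                  (fun p => nat_prime p /\ (Z.of_nat p mod q = a mod q)%Z)
                  (fun p => Cmult (RtoC (ln (INR p))) (e2pi (INR p * xi)))))
          <= K * Rpower (INR N) (1 - chi - chi').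
Proof.
intros x0 c1 c2 h1 h2 phi1 phi2 psi hx0 hc1 hc2 R1 R2 I1 I2 A chi hchi hs.
destruct (PrimeSums.class_R_regular x0 c1 h1) as (t & t1 & t2 & rg1); try lra; trivial.
destruct (PrimeSums.class_R_regular x0 c2 h2) as (u & u1 & u2 & rg2); try lra; trivial.
destruct (PrimeSums.inverse_phase _ _ _ _ _ _ _ rg1 I1) as (Y & ph & _); try lra.
(* With 1 - 1/c1 >= 0 the hypothesis on chi yields 17 (1 - 1/c2) + 31 chi <= 1, the condition of
   [window_bound] with d = 1 - 1/c2. *)
assert (i1 : / c1 <= 1) by (rewrite <- Rinv_1; apply Rinv_le_contravar; lra).
assert (i2 : / c2 <= 1) by (rewrite <- Rinv_1; apply Rinv_le_contravar; lra).
destruct (PrimeSums.prime_weight_sum x0 h1 phi1 psi Y _ _ _ (1 - / c2) chi ph) as [K HK]; try lra.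
- apply (PrimeSums.inverse_growth _ _ _ _ _ _ _ rg1 I1); lra.
- apply (PrimeSums.slow_weight_of_regular _ _ _ _ _ _ _ _ rg2 I2); trivial; lra.
(* The margin e of [window_bound], one value for all admissible parameters. *)
- exists (1 / 1000); split; [lra | exists K].
  intros a q N xi ha _ hN.
  apply PrimeSums.prime_weight_progression; trivial; lia.
Qed.
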